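(* Let $\mathcal{Y}$ be a finite set, let $0\leq\alpha<1$ and $\theta>-\alpha$ be constants, and let $(Y_n:n\geq 1)$ be a sequence of $\mathcal{Y}$-valued random variables on a probability space $(\Omega,\mathcal{A},P)$, with $\nu$ the probability distribution of $Y_1$, satisfying $$P\bigl(Y_{n+1}\in B\mid Y_1,\ldots,Y_n\bigr)=\frac{\sum_{y\in B}(S_{n,y}-\alpha)\,I_{\{S_{n,y}\neq 0\}}+\bigl(\theta+\alpha\sum_{y\in\mathcal{Y}}I_{\{S_{n,y}\neq 0\}}\bigr)\,\nu(B)}{\theta+n}\quad\text{a.s.}$$ for all $B\subset\mathcal{Y}$ and $n\geq 1$, where $S_{n,y}=\sum_{k=1}^nI_{\{Y_k=y\}}$. Let $A\subset\mathcal{Y}$, $\mathcal{G}_n=\sigma(Y_1,\ldots,Y_n)$ (with $\mathcal{G}_0$ trivial), $X_n=I_A(Y_n)$, $Z_n=E(X_{n+1}\mid\mathcal{G}_n)$ and $\overline{X}_n=\frac1n\sum_{k=1}^nX_k$. Then $$E\Bigl\{\bigl(E(Z_{n+1}\mid\mathcal{G}_n)-Z_n\bigr)^2\Bigr\}=o(n^{-3})$$ (so that $Z_n$ converges a.s. to some random variable $Z$), and, with $C_n=\sqrt{n}(\overline{X}_n-Z_n)$ and $D_n=\sqrt{n}(Z_n-Z)$, $$(C_n,D_n)\longrightarrow\delta_0\times\mathcal{N}\bigl(0,Z(1-Z)\bigr)\quad\text{stably}.$$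
   Context: A kernel on a metric space $S$ is a collection $N=\{N(\omega):\omega\in\Omega\}$ of Borel probability measures on $S$ such that $\omega\mapsto N(\omega)(f)=\int f\,dN(\omega)$ is $\mathcal{A}$-measurable for each bounded Borel $f:S\to\mathbb{R}$. For $S$-valued random variables $T_n$ on $(\Omega,\mathcal{A},P)$, $T_n\to N$ stably means that $P(T_n\in\cdot\mid H)\to E(N(\cdot)\mid H)$ weakly for all $H\in\mathcal{A}$ with $P(H)>0$. $\mathcal{N}(a,b)$ is the Gaussian law on $\mathbb{R}$ with mean $a$ and variance $b\geq0$ ($\mathcal{N}(a,0)=\delta_a$). For a random variable $L\geq 0$, $\mathcal{N}(0,L)$ is the kernel $\omega\mapsto\mathcal{N}(0,L(\omega))$; $\delta_0$ is the constant kernel equal to the point mass at $0$. For kernels $M,N$ on $S$, $M\times N$ is the kernel on $S\times S$ given by $(M\times N)(\omega)=M(\omega)\times N(\omega)$. *)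

(* Defs.v *)
From HB Require Import structures.
From mathcomp Require Import all_boot all_order all_algebra.
From mathcomp Require Import all_classical all_reals all_analysis.
From mathcomp Require Import measurable_realfun.
Import Order.TTheory GRing.Theory Num.Theory.
Import numFieldNormedType.Exports.

Set Implicit Arguments.
Unset Strict Implicit.
Unset Printing Implicit Defensive.

Local Open Scope classical_set_scope.
Local Open Scope ring_scope.

(* [V] is a version of [E(X | G)]; [G] is meant to be a sub-sigma-algebra of
   the measurable sets of [T]. *)
Definition is_cond_exp d (T : measurableType d) (R : realType)
    (P : probability T R) (G : set_system T) (X V : T -> R) : Prop :=
  [/\ P.-integrable setT (EFin \o X),
      P.-integrable setT (EFin \o V),
      forall B : set R, measurable B -> G (V @^-1` B) &
      forall E, G E ->
        (\int[P]_(w in E) (V w)%:E = \int[P]_(w in E) (X w)%:E)%E].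

Section gaussian.
Context {R : realType}.

(* N(a, b), parametrized by its variance [b], whereas [normal_prob] takes the
   standard deviation and is not a point mass when the latter is 0. Only
   [0 <= b] is meaningful; for [b < 0] the value is the junk [\d_a]. *)
Definition gauss (a b : R) : set R -> \bar R :=
  if 0 < b then normal_prob a (Num.sqrt b) else \d_a.

Section gauss_probability.
Variables a b : R.

Let gauss0 : gauss a b set0 = 0%E.
Proof. by rewrite /gauss; case: ifP => _; exact: measure0. Qed.

Let gauss_ge0 U : (0 <= gauss a b U)%E.
Proof. by rewrite /gauss; case: ifP => _; exact: measure_ge0. Qed.

Let gauss_sigma_additive : semi_sigma_additive (gauss a b).
Proof.
rewrite /gauss; case: ifP => _; last exact: measure_semi_sigma_additive.
exact: (@measure_semi_sigma_additive _ (measurableTypeR R) R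
  (normal_prob a (Num.sqrt b))).
Qed.

HB.instance Definition _ := isMeasure.Build _ R R (gauss a b)
  gauss0 gauss_ge0 gauss_sigma_additive.

Let gauss_setT : gauss a b setT = 1%E.
Proof.
rewrite /gauss; case: ifP => _; last exact: diracT.
exact: (@probability_setT _ (measurableTypeR R) R
  (normal_prob a (Num.sqrt b))).
Qed.

HB.instance Definition _ :=
  Measure_isProbability.Build _ _ R (gauss a b) gauss_setT.

End gauss_probability.

Let dens (a : R) (p : R * R) : R :=
  expR (- ln (Num.sqrt (p.1 * (pi *+ 2)))) *
  expR (- (p.2 - a) ^+ 2 * expR (- ln (p.1 * 2))).

Let densE (a b x : R) : 0 < b -> normal_pdf a (Num.sqrt b) x = dens a (b, x).
Proof.
move=> b0; have p0 : 0 < pi *+ 2 :> R by rewrite mulrn_wgt0 ?pi_gt0.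
rewrite normal_pdfE ?gt_eqF ?sqrtr_gt0//.
rewrite /normal_peak /normal_fun /dens /= sqr_sqrtr ?ltW//.
rewrite -(mulrnAr b pi) -(mulr_natr b 2) !expRN.
by rewrite !lnK// posrE ?sqrtr_gt0 mulr_gt0.
Qed.

Let measurable_dens (a : R) : measurable_fun [set: R * R] (dens a).
Proof.
have m1 : measurable_fun [set: R * R] (@fst R R) by exact: measurable_fst.
have m2 : measurable_fun [set: R * R] (@snd R R) by exact: measurable_snd.
have msqrt : measurable_fun [set: R] (@Num.sqrt R).
  by apply: continuous_measurable_fun; exact: sqrt_continuous.
have mln := @measurable_ln R.
have mopp := @oppr_measurable R setT.
have mexp := @measurable_expR R.
apply: measurable_funM.
  apply: (measurableT_comp mexp); apply: (measurableT_comp mopp).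
  apply: (measurableT_comp mln); apply: (measurableT_comp msqrt).
  exact: measurable_funM.
apply: (measurableT_comp mexp); apply: measurable_funM.
  apply: (measurableT_comp mopp); apply: measurable_funX.
  exact: measurable_funB.
apply: (measurableT_comp mexp); apply: (measurableT_comp mopp).
by apply: (measurableT_comp mln); exact: measurable_funM.
Qed.

Lemma measurable_gauss (a : R) (U : set R) : measurable U ->
  measurable_fun [set: R] (fun b => gauss a b U).
Proof.
move=> mU.
pose h (p : R * R) := ((dens a p)%:E * (\1_U p.2)%:E)%E.
have h0 p : (0 <= h p)%E.
  by rewrite mule_ge0// lee_fin// mulr_ge0// expR_ge0.
have mh : measurable_fun [set: R * R] h.
  apply: emeasurable_funM.
    by apply/measurable_EFinP; exact: measurable_dens.
  apply/measurable_EFinP.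
  by apply: (@measurableT_comp _ _ _ _ _ _ (\1_U : R -> R)) => //.
have mF := @measurable_fun_fubini_tonelli_F _ _ R (measurableTypeR R) R
   (@lebesgue_measure R) h mh h0.
rewrite (_ : (fun b => _) = (fun b => if 0 < b then
    fubini_F (@lebesgue_measure R) h b else (\d_a U)%R)); last first.
  apply/funext => b; rewrite /gauss; case: ifPn => // b0.
  rewrite /normal_prob /fubini_F /h [LHS]integral_mkcond; apply: eq_integral => x _.
  rewrite patchE /= indicE; case: ifPn => _; last by rewrite mule0.
  by rewrite mule1 densE.
apply: measurable_fun_ifT => //; exact: measurable_fun_ltr.
Qed.

End gaussian.

Section gauss_kernel.
Context d (T : measurableType d) (R : realType).

(* The kernel [w |-> N(0, L w)]. *)
Definition gauss_kernel (L : {mfun T >-> R}) (w : T)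
  : {measure set R -> \bar R} := gauss 0 (L w).

Variable L : {mfun T >-> R}.

Let measurable_gauss_kernel U : measurable U ->
  measurable_fun [set: T] (gauss_kernel L ^~ U).
Proof.
by move=> mU; apply: (measurableT_comp (measurable_gauss 0 mU)).
Qed.

HB.instance Definition _ :=
  isKernel.Build _ _ T R R (gauss_kernel L) measurable_gauss_kernel.

Let prob_gauss_kernel w : gauss_kernel L w [set: R] = 1%E.
Proof. exact: probability_setT. Qed.

HB.instance Definition _ :=
  Kernel_isProbability.Build _ _ T R R (gauss_kernel L) prob_gauss_kernel.

End gauss_kernel.

Section kernel_prob.
Context d d' (T : measurableType d) (S : measurableType d') (R : realType).
Variables (N : R.-pker T ~> S) (w : T).

Definition kernel_prob : set S -> \bar R := N w.

HB.instance Definition _ := Measure.on kernel_prob.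

Let kernel_prob_setT : kernel_prob setT = 1%E.
Proof. exact: prob_kernel. Qed.

HB.instance Definition _ :=
  Measure_isProbability.Build _ _ R kernel_prob kernel_prob_setT.

End kernel_prob.

Section kernel_product.
Context d d1 d2 (T : measurableType d) (S1 : measurableType d1)
  (S2 : measurableType d2) (R : realType).
Variables (M : R.-pker T ~> S1) (N : R.-pker T ~> S2).

Definition prod_kernel_law (w : T) : set (S1 * S2) -> \bar R := (M w \x N w)%E.

Let MP w : probability S1 R := kernel_prob M w.
Let NP w : probability S2 R := kernel_prob N w.

Let law0 w : prod_kernel_law w set0 = 0%E.
Proof. exact: (measure0 (MP w \x NP w)%E). Qed.

Let law_ge0 w U : (0 <= prod_kernel_law w U)%E.
Proof. exact: (measure_ge0 (MP w \x NP w)%E). Qed.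

Let law_sigma_additive w : semi_sigma_additive (prod_kernel_law w).
Proof. exact: (@measure_semi_sigma_additive _ _ _ (MP w \x NP w)%E). Qed.

HB.instance Definition _ w := isMeasure.Build _ _ R (prod_kernel_law w)
  (law0 w) (law_ge0 w) (@law_sigma_additive w).

Definition prod_kernel (w : T) : {measure set (S1 * S2) -> \bar R} :=
  prod_kernel_law w.

Let N1 (wx : T * S1) : {measure set S2 -> \bar R} := N wx.1.

Let measurable_N1 U : measurable U -> measurable_fun setT (N1 ^~ U).
Proof.
move=> mU.
exact: (measurableT_comp (measurable_kernel N U mU) measurable_fst).
Qed.

HB.instance Definition _ :=
  isKernel.Build _ _ (T * S1)%type S2 R N1 measurable_N1.

Let prob_N1 wx : N1 wx setT = 1%E.
Proof. exact: prob_kernel. Qed.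

HB.instance Definition _ :=
  Kernel_isProbability.Build _ _ (T * S1)%type S2 R N1 prob_N1.

Let measurable_prod_kernel U : measurable U ->
  measurable_fun [set: T] (prod_kernel ^~ U).
Proof.
move=> mU.
pose U' : set (T * S1 * S2) := [set p | U (p.1.2, p.2)].
apply: (measurable_fun_integral_finite_kernel
  (fun wx : T * S1 => N wx.1 (xsection U wx.2)) M) => //.
rewrite (_ : (fun wx => _) = (fun wx => N1 wx (xsection U' wx))); last first.
  by apply/funext => -[w x].
apply: measurable_fun_xsection_finite_kernel.
  rewrite inE /U' -[X in measurable X]setTI.
  have m : measurable_fun setT (fun p : T * S1 * S2 => (p.1.2, p.2)).
    apply/measurable_fun_pairP; split; last exact: measurable_snd.
    exact: (measurableT_comp measurable_snd measurable_fst).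
  exact: m.
Qed.

HB.instance Definition _ :=
  isKernel.Build _ _ T (S1 * S2)%type R prod_kernel measurable_prod_kernel.

Let prob_prod_kernel w : prod_kernel w setT = 1%E.
Proof. exact: (probability_setT (MP w \x NP w)%E). Qed.

HB.instance Definition _ :=
  Kernel_isProbability.Build _ _ T (S1 * S2)%type R prod_kernel
    prob_prod_kernel.

End kernel_product.

Section stable_convergence.
Context d (T : measurableType d) (R : realType) (P : probability T R).

(* [P(X \in . | H)], for [P H > 0]. *)
Definition cond_law (H : set T) (X : T -> R * R) (B : set (R * R)) : \bar R :=
  (P (H `&` X @^-1` B) * ((fine (P H))^-1)%:E)%E.

(* [E(N(.) | H)], for [P H > 0]. *)
Definition cond_mixture (H : set T) (N : R.-pker T ~> (R * R)%type)
    (B : set (R * R)) : \bar R :=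
  ((\int[P]_(w in H) N w B) * ((fine (P H))^-1)%:E)%E.

Definition weak_cvg (mu_ : nat -> set (R * R) -> \bar R)
    (mu : set (R * R) -> \bar R) : Prop :=
  forall f : R * R -> R, continuous f -> bounded_fun f ->
    (\int[mu_ n]_x (f x)%:E)%E @[n --> \oo] --> (\int[mu]_x (f x)%:E)%E.

(* Stable convergence in the plane; the measurable sets of [R * R], those of
   the product sigma-algebra, are its Borel sets. *)
Definition stable_cvg (X_ : nat -> T -> R * R)
    (N : R.-pker T ~> (R * R)%type) : Prop :=
  (forall n, measurable_fun setT (X_ n)) /\
  forall H, measurable H -> (0 < P H)%E ->
    weak_cvg (fun n => cond_law H (X_ n)) (cond_mixture H N).

End stable_convergence.

(* The process is [Y 1, Y 2, ...]: [Y 0] is never used. *)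
Section process.
Context d (T : measurableType d) (R : realType) (P : probability T R).
Context (S : finType) (Y : nat -> T -> S).

(* sigma(Y_1, ..., Y_n), where [S] carries all its subsets; trivial for
   [n = 0]. *)
Definition past (n : nat) : set_system T :=
  <<s \bigcup_(k in [set k | (0 < k <= n)%N])
        preimage_set_system setT (Y k) setT >>.

Definition occ (n : nat) (y : S) (w : T) : nat :=
  (\sum_(1 <= k < n.+1) (Y k w == y))%N.

Definition seen (n : nat) (y : S) (w : T) : R := (occ n y w != 0)%:R.

(* The distribution of [Y 1]. *)
Definition law1 (B : {set S}) : R := fine (P (Y 1 @^-1` [set` B])).

Definition predictive (alpha theta : R) (B : {set S}) (n : nat) (w : T) : R :=
  (\sum_(y in B) ((occ n y w)%:R - alpha) * seen n y w
   + (theta + alpha * \sum_(y : S) seen n y w) * law1 B) / (theta + n%:R).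

Definition hit (A : {set S}) (n : nat) (w : T) : R := (Y n w \in A)%:R.

Definition hit_mean (A : {set S}) (n : nat) (w : T) : R :=
  n%:R^-1 * \sum_(1 <= k < n.+1) hit A k w.

End process.

(* Main.v *)
Require Import Defs.
From HB Require Import structures.
From mathcomp Require Import all_boot all_order all_algebra.
From mathcomp Require Import all_classical all_reals all_analysis.
From mathcomp Require Import measurable_realfun ring lra.
Import Order.TTheory GRing.Theory Num.Theory.
Import numFieldNormedType.Exports.

(** Write [q n] for the urn's predictive probability of [A]; it is a version
    of [Z n]. One draw changes the numerator of [q] by
      [(theta + n + 1) q_(n+1) = (theta + n) q_n + X_(n+1) + alpha e_n],
    where [|e_n| <= 1] and [e_n] vanishes unless the draw [Y_(n+1)] is a
    value never seen before. As there are finitely many values, such a draw has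
    conditional probability [O(1/n)]. So [q] is almost a martingale: given the
    past, its increment is [O(1/n)], has mean [O(n^-2)] and second moment
    [q_n (1 - q_n) / (n (n + 1)) + O(n^-3)] ([urn_increments]). The past is
    generated by finitely many atoms, so these facts are stated, and used, as
    bounds on integrals against bounded functions of [Y_1, ..., Y_n].

    The drift. With [g] the difference of [E(Z_(n+1) | G_n)] and [Z_n], testing
    the first moment against [g] itself gives [E g^2 <= C n^-2 E|g|], hence
    [E g^2 = O(n^-4)] ([drift_sq_le]).

    Almost sure convergence. These bounds give
    [E (q_k - q_n)^2 <= K / n] for [k >= n]. Along the indices [j^4] the
    distances in mean between consecutive terms are then summable, and between
    [j^4] and [(j + 1)^4] the bound on the increments leaves [q] no room to
    move ([ae_cvg]).

    Stable convergence. Let [F] be smooth, [v = q_n (1 - q_n)], and let [S_t F]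
    be the average of [F] over translations by [N(0, t)]. For [k >= n] put
    [U_k = E (g S_(n v / k) F (sqrt n (q_n - q_k)))], with [g] a bounded
    function of the past at [n]. From [k] to [k + 1] the variance drops by
    [n v / (k (k + 1))], which is up to small errors the conditional second
    moment of the increment of [sqrt n (q_n - q_k)]. Since [S] is a semigroup, a
    Taylor expansion gives [U_(k+1) - U_k = O(sqrt n / k^2)]
    ([lindeberg_step]), and the sum over [k >= n] is [O(1 / sqrt n)]. Now [U_n]
    is the average of [g S_v F 0], and [U_k] tends to
    [E (g F (sqrt n (q_n - Z)))]. Hence the gaps
    [F (sqrt n (q_n - Z)) - S_(Z (1 - Z)) F 0] are asymptotically orthogonal to
    every function of finitely many draws, thus to one another, and by a
    principle of Renyi to every bounded random variable ([renyi_mixing]),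
    in particular to the indicator of any event [H].

    Finally, [n] times the empirical frequency and [n q_n] differ by a bounded
    amount, so the first coordinate [C_n] is uniformly [O(1 / sqrt n)]. A
    bounded continuous [f] is therefore, on compact sets and near the axis,
    uniformly close to a smooth function of the second coordinate
    ([smooth_approx]); Chebyshev's inequality takes care of the rest
    ([joint_mixing]). *)

Set Implicit Arguments.
Unset Strict Implicit.
Unset Printing Implicit Defensive.

Local Open Scope classical_set_scope.
Local Open Scope ring_scope.

Lemma le_of_eq (R : realType) (x y : R) : x = y -> x <= y.
Proof. by move=> ->. Qed.

(** * Bounded measurable functions and their expectations *)
Section bounded_measurable.
Context d (T : measurableType d) (R : realType).
Implicit Types (f g : T -> R) (c M : R).

(** Almost all integrands below are bounded; closure of this class under the
    operations replaces integrability side conditions. *)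
Definition bm f : Prop :=
  measurable_fun [set: T] f /\ exists M, forall x, `|f x| <= M.

Lemma bmP f : bm f -> exists2 M : R, 0 < M & forall x, `|f x| <= M.
Proof.
move=> [_ [M fM]]; exists (`|M| + 1); first by rewrite ltr_wpDl.
by move=> x; rewrite (le_trans (fM x))// (le_trans (ler_norm _))// lerDl.
Qed.

Lemma bm_cst c : bm (fun=> c).
Proof. by split; [exact: measurable_cst|exists `|c|]. Qed.

Lemma bmD f g : bm f -> bm g -> bm (fun x => f x + g x).
Proof.
move=> [mf [M fM]] [mg [N gN]]; split; first exact: measurable_funD.
by exists (M + N) => x; rewrite (le_trans (ler_normD _ _))// lerD.
Qed.

Lemma bmM f g : bm f -> bm g -> bm (fun x => f x * g x).
Proof.
move=> [mf [M fM]] [mg [N gN]]; split; first exact: measurable_funM.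
by exists (M * N) => x; rewrite normrM ler_pM.
Qed.

Lemma bmN f : bm f -> bm (fun x => - f x).
Proof.
move=> [mf [M fM]]; split; first exact: (measurableT_comp (@oppr_measurable R setT)).
by exists M => x; rewrite normrN.
Qed.

Lemma bmB f g : bm f -> bm g -> bm (fun x => f x - g x).
Proof. by move=> bf bg; apply: bmD => //; exact: bmN. Qed.

Lemma bm_norm f : bm f -> bm (fun x => `|f x|).
Proof.
move=> [mf [M fM]]; split; first exact: (measurableT_comp (@normr_measurable R setT)).
by exists M => x; rewrite normr_id.
Qed.

Lemma bmX f n : bm f -> bm (fun x => f x ^+ n).
Proof.
move=> bf; elim: n => [|n ih]; first exact: bm_cst.
by under eq_fun do rewrite exprS; exact: bmM.
Qed.

Lemma bm_sum I (s : seq I) (F : I -> T -> R) :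
  (forall i, bm (F i)) -> bm (fun x => \sum_(i <- s) F i x).
Proof.
move=> bF; elim: s => [|i s ih].
  by under eq_fun do rewrite big_nil; exact: bm_cst.
by under eq_fun do rewrite big_cons; exact: bmD.
Qed.

Lemma bm_indic (H : set T) : measurable H -> bm (\1_H : T -> R).
Proof.
move=> mH; split => //.
by exists 1 => x; rewrite indicE; case: (x \in H); rewrite ?normr1 ?normr0.
Qed.

End bounded_measurable.

Lemma bm_comp d d' (T : measurableType d) (U : measurableType d') (R : realType)
    (h : U -> T) (f : T -> R) :
  measurable_fun setT h -> bm f -> bm (f \o h).
Proof.
by move=> mh [mf [M fM]]; split; [exact: measurableT_comp|exists M => x /=].
Qed.

#[global] Hint Extern 0 (bm (fun=> _)) => exact: bm_cst : core.

Section expectation.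
Context d (T : measurableType d) (R : realType) (P : probability T R).
Implicit Types (f g : T -> R) (c M : R).

Definition integ f := P.-integrable setT (EFin \o f).

Lemma bm_integ f : bm f -> integ f.
Proof.
move=> [mf [M fM]]; apply: measurable_bounded_integrable => //.
  by rewrite (le_lt_trans (probability_le1 P _))// ltry.
by exists M; split; [exact: num_real|move=> x Mx t _; exact: (le_trans (fM t) (ltW Mx))].
Qed.

Lemma EFin_Rintegral f : integ f ->
  (\int[P]_x (f x)%:E = (\int[P]_x f x)%:E)%E.
Proof. by move=> jf; rewrite /Rintegral fineK//; exact: integrable_fin_num jf. Qed.

Lemma ED f g : integ f -> integ g ->
  \int[P]_x (f x + g x) = \int[P]_x f x + \int[P]_x g x.
Proof. by move=> *; rewrite RintegralD. Qed.

Lemma EB f g : integ f -> integ g ->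
  \int[P]_x (f x - g x) = \int[P]_x f x - \int[P]_x g x.
Proof. by move=> *; rewrite RintegralB. Qed.

Lemma EZ c f : integ f -> \int[P]_x (c * f x) = c * \int[P]_x f x.
Proof. by move=> *; rewrite RintegralZl. Qed.

Lemma Ecst c : \int[P]_x c = c.
Proof. by rewrite Rintegral_cst// [X in fine X](@probability_setT _ T R P) mulr1. Qed.

Lemma Ele f g : integ f -> integ g -> (forall x, f x <= g x) ->
  \int[P]_x f x <= \int[P]_x g x.
Proof. by move=> *; apply: le_Rintegral. Qed.

Lemma Enorm f : integ f -> `|\int[P]_x f x| <= \int[P]_x `|f x|.
Proof. by move=> *; apply: le_normr_Rintegral. Qed.

Lemma integ_norm f : integ f -> integ (fun x => `|f x|).
Proof. by move=> ?; exact: integrable_norm. Qed.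

Lemma integD f g : integ f -> integ g -> integ (fun x => f x + g x).
Proof. by move=> jf jg; have := integrableD measurableT jf jg. Qed.

Lemma integB f g : integ f -> integ g -> integ (fun x => f x - g x).
Proof. by move=> jf jg; have := integrableB measurableT jf jg. Qed.

Lemma integZ c f : integ f -> integ (fun x => c * f x).
Proof. by move=> jf; have := integrableZl measurableT c jf. Qed.

Lemma integ_le f g : measurable_fun setT f -> integ g ->
  (forall x, `|f x| <= g x) -> integ f.
Proof.
move=> mf ig fg; apply: (le_integrable _ _ _ ig) => //.
  exact/measurable_EFinP.
by move=> x _ /=; rewrite lee_fin (le_trans (fg x))// ler_norm.
Qed.

Lemma Ele_cst f c : integ f -> (forall x, f x <= c) -> \int[P]_x f x <= c.
Proof.
by move=> ? fc; rewrite -[leRHS]Ecst; apply: Ele => //; exact: bm_integ.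
Qed.

Lemma Enorm_le f g : integ f -> integ g -> (forall x, `|f x| <= g x) ->
  `|\int[P]_x f x| <= \int[P]_x g x.
Proof.
move=> jf jg fg; apply: (le_trans (Enorm jf)); apply: Ele => //.
exact: integ_norm.
Qed.

Lemma Enorm_cst f c : integ f -> (forall x, `|f x| <= c) ->
  `|\int[P]_x f x| <= c.
Proof.
by move=> ? fc; rewrite -[leRHS]Ecst; apply: Enorm_le => //; exact: bm_integ.
Qed.

Lemma E_ge0 f : (forall x, 0 <= f x) -> 0 <= \int[P]_x f x.
Proof. by move=> *; apply: Rintegral_ge0. Qed.

Lemma Esum I (s : seq I) (F : I -> T -> R) : (forall i, bm (F i)) ->
  \int[P]_x (\sum_(i <- s) F i x) = \sum_(i <- s) \int[P]_x F i x.
Proof.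
move=> bF; elim: s => [|i s ih].
  by under eq_Rintegral do rewrite big_nil; rewrite Ecst big_nil.
under eq_Rintegral do rewrite big_cons.
by rewrite ED ?big_cons ?ih//; apply: bm_integ => //; exact: bm_sum.
Qed.

Lemma E_ae f g : measurable_fun setT f -> measurable_fun setT g ->
  {ae P, forall x, f x = g x} -> \int[P]_x f x = \int[P]_x g x.
Proof.
move=> mf mg fg; congr fine; apply: ae_eq_integral => //.
- exact/measurable_EFinP.
- exact/measurable_EFinP.
- by apply: filterS fg => x /= ->.
Qed.

Lemma E_sq0 f : bm f -> \int[P]_x (f x ^+ 2) = 0 -> {ae P, forall x, f x = 0}.
Proof.
move=> bf; have [mf2 _] := bmX 2 bf.
have /integrable_fin_num f2 := bm_integ (bmX 2 bf).
move=> /eqP; rewrite fine_eq0 ?f2// => /eqP f20.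
have /ae_eq_integral_abs : measurable_fun setT (fun x => (f x ^+ 2)%:E).
  exact/measurable_EFinP.
move=> /(_ P measurableT)[+ _]; move=> /(_ _)/wrap[].
  by under eq_integral do rewrite gee0_abs ?lee_fin ?sqr_ge0//.
by apply: filterS => x /= /(_ Logic.I)[/eqP]; rewrite sqrf_eq0 => /eqP.
Qed.

Lemma E_dct (F : nat -> T -> R) f M : (forall n, measurable_fun setT (F n)) ->
  measurable_fun setT f -> (forall n x, `|F n x| <= M) ->
  {ae P, forall x, F n x @[n --> \oo] --> f x} ->
  \int[P]_x F n x @[n --> \oo] --> \int[P]_x f x.
Proof.
move=> mF mf FM Ff.
have [] := @dominated_convergence _ _ _ P setT measurableT
  (fun n x => (F n x)%:E) (EFin \o f) (cst M%:E).
- by move=> n; exact/measurable_EFinP.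
- exact/measurable_EFinP.
- by apply: filterS Ff => x /= Fx _; apply: cvg_EFin => //; exact: nearW.
- exact: (bm_integ (bm_cst T M)).
- by apply: aeW => x n _ /=; rewrite lee_fin.
move=> intf _ cvgF; apply: fine_cvg.
rewrite fineK//; exact: integrable_fin_num.
Qed.

End expectation.

(** * Gaussian integrals: convolution and moments *)
Section normal_integral.
Context {R : realType}.
Local Notation mu := (@lebesgue_measure R).

(** The density is only a Radon-Nikodym derivative up to null sets, hence the
    detour through almost everywhere equality. *)
Lemma ge0_integral_normal_prob (m s : R) (f : R -> \bar R) :
  measurable_fun setT f -> (forall x, (0 <= f x)%E) ->
  (\int[normal_prob m s]_x f x = \int[mu]_x (f x * (normal_pdf m s x)%:E))%E.
Proof.
move=> mf f0.
have dom := normal_prob_dominates m s.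
rewrite -(Radon_Nikodym_SigmaFinite.change_of_variables dom)//.
have intf := Radon_Nikodym_SigmaFinite.f_integrable dom.
have mpdf : measurable_fun [set: R] (fun x => (normal_pdf m s x)%:E).
  by apply/measurable_EFinP; exact: measurable_normal_pdf.
apply: ae_eq_integral => //.
- by apply: emeasurable_funM => //; exact: measurable_int intf.
- exact: emeasurable_funM.
- apply: ae_eqe_mul2l => /=.
  apply: integral_ae_eq => //.
  by move=> E _ mE; rewrite -Radon_Nikodym_SigmaFinite.f_integral.
Qed.

Lemma lebesgue_measure_shift (c : R) (A : set R) : measurable A ->
  pushforward mu ((+%R c) : _ -> measurableTypeR R) A = mu A.
Proof.
move=> mA.
have mc : measurable_fun setT ((+%R c) : measurableTypeR R -> measurableTypeR R).
  exact: measurable_funD.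
pose f : {mfun (measurableTypeR R) >-> (measurableTypeR R)} :=
  HB.pack ((+%R c) : measurableTypeR R -> measurableTypeR R)
    (isMeasurableFun.Build _ _ _ _ _ mc).
rewrite -[LHS]/(pushforward mu f A).
apply/esym/lebesgue_measure_unique => //= _ [[a b]] _ <-.
rewrite /pushforward /f/=.
rewrite (_ : _ @^-1` _ = `]a - c, b - c]%classic); last first.
  by apply/seteqP; split => x /=; rewrite !in_itv/= => /andP[? ?]; apply/andP; split; lra.
rewrite !lebesgue_measure_itv/= !lte_fin ltrD2r; case: ifP => // _.
by rewrite -!EFinB; congr EFin; ring.
Qed.

Lemma ge0_integral_shift (c : R) (f : R -> \bar R) :
  measurable_fun setT f -> (forall x, (0 <= f x)%E) ->
  (\int[mu]_x f (c + x)%R = \int[mu]_x f x)%E.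
Proof.
move=> mf f0.
have mc : measurable_fun setT ((+%R c) : measurableTypeR R -> measurableTypeR R).
  exact: measurable_funD.
rewrite -[LHS](@ge0_integral_pushforward _ _ (measurableTypeR R)
  (measurableTypeR R) R (+%R c) _ mu setT f)//.
by apply: eq_measure_integral => //= A mA _; exact: lebesgue_measure_shift.
Qed.

End normal_integral.

Section semigroup.
Context {R : realType}.
Local Notation mu := (@lebesgue_measure R).
Implicit Types (a b v x y w : R).

Lemma normal_pdf_sqrt a x y : 0 < a -> normal_pdf x (Num.sqrt a) y =
  (Num.sqrt (a * pi *+ 2))^-1 * expR (- (y - x) ^+ 2 / (a *+ 2)).
Proof.
move=> a0; rewrite normal_pdfE ?gt_eqF ?sqrtr_gt0//.
by rewrite /normal_peak /normal_fun sqr_sqrtr ?ltW.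
Qed.

(** Completing the square: conditionally on the sum of two independent centred
    Gaussian variables, one of them is Gaussian. Integrating out [y] yields the
    convolution formula. *)
Lemma normal_pdf_mul a b w y : 0 < a -> 0 < b ->
  normal_pdf 0 (Num.sqrt a) (w - y) * normal_pdf 0 (Num.sqrt b) y =
  normal_pdf 0 (Num.sqrt (a + b)) w *
  normal_pdf (w * b / (a + b)) (Num.sqrt (a * b / (a + b))) y.
Proof.
move=> a0 b0; have ab0 : 0 < a + b by exact: addr_gt0.
rewrite !normal_pdf_sqrt// ?divr_gt0 ?mulr_gt0//.
rewrite !mulrA -![_ * expR _ * _]mulrA ![expR _ * _^-1]mulrC !mulrA.
rewrite -!mulrA -!expRD !mulrA; congr (_ * expR _); last by field; rewrite !gt_eqF.
have p0 := pi_ge0 R.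
rewrite -!invfM -!sqrtrM ?mulrn_wge0 ?mulr_ge0 ?(ltW ab0) ?(ltW a0)//.
by congr (_ (Num.sqrt _)); field; rewrite gt_eqF.
Qed.

Lemma ge0_integral_normal_conv a b (f : R -> \bar R) : 0 < a -> 0 < b ->
  measurable_fun setT f -> (forall x, (0 <= f x)%E) ->
  (\int[normal_prob 0 (Num.sqrt b)]_y
     \int[normal_prob 0 (Num.sqrt a)]_z f (y + z)%R =
   \int[normal_prob 0 (Num.sqrt (a + b))]_w f w)%E.
Proof.
move=> a0 b0 mf f0; have ab0 : 0 < a + b by exact: addr_gt0.
pose p s x : \bar R := (normal_pdf 0 (Num.sqrt s) x)%:E.
have mp s : measurable_fun [set: R] (p s).
  by apply/measurable_EFinP; exact: measurable_normal_pdf.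
have p0 s x : (0 <= p s x)%E by rewrite lee_fin normal_pdf_ge0.
pose g (z : R * R) := (f z.2 * (p a (z.2 - z.1)%R * p b z.1))%E.
have g0 z : (0 <= g z)%E by rewrite mule_ge0// mule_ge0.
have mg : measurable_fun setT g.
  apply: emeasurable_funM; first exact: (measurableT_comp mf measurable_snd).
  apply: emeasurable_funM; last exact: (measurableT_comp (mp b) measurable_fst).
  apply: (measurableT_comp (mp a)); apply: measurable_funB.
    exact: measurable_snd.
  exact: measurable_fst.
have gE y : (\int[normal_prob 0 (Num.sqrt a)]_z f (y + z)%R * p b y =
    \int[mu]_w g (y, w))%E.
  rewrite ge0_integral_normal_prob//; last first.
    by apply: (measurableT_comp mf); exact: measurable_funD.
  rewrite -(@ge0_integral_shift _ y (fun w => g (y, w)))//; last first.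
    exact: (measurableT_comp mg (measurable_pair1 y)).
  rewrite -ge0_integralZr//.
  - apply: eq_integral => z _; rewrite /g/= /p.
    by rewrite (_ : (y + z - y) = z) ?muleA//; ring.
  - apply: emeasurable_funM; last exact: mp.
    by apply: (measurableT_comp mf); exact: measurable_funD.
  - by move=> z _; rewrite mule_ge0 // lee_fin normal_pdf_ge0.
have mI : measurable_fun [set: R] (fun y => \int[normal_prob 0 (Num.sqrt a)]_z f (y + z)%R)%E.
  have := @measurable_fun_fubini_tonelli_F _ _ R (measurableTypeR R) R (normal_prob 0 (Num.sqrt a))
    (fun z => f (z.1 + z.2)%R); apply => //.
  by apply: (measurableT_comp mf); apply: measurable_funD.
apply: (etrans (ge0_integral_normal_prob 0 (Num.sqrt b) mI (fun y => integral_ge0 _ _))) => //.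
transitivity (\int[mu]_y \int[mu]_w g (y, w))%E.
  by apply: eq_integral => y _; rewrite -gE.
rewrite (@fubini_tonelli _ _ _ _ _ mu mu g)// ge0_integral_normal_prob//.
apply: eq_integral => w _ /=.
rewrite /g/= /p.
transitivity (\int[mu]_y (f w * (normal_pdf 0 (Num.sqrt (a + b)) w)%:E *
   (normal_pdf (w * b / (a + b)) (Num.sqrt (a * b / (a + b))) y)%:E))%E.
  by apply: eq_integral => y _; rewrite -EFinM normal_pdf_mul// EFinM muleA.
rewrite ge0_integralZl//.
- by rewrite integral_normal_pdf mule1.
- by apply/measurable_EFinP; exact: measurable_normal_pdf.
- by move=> y _; rewrite lee_fin normal_pdf_ge0.
- by rewrite mule_ge0 // lee_fin normal_pdf_ge0.
Qed.

End semigroup.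

Section exp_taylor.
Context {R : realType}.
Implicit Types (x y : R).

Lemma mean_value_at0 (f df : R -> R) y : (forall x, is_derive x 1 f (df x)) -> f 0 = 0 ->
  exists2 c, `|c| <= `|y| & f y = df c * y.
Proof.
move=> fdf f0.
have cf : continuous f.
  by move=> x; apply/differentiable_continuous/derivable1_diffP; have [] := fdf x.
have wcf a b : {within `[a, b], continuous f} by exact: continuous_subspaceT.
have [y0|y0] := leP 0 y.
  have [c cy fE] := MVT_segment y0 (fun x _ => fdf x) (wcf _ _).
  exists c; last by rewrite -[f y]subr0 -f0 fE subr0.
  by move: cy; rewrite in_itv/= => /andP[c0 cy]; rewrite !ger0_norm.
have [c cy fE] := MVT_segment (ltW y0) (fun x _ => fdf x) (wcf _ _).
exists c; last by move: fE; rewrite f0 !sub0r mulrN => /oppr_inj.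
by move: cy; rewrite in_itv/= => /andP[c0 cy]; rewrite !ler0_norm ?lerN2// ltW.
Qed.

(** Three applications of the mean value theorem; the bound holds for both
    signs of [y]. *)
Lemma exp_taylor3 y :
  `|expR y - 1 - y - y ^+ 2 / 2| <= `|y| ^+ 3 * expR `|y|.
Proof.
have d1 x : is_derive x 1 (fun x => expR x - 1) (expR x).
  by apply: is_derive_eq; rewrite ?subr0.
have d2 x : is_derive x 1 (fun x => expR x - 1 - x) (expR x - 1).
  by apply: is_derive_eq; rewrite ?subr0.
have d3 x : is_derive x 1 (fun x => expR x - 1 - x - x ^+ 2 / 2) (expR x - 1 - x).
  apply: is_derive_eq; rewrite ?subr0 !scaler0 add0r; congr (_ - _).
  by rewrite -[_ *: _]/(_ * (x * 1 + x * 1)); field.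
have [|c1 c1y ->] := mean_value_at0 y d3; first by rewrite expR0 expr0n mul0r; ring.
have [|c2 c2y ->] := mean_value_at0 c1 d2; first by rewrite expR0; ring.
have [|c3 c3y ->] := mean_value_at0 c2 d1; first by rewrite expR0; ring.
rewrite !normrM (ger0_norm (expR_ge0 _)).
rewrite (_ : `|y| ^+ 3 * expR `|y| = expR `|y| * `|y| * `|y| * `|y|); last by ring.
have c2y' := le_trans c2y c1y.
do 3 (apply: ler_pM; rewrite ?mulr_ge0 ?expR_ge0//).
by rewrite ler_expR (le_trans (ler_norm _))// (le_trans c3y).
Qed.

Lemma cube_expR x : 0 <= x -> x ^+ 3 <= 6 * expR x.
Proof.
move=> x0; have := @expR_ge1Dxn R x 2 x0.
rewrite (_ : 3`!%:R = 6 :> R)//= => h.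
have : x ^+ 3 / 6 <= expR x by rewrite (le_trans _ h)// lerDr.
by rewrite ler_pdivrMr// mulrC.
Qed.

Lemma expR_norm x : expR `|x| <= expR x + expR (- x).
Proof.
have [x0|x0] := ger0P x; first by rewrite lerDl expR_ge0.
by rewrite lerDr expR_ge0.
Qed.

(** Serves to read the first coefficients off an expansion at 0 whose remainder
    is one order smaller. *)
Lemma eq0_of_le_linear (a K : R) : (forall l, 0 < l <= 1 -> `|a| <= K * l) -> a = 0.
Proof.
move=> h; apply/eqP; rewrite -normr_eq0 eq_le normr_ge0 andbT.
apply/ler_addgt0Pr => e e0; rewrite add0r.
have K0 : 0 < `|K| + 1 by rewrite ltr_wpDl.
have l0 : 0 < Num.min 1 (e / (`|K| + 1)) by rewrite lt_min ltr01 divr_gt0.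
apply: (le_trans (h (Num.min 1 (e / (`|K| + 1))) _)).
  by rewrite l0 ge_min lexx.
apply: (@le_trans _ _ ((`|K| + 1) * (e / (`|K| + 1)))).
  apply: (@le_trans _ _ ((`|K| + 1) * Num.min 1 (e / (`|K| + 1)))).
    by rewrite ler_wpM2r ?(ltW l0)// (le_trans (ler_norm _))// lerDl.
  by rewrite ler_wpM2l ?(ltW K0)// ge_min lexx orbT.
by rewrite mulrC divfK// gt_eqF.
Qed.

End exp_taylor.

Section gauss_moments.
Context {R : realType}.
Implicit Types (l v x : R).

(** [gauss] lives on [R] with its canonical sigma-algebra and [normal_prob] on
    a copy of it that carries another display; the identity transports one
    integral to the other. *)
Lemma gauss_normal v (f : R -> \bar R) : 0 < v ->
  measurable_fun setT f -> (forall x, (0 <= f x)%E) ->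
  (\int[gauss 0 v]_x f x = \int[normal_prob 0 (Num.sqrt v)]_x f x)%E.
Proof.
move=> v0 mf f0.
have mid : measurable_fun setT (idfun : measurableTypeR R -> R).
  by move=> _ A mA; rewrite setTI; exact: mA.
have := @ge0_integral_pushforward _ _ (measurableTypeR R) R R idfun mid
  (normal_prob 0 (Num.sqrt v)) setT f measurableT mf (fun x _ => f0 x).
move=> <-; apply: eq_measure_integral => A mA _.
by rewrite /= /gauss v0.
Qed.

Lemma integral_gauss_dirac (g : R -> \bar R) : measurable_fun setT g ->
  (\int[gauss 0%R 0%R]_x g x = g 0%R)%E.
Proof. by move=> mg; rewrite /gauss ltxx integral_dirac// diracT mul1e. Qed.

Lemma EFin_integral_gauss_dirac (f : R -> R) : measurable_fun setT f ->
  (\int[gauss 0 0]_x (f x)%:E = (f 0)%:E)%E.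
Proof. by move=> mf; apply: integral_gauss_dirac; exact/measurable_EFinP. Qed.

(** Completing the square turns the tilted density into a constant multiple of
    the density with mean [l * v]. *)
Lemma gauss_mgf_ereal l v : 0 <= v ->
  (\int[gauss 0 v]_x (expR (l * x))%:E = (expR (l ^+ 2 * v / 2))%:E)%E.
Proof.
have me : measurable_fun [set: R] (fun x : R => expR (l * x)).
  by apply: measurableT_comp => //; exact: measurable_funM.
rewrite le_eqVlt => /predU1P[<-|v0].
  by rewrite EFin_integral_gauss_dirac// !mulr0 mul0r.
have mE : measurable_fun [set: R] (fun x : R => (expR (l * x))%:E).
  exact/measurable_EFinP.
have E0 x : (0 <= (expR (l * x))%:E)%E by rewrite lee_fin expR_ge0.
rewrite gauss_normal// ge0_integral_normal_prob//.
transitivity (\int[lebesgue_measure]_x ((expR (l ^+ 2 * v / 2))%:E *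
   (normal_pdf (l * v) (Num.sqrt v) x)%:E))%E.
  apply: eq_integral => x _; rewrite !normal_pdf_sqrt// -!EFinM; congr EFin.
  rewrite mulrCA [RHS]mulrCA -!expRD; congr (_ * expR _).
  by field; rewrite gt_eqF.
rewrite ge0_integralZl//.
- by rewrite integral_normal_pdf mule1.
- by apply/measurable_EFinP; exact: measurable_normal_pdf.
- by move=> x _; rewrite lee_fin normal_pdf_ge0.
Qed.

Lemma integ_gauss_exp l v : 0 <= v -> integ (gauss 0 v) (fun x => expR (l * x)).
Proof.
move=> v0; apply/integrableP; split.
  apply/measurable_EFinP.
  by apply: measurableT_comp => //; exact: measurable_funM.
under eq_integral do rewrite /= ger0_norm ?expR_ge0//.
by rewrite gauss_mgf_ereal// ltry.
Qed.

Lemma gauss_mgf l v : 0 <= v ->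
  \int[gauss 0 v]_x expR (l * x) = expR (l ^+ 2 * v / 2).
Proof. by move=> v0; rewrite /Rintegral gauss_mgf_ereal. Qed.

(** Twice the hyperbolic cosine of [l * x]: it dominates the powers of [`|x|]
    and has an explicit Gaussian integral. *)
Definition cosh2 l x : R := expR (l * x) + expR (- l * x).

Lemma integ_cosh2 l v : 0 <= v -> integ (gauss 0 v) (cosh2 l).
Proof. by move=> v0; apply: integD; exact: integ_gauss_exp. Qed.

Lemma gauss_cosh2 l v : 0 <= v ->
  \int[gauss 0 v]_x cosh2 l x = 2 * expR (l ^+ 2 * v / 2).
Proof.
move=> v0; rewrite ED; try exact: integ_gauss_exp.
by rewrite !gauss_mgf// sqrrN; ring.
Qed.

Lemma measurable_cube : measurable_fun [set: R] (fun x : R => `|x| ^+ 3).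
Proof. by apply: measurable_funX; exact: normr_measurable. Qed.

Lemma cube_cosh2 l x : 0 < l -> `|x| ^+ 3 <= 6 / l ^+ 3 * cosh2 l x.
Proof.
move=> l0.
have := @cube_expR R (`|l * x|) (normr_ge0 _).
have := @expR_norm R (l * x); rewrite -mulNr -/(cosh2 l x) => h1 h2.
have : (l * `|x|) ^+ 3 <= 6 * cosh2 l x.
  rewrite (_ : l * `|x| = `|l * x|); last by rewrite normrM (gtr0_norm l0).
  rewrite (le_trans h2)//.
  by rewrite ler_pM2l.
rewrite exprMn => h3.
have l30 : 0 < l ^+ 3 by rewrite exprn_gt0.
rewrite -(ler_pM2l l30) (le_trans h3)// !mulrA.
by rewrite [_ * 6]mulrC mulfK ?gt_eqF.
Qed.

Lemma integ_gauss_cube v : 0 <= v -> integ (gauss 0 v) (fun x => `|x| ^+ 3).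
Proof.
move=> v0; apply: (integ_le measurable_cube (integZ (6 / 1 ^+ 3) (integ_cosh2 1 v0))).
by move=> x; rewrite ger0_norm ?exprn_ge0//; exact: cube_cosh2.
Qed.

(** Scaling: [l = 1 / sqrt v] is the choice that makes [l ^+ 2 * v = 1]. *)
Lemma gauss_cube v : 0 <= v ->
  \int[gauss 0 v]_x (`|x| ^+ 3) <= 12 * expR 1 * Num.sqrt v ^+ 3.
Proof.
rewrite le_eqVlt => /predU1P[<-|v0].
  rewrite /Rintegral EFin_integral_gauss_dirac; last exact: measurable_cube.
  by rewrite sqrtr0 normr0 !expr0n/= mulr0.
have s0 : 0 < (Num.sqrt v)^-1 by rewrite invr_gt0 sqrtr_gt0.
have sv : (Num.sqrt v)^-1 ^+ 2 * v = 1.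
  by rewrite -[v in _ * v]sqr_sqrtr ?ltW// -exprMn mulVf ?expr1n// gt_eqF// sqrtr_gt0.
have s3 : 6 / (Num.sqrt v)^-1 ^+ 3 = 6 * Num.sqrt v ^+ 3 by rewrite exprVn invrK.
have := Ele (integ_gauss_cube (ltW v0)) (integZ (6 / (Num.sqrt v)^-1 ^+ 3)
  (integ_cosh2 (Num.sqrt v)^-1 (ltW v0))) (fun x => cube_cosh2 x s0).
rewrite EZ; last exact/integ_cosh2/ltW.
rewrite gauss_cosh2 ?(ltW v0)// sv s3.
move=> /le_trans; apply.
have : expR (1 / 2) <= expR 1 :> R by rewrite ler_expR; lra.
have : 0 <= Num.sqrt v ^+ 3 by rewrite exprn_ge0.
nra.
Qed.

Lemma measurable_id_pow n : measurable_fun [set: R] (fun x : R => x ^+ n).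
Proof. exact: measurable_funX. Qed.

Lemma integ_gauss_pow n v : (n <= 3)%N -> 0 <= v ->
  integ (gauss 0 v) (fun x => x ^+ n).
Proof.
move=> n3 v0.
have h : integ (gauss 0 v) (fun x => 1 + `|x| ^+ 3).
  apply: integD; last exact: integ_gauss_cube.
  exact: bm_integ.
apply: (integ_le (measurable_id_pow n) h) => x; rewrite normrX.
have [x1|x1] := leP `|x| 1.
  by apply: (@le_trans _ _ 1); [exact: exprn_ile1|rewrite lerDl exprn_ge0].
rewrite (@le_trans _ _ (`|x| ^+ 3))// ?lerDr//.
by apply: ler_weXn2l => //; exact: ltW.
Qed.

(** Both moments are read off the moment generating function: expanding it and
    the exponential to order two leaves
    [l * m1 + l ^+ 2 / 2 * (m2 - v) = O(l ^ 3)], and [l] is arbitrarily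
    small of either sign. *)
Lemma gauss_moments v : 0 <= v ->
  \int[gauss 0 v]_x x = 0 /\ \int[gauss 0 v]_x (x ^+ 2) = v.
Proof.
move=> v0; set m1 := \int[gauss 0 v]_x x; set m2 := \int[gauss 0 v]_x (x ^+ 2).
have i1 : integ (gauss 0 v) (fun x => x).
  by have := @integ_gauss_pow 1 v isT v0; under eq_fun do rewrite expr1.
have i2 := @integ_gauss_pow 2 v isT v0.
pose K1 := 12 * expR (2 ^+ 2 * v / 2).
pose K2 := v ^+ 2 / 8 + v ^+ 3 * expR v.
have key l : `|l| <= 1 -> `|l * m1 + l ^+ 2 / 2 * (m2 - v)| <= (K1 + K2) * `|l| ^+ 3.
  move=> l1.
  have l30 : 0 <= `|l| ^+ 3 by rewrite exprn_ge0.
  have ie := @integ_gauss_exp l v v0.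
  have h1 : `|\int[gauss 0 v]_x (expR (l * x) - (1 + l * x + l ^+ 2 / 2 * x ^+ 2))|
      <= K1 * `|l| ^+ 3.
    have -> : K1 * `|l| ^+ 3 = \int[gauss 0 v]_x (6 * `|l| ^+ 3 * cosh2 2 x).
      by rewrite EZ ?gauss_cosh2//; [rewrite /K1; ring|exact: integ_cosh2].
    apply: Enorm_le.
    - apply: integB => //; apply: integD; last exact: integZ.
      by apply: integD; [exact: bm_integ|exact: integZ].
    - exact/integZ/integ_cosh2.
    move=> x.
    have := exp_taylor3 (l * x).
    rewrite (_ : expR (l * x) - 1 - l * x - (l * x) ^+ 2 / 2 =
      expR (l * x) - (1 + l * x + l ^+ 2 / 2 * x ^+ 2)); last by ring.
    move=> /le_trans; apply.
    rewrite normrM exprMn.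
    have e1 : expR (`|l| * `|x|) <= expR `|x| by rewrite ler_expR ler_piMl.
    have e2 := cube_expR (normr_ge0 x).
    have e3 : expR `|x| * expR `|x| <= cosh2 2 x.
      rewrite -expRD (_ : `|x| + `|x| = `|2 * x|); last by rewrite normrM ger0_norm//; ring.
      by rewrite (le_trans (expR_norm _))// /cosh2 mulNr.
    apply: (@le_trans _ _ (`|l| ^+ 3 * (6 * expR `|x|) * expR `|x|)).
      apply: ler_pM; rewrite ?mulr_ge0 ?expR_ge0 ?exprn_ge0//.
      by rewrite ler_wpM2l.
    rewrite (_ : `|l| ^+ 3 * (6 * expR `|x|) * expR `|x| =
      6 * `|l| ^+ 3 * (expR `|x| * expR `|x|)); last by ring.
    by rewrite ler_wpM2l// mulr_ge0.
  have h2 : `|expR (l ^+ 2 * v / 2) - 1 - l ^+ 2 * v / 2| <= K2 * `|l| ^+ 3.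
    set s := l ^+ 2 * v / 2.
    have sE : s = `|l| ^+ 2 * v / 2 by rewrite /s real_normK// num_real.
    have s0 : 0 <= s by rewrite /s mulr_ge0// mulr_ge0 ?sqr_ge0.
    have l21 : `|l| ^+ 2 <= 1 by rewrite exprn_ile1.
    have sv : s <= v by rewrite sE; nra.
    have := exp_taylor3 s; rewrite (ger0_norm s0) => h.
    have s2 : s ^+ 2 / 2 <= v ^+ 2 / 8 * `|l| ^+ 3.
      rewrite (_ : s ^+ 2 / 2 = v ^+ 2 / 8 * (`|l| ^+ 3 * `|l|)); last by rewrite sE; field.
      by rewrite ler_wpM2l ?divr_ge0 ?sqr_ge0// ler_piMr.
    have s3 : s ^+ 3 * expR s <= v ^+ 3 * expR v * `|l| ^+ 3.
      rewrite [leRHS]mulrAC; apply: ler_pM; rewrite ?exprn_ge0 ?expR_ge0 ?ler_expR//.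
      rewrite (_ : s ^+ 3 = v ^+ 3 * `|l| ^+ 3 * (`|l| ^+ 3 / 8)); last by rewrite sE; field.
      rewrite ler_piMr ?mulr_ge0 ?exprn_ge0//.
      have : `|l| ^+ 3 <= 1 by rewrite exprn_ile1.
      by move=> ?; lra.
    rewrite /K2 mulrDl.
    rewrite (_ : expR s - 1 - s = (expR s - 1 - s - s ^+ 2 / 2) + s ^+ 2 / 2); last by ring.
    rewrite (le_trans (ler_normD _ _))// addrC lerD//.
      by rewrite ger0_norm// divr_ge0// sqr_ge0.
    exact: le_trans h s3.
  move: h1; rewrite EB//; last first.
    apply: integD; last exact: integZ.
    by apply: integD; [exact: bm_integ|exact: integZ].
  rewrite gauss_mgf// ED; last 2 first.
  - by apply: integD; [exact: bm_integ|exact: integZ].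
  - exact: integZ.
  rewrite ED; last 2 first.
  - exact: bm_integ.
  - exact: integZ.
  rewrite Ecst !EZ// -/m1 -/m2 => h1.
  rewrite (_ : _ + _ = (expR (l ^+ 2 * v / 2) - 1 - l ^+ 2 * v / 2) -
    (expR (l ^+ 2 * v / 2) - (1 + l * m1 + l ^+ 2 / 2 * m2))); last by ring.
  by rewrite (le_trans (ler_normB _ _))// mulrDl addrC lerD.
have K0 : 0 <= K1 + K2.
  by rewrite addr_ge0 ?mulr_ge0 ?expR_ge0// addr_ge0 ?mulr_ge0 ?expR_ge0 ?exprn_ge0.
have m10 : m1 = 0.
  apply: (@eq0_of_le_linear _ _ (K1 + K2)) => l /andP[l0 l1].
  have := key l; rewrite gtr0_norm// => /(_ l1) k1.
  have := key (- l); rewrite normrN gtr0_norm// => /(_ l1) k2.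
  have : `|(l * m1 + l ^+ 2 / 2 * (m2 - v)) - (- l * m1 + (- l) ^+ 2 / 2 * (m2 - v))|
    <= (K1 + K2) * l ^+ 3 + (K1 + K2) * l ^+ 3.
    by rewrite (le_trans (ler_normB _ _))// lerD.
  rewrite (_ : _ - _ = (2 * l) * m1); last by ring.
  rewrite normrM gtr0_norm ?mulr_gt0//.
  rewrite (_ : _ + _ = 2 * l * ((K1 + K2) * l * l)); last by ring.
  rewrite ler_pM2l ?mulr_gt0// => /le_trans; apply.
  by rewrite ler_piMr// mulr_ge0// ltW.
split => //; apply/eqP; rewrite -subr_eq0; apply/eqP.
apply: (@eq0_of_le_linear _ _ (2 * (K1 + K2))) => l /andP[l0 l1].
have := key l; rewrite gtr0_norm// => /(_ l1).
rewrite m10 mulr0 add0r normrM gtr0_norm ?divr_gt0 ?exprn_gt0//.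
rewrite (_ : _ * l ^+ 3 = l ^+ 2 / 2 * (2 * (K1 + K2) * l)); last by field.
by rewrite ler_pM2l// divr_gt0// exprn_gt0.
Qed.

End gauss_moments.

(** The heat semigroup. Locked, because conversion would otherwise unfold
    [gauss] and compare Gaussian measures by their densities. *)
HB.lock Definition gauss_avg {R : realType} (v : R) (F : R -> R) (x : R) : R :=
  \int[gauss 0 v]_y F (x + y).

Section gauss_smoothing.
Context {R : realType}.
Implicit Types (F : R -> R) (a b v x h C : R).

Lemma gauss_avgE v F x : gauss_avg v F x = \int[gauss 0 v]_y F (x + y).
Proof. by rewrite gauss_avg.unlock. Qed.

Lemma measurable_addl x : measurable_fun [set: R] (fun y : R => x + y).
Proof. exact: measurable_funD. Qed.

Lemma bm_shift F x : bm F -> bm (fun y => F (x + y)).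
Proof. by move=> bF; exact: (bm_comp (measurable_addl x) bF). Qed.

Lemma integ_shift v F x : bm F -> integ (gauss 0 v) (fun y => F (x + y)).
Proof. by move=> bF; apply: bm_integ; exact: bm_shift. Qed.

(** Tonelli's theorem needs a nonnegative integrand; the bound [M] of [F] is
    added and then subtracted. *)
Lemma bm_gauss_avg v F : bm F -> bm (gauss_avg v F).
Proof.
move=> bF; have [mF _] := bF; have [M M0 FM] := bmP bF.
pose g (p : R * R) : \bar R := (F (p.1 + p.2) + M)%:E.
have g0 p : (0 <= g p)%E.
  by have := FM (p.1 + p.2); rewrite ler_norml lee_fin => /andP[? _]; lra.
have mg : measurable_fun setT g.
  apply/measurable_EFinP; apply: measurable_funD => //.
  by apply: (measurableT_comp mF); exact: measurable_funD.
have mI := @measurable_fun_fubini_tonelli_F _ _ R R R (gauss 0 v) g mg g0.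
have -> : gauss_avg v F = (fun x => fine (fubini_F (gauss 0 v) g x) - M).
  apply/funext => x; rewrite /fubini_F /g gauss_avgE.
  transitivity (\int[gauss 0 v]_y (F (x + y) + M) - M) => //.
  by rewrite ED ?Ecst ?addrK//; [exact: integ_shift|exact: bm_integ].
split; first by apply: measurable_funB => //; exact: measurableT_comp.
exists (M + M + M) => x; rewrite (le_trans (ler_normB _ _))// (gtr0_norm M0) lerD//.
rewrite -[X in `|X|]/(\int[gauss 0 v]_y (F (x + y) + M)).
apply: Enorm_cst => [|y].
  by apply: integD; [exact: integ_shift|exact: bm_integ].
by rewrite (le_trans (ler_normD _ _))// (gtr0_norm M0) lerD.
Qed.

(** The degenerate variances, where [gauss] is a point mass, are treated
    apart. *)
Lemma gauss_conv a b (f : R -> \bar R) : 0 <= a -> 0 <= b ->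
  measurable_fun setT f -> (forall x, (0 <= f x)%E) ->
  (\int[gauss 0 b]_y \int[gauss 0 a]_z f (y + z)%R = \int[gauss 0%R (a + b)%R]_w f w)%E.
Proof.
move=> a0 b0 mf f0.
have mfD (y : R) : measurable_fun [set: R] (fun z : R => f (y + z)%R).
  exact: (measurableT_comp mf (measurable_addl y)).
move: a0; rewrite le_eqVlt => /predU1P[<-|a0].
  rewrite add0r; apply: eq_integral => y _.
  by rewrite integral_gauss_dirac// addr0.
have mI : measurable_fun [set: R] (fun y => \int[gauss 0 a]_z f (y + z)%R)%E.
  have := @measurable_fun_fubini_tonelli_F _ _ R R R (gauss 0 a)
    (fun z => f (z.1 + z.2)%R); apply => //.
  by apply: (measurableT_comp mf); exact: measurable_funD.
move: b0; rewrite le_eqVlt => /predU1P[<-|b0].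
  rewrite (addr0 a); apply: (etrans (integral_gauss_dirac mI)).
  by apply: eq_integral => y _; rewrite (add0r y).
have I0 y : (0 <= \int[gauss 0%R a]_z f (y + z)%R)%E by exact: integral_ge0.
apply: (etrans (gauss_normal b0 mI I0)).
apply: esym; apply: (etrans (gauss_normal (addr_gt0 a0 b0) mf f0)).
apply: (etrans (esym (ge0_integral_normal_conv a0 b0 mf f0))).
by apply: eq_integral => y _; exact: (esym (gauss_normal a0 (mfD y) _)).
Qed.

Lemma gauss_avg_conv a b F x : 0 <= a -> 0 <= b -> bm F ->
  gauss_avg a (gauss_avg b F) x = gauss_avg (a + b) F x.
Proof.
move=> a0 b0 bF; have [mF _] := bF; have [M M0 FM] := bmP bF.
have bg := bm_gauss_avg b bF.
have F0 y : 0 <= F y + M.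
  by have := FM y; rewrite ler_norml => /andP[? _]; lra.
suff : gauss_avg a (gauss_avg b F) x + M = gauss_avg (a + b) F x + M by move=> /addIr.
have sE v G : bm G -> gauss_avg v G x + M = \int[gauss 0 v]_y (G (x + y) + M).
  by move=> bG; rewrite gauss_avgE ED ?Ecst//; [exact: integ_shift|exact: bm_integ].
have bFx (y : R) : bm (fun z : R => F (x + (y + z))).
  by under eq_fun do rewrite addrA; exact: bm_shift.
rewrite (sE a _ bg) (sE (a + b) _ bF).
have mFx : measurable_fun [set: R] (fun w : R => (F (x + w) + M)%:E).
  by apply/measurable_EFinP; apply: measurable_funD => //; have [] := bm_shift x bF.
have F0x (w : R) : (0 <= (F (x + w) + M)%:E)%E by rewrite lee_fin.
rewrite (addrC a b) /Rintegral; apply: (congr1 fine).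
apply: (etrans _ (gauss_conv b0 a0 mFx F0x)).
apply: eq_integral => y _.
have iM : integ (gauss 0 b) (fun z => F (x + (y + z)) + M).
  by apply: integD; apply: bm_integ.
apply: (etrans _ (esym (EFin_Rintegral iM))).
rewrite gauss_avgE; apply: (congr1 EFin); apply: esym.
apply: (etrans (@ED _ _ _ (gauss 0 b) _ _ (bm_integ (gauss 0 b) (bFx y))
  (bm_integ (gauss 0 b) (bm_cst R M)))).
rewrite Ecst; congr (_ + _).
by apply: eq_Rintegral => z _; rewrite addrA.
Qed.

(** A quantitative form of twice continuously differentiable with Lipschitz
    second derivative, where [F1] and [F2] play the role of the derivatives. Stated
    as an expansion, it is inherited by averages without differentiating under
    the integral sign. *)
Definition taylor3 F F1 F2 C := [/\ bm F, bm F1, bm F2, 0 <= C &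
  forall x h, `|F (x + h) - F x - h * F1 x - h ^+ 2 / 2 * F2 x| <= C * `|h| ^+ 3].

Lemma taylor3_gauss_avg v F F1 F2 C : taylor3 F F1 F2 C ->
  taylor3 (gauss_avg v F) (gauss_avg v F1) (gauss_avg v F2) C.
Proof.
move=> [bF bF1 bF2 C0 FT]; split => //; try exact: bm_gauss_avg.
move=> x h; rewrite !gauss_avgE.
have i k G : bm G -> integ (gauss 0 v) (fun y => k * G (x + y)).
  by move=> bG; apply: integZ; exact: integ_shift.
rewrite -EB; [|exact: integ_shift..].
rewrite -EZ; last exact: integ_shift.
rewrite -EB; [|by apply: integB; exact: integ_shift|exact: i].
rewrite -EZ; last exact: integ_shift.
have i3 := integB (integB (integ_shift v (x + h) bF) (integ_shift v x bF)) (i h _ bF1).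
rewrite -EB//; last exact: i.
apply: Enorm_cst => [|y]; first by apply: integB => //; exact: i.
by rewrite -[x + h + y]addrA (addrC h y) addrA FT.
Qed.

(** The third absolute moment of [N(0, v)] is at most this constant times
    [Num.sqrt v ^+ 3]. *)
Definition cube_cst : R := 12 * expR 1.

(** Averaging the Taylor expansion at [x]: the linear term has mean 0 and the
    quadratic one has mean [v / 2 * F2 x]. *)
Lemma gauss_avg_expand v F F1 F2 C x : 0 <= v -> taylor3 F F1 F2 C ->
  `|gauss_avg v F x - F x - v / 2 * F2 x| <= C * cube_cst * Num.sqrt v ^+ 3.
Proof.
move=> v0 [bF bF1 bF2 C0 FT].
have [m1 m2] := gauss_moments v0.
have i1 : integ (gauss 0 v) (fun y => F1 x * y).
  apply: integZ; have := @integ_gauss_pow R 1 v isT v0.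
  by under eq_fun do rewrite expr1.
have i2 : integ (gauss 0 v) (fun y => F2 x / 2 * y ^+ 2).
  by apply: integZ; exact: integ_gauss_pow.
have iF := integ_shift v x bF.
have i0 : integ (gauss 0 v) (fun y => F (x + y) - F x).
  by apply: integB => //; exact: bm_integ.
have iG : integ (gauss 0 v) (fun y => F (x + y) - F x - F1 x * y - F2 x / 2 * y ^+ 2).
  by apply: integB => //; exact: integB.
have -> : gauss_avg v F x - F x - v / 2 * F2 x =
    \int[gauss 0 v]_y (F (x + y) - F x - F1 x * y - F2 x / 2 * y ^+ 2).
  rewrite EB//; last exact: integB.
  rewrite EB// EB//; last exact: bm_integ.
  rewrite Ecst EZ; last first.
    by have := @integ_gauss_pow R 1 v isT v0; under eq_fun do rewrite expr1.
  rewrite EZ ?m1 ?m2; last exact: integ_gauss_pow.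
  by rewrite gauss_avgE; ring.
apply: (@le_trans _ _ (\int[gauss 0 v]_y (C * `|y| ^+ 3))).
  apply: Enorm_le => //; first by apply: integZ; exact: integ_gauss_cube.
  move=> y; have := FT x y; congr (`|_| <= _); ring.
rewrite EZ; last exact: integ_gauss_cube.
by rewrite -mulrA ler_wpM2l//; exact: gauss_cube.
Qed.

Lemma gauss_avg_near v F F1 F2 C M x : 0 <= v <= 1 -> taylor3 F F1 F2 C ->
  (forall x, `|F2 x| <= M) ->
  `|gauss_avg v F x - F x| <= (C * cube_cst + M) * v.
Proof.
move=> /andP[v0 v1] tF F2M; have := gauss_avg_expand x v0 tF => h.
have [_ _ _ C0 _] := tF.
have K30 : 0 <= cube_cst by rewrite /cube_cst mulr_ge0// expR_ge0.
rewrite (_ : gauss_avg v F x - F x =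
  (gauss_avg v F x - F x - v / 2 * F2 x) + v / 2 * F2 x); last by ring.
rewrite (le_trans (ler_normD _ _))// mulrDl lerD//.
  apply: (le_trans h); rewrite ler_wpM2l ?mulr_ge0//.
  rewrite -[leRHS]sqr_sqrtr// exprSr ler_piMr ?sqr_ge0//.
  by rewrite -[leRHS]sqrtr1 ler_sqrt.
rewrite normrM ger0_norm ?divr_ge0// mulrC ler_pM ?divr_ge0//.
lra.
Qed.

(** By the semigroup property only the increment of the variance matters. *)
Lemma gauss_avg_lip a b F F1 F2 C M x : 0 <= a <= 1 -> 0 <= b <= 1 ->
  taylor3 F F1 F2 C -> (forall x, `|F2 x| <= M) ->
  `|gauss_avg a F x - gauss_avg b F x| <= (C * cube_cst + M) * `|a - b|.
Proof.
wlog ab : a b / a <= b.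
  move=> H /andP[a0 a1] /andP[b0 b1]; have [ab|/ltW ba] := leP a b.
    by apply: H => //; apply/andP.
  by rewrite distrC (distrC a); apply: H => //; apply/andP.
move=> /andP[a0 a1] /andP[b0 b1] tF F2M; have [bF _ bF2 _ _] := tF.
rewrite distrC (distrC a) (ger0_norm (_ : 0 <= b - a)) ?subr_ge0//.
rewrite (_ : gauss_avg b F x = gauss_avg (b - a) (gauss_avg a F) x); last first.
  by rewrite gauss_avg_conv ?subr_ge0// subrK.
apply: (gauss_avg_near _ _ (taylor3_gauss_avg a tF)); first by apply/andP; split; lra.
move=> y; rewrite gauss_avgE; apply: Enorm_cst => //; exact: integ_shift.
Qed.

End gauss_smoothing.

(** * Mixing sequences *)
Section renyi.
Context d (T : measurableType d) (R : realType) (P : probability T R).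

Lemma cvgr0P (u : nat -> R) :
  (u n @[n --> \oo] --> (0 : R)) <->
  forall e, 0 < e -> exists N, forall n, (N <= n)%N -> `|u n| <= e.
Proof.
split=> [/cvgrPdist_le h e e0|h].
  have [N _ hN] := h e e0; exists N => n Nn.
  by have := hN n Nn; rewrite /= sub0r normrN.
apply/cvgrPdist_le => e e0; have [N hN] := h e e0.
by exists N => // n /= Nn; rewrite sub0r normrN hN.
Qed.

(** If the integral of [h * g n] exceeded [e] in absolute value infinitely
    often, one could choose greedily indices whose functions, up to sign, are
    nearly orthogonal to the sum [S] of the previous ones. After [k] steps
    [E (h * S) >= k * e] while [E (S ^+ 2) <= k * (M ^+ 2 + 1)], which
    contradicts the Cauchy-Schwarz inequality for large [k]. *)
Lemma renyi_mixing (g : nat -> T -> R) (h : T -> R) M :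
  (forall n, measurable_fun setT (g n)) -> (forall n x, `|g n x| <= M) ->
  bm h -> (forall x, `|h x| <= 1) ->
  (forall m, \int[P]_x (g m x * g n x) @[n --> \oo] --> (0 : R)) ->
  \int[P]_x (h x * g n x) @[n --> \oo] --> (0 : R).
Proof.
move=> mg gM bh h1 gg; apply/cvgr0P; apply: contrapT.
move=> /existsNP[e /not_implyP[e0 /forallNP he]].
have bg n : bm (g n) by split => //; exists M.
have step k : exists S : T -> R, [/\ bm S,
    \int[P]_x (S x * g n x) @[n --> \oo] --> (0 : R),
    k%:R * e <= \int[P]_x (h x * S x) &
    \int[P]_x (S x ^+ 2) <= k%:R * (M ^+ 2 + 1)].
  elim: k => [|k [S [bS Sg hS S2]]].
    exists (fun=> 0); split => //.
    - rewrite (_ : (fun n => _) = (fun=> 0)); first exact: cvg_cst.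
      apply/funext => n; under eq_Rintegral do rewrite mul0r.
      exact: Ecst.
    - by under eq_Rintegral do rewrite mulr0; rewrite Ecst mul0r.
    - by under eq_Rintegral do rewrite expr0n; rewrite Ecst mul0r.
  have /cvgr0P/(_ (2^-1)) [|N hN] := Sg; first by rewrite invr_gt0.
  have /existsNP[n /not_implyP[Nn /negP]] := he N.
  rewrite -ltNge => en.
  set a := \int[P]_x (h x * g n x).
  pose s : R := Num.sg a.
  have a0 : a != 0 by rewrite -normr_gt0 (lt_trans e0).
  have s2 : s ^+ 2 = 1 by rewrite /s sqr_sg a0.
  exists (fun x => S x + s * g n x); split.
  - by apply: bmD => //; exact: bmM.
  - have -> : (fun n0 => \int[P]_x ((S x + s * g n x) * g n0 x)) =
      (fun n0 => \int[P]_x (S x * g n0 x) + s * \int[P]_x (g n x * g n0 x)).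
      apply/funext => j; under eq_Rintegral do rewrite mulrDl -mulrA.
      rewrite ED ?EZ//; apply: bm_integ; try exact: bmM.
      by apply: bmM => //; exact: bmM.
    rewrite -[X in _ --> X](addr0 0) -[X in _ --> _ + X](mulr0 s).
    by apply: cvgD => //; apply: cvgMr; exact: gg.
  - under eq_Rintegral do rewrite mulrDr mulrCA.
    rewrite ED; [|by apply: bm_integ; exact: bmM|].
      rewrite EZ; last by apply: bm_integ; exact: bmM.
      rewrite -natr1 mulrDl mul1r lerD//.
      by rewrite -/a /s -[X in _ * X]mulr_sg_norm mulrA -expr2 s2 mul1r ltW.
    by apply: bm_integ; apply: bmM => //; exact: bmM.
  - rewrite (_ : \int[P]_x _ = \int[P]_x (S x ^+ 2 + (2 * s * (S x * g n x)
      + g n x ^+ 2))); last first.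
      apply: eq_Rintegral => x _; rewrite sqrrD exprMn s2 mul1r; ring.
    have b1 : bm (fun x => 2 * s * (S x * g n x)).
      by apply: bmM => //; exact: bmM.
    have b2 := bmX 2 (bg n).
    rewrite ED; [|by apply: bm_integ; exact: bmX|by apply: bm_integ; exact: bmD].
    rewrite ED; [|exact: bm_integ|exact: bm_integ].
    rewrite EZ; last by apply: bm_integ; exact: bmM.
    have -> : k.+1%:R * (M ^+ 2 + 1) = k%:R * (M ^+ 2 + 1) + (1 + M ^+ 2).
      by rewrite -natr1; ring.
    rewrite lerD// lerD//; last first.
      apply: Ele_cst; first exact: bm_integ.
      move=> x; rewrite -real_normK ?num_real// ler_pXn2r ?nnegrE//.
      by rewrite (le_trans (normr_ge0 _) (gM n x)).
    rewrite (le_trans (ler_norm _))// !normrM [`|2|]ger0_norm//.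
    rewrite [`|s|]normr_sg a0 mulr1.
    by have := hN n Nn; lra.
(* With [c = k * e], integrating [2 * c * (h * S) <= c ^+ 2 + S ^+ 2] gives
   [c ^+ 2 <= k * (M ^+ 2 + 1)], which fails for this [k]. *)
pose k := (Num.trunc ((M ^+ 2 + 1) / e ^+ 2)).+1.
have [S [bS _ hS S2]] := step k.
set c := k%:R * e in hS.
have k0 : 0 < k%:R :> R by rewrite ltr0n.
have : 2 * c * c <= c ^+ 2 + k%:R * (M ^+ 2 + 1).
  apply: (@le_trans _ _ (2 * c * \int[P]_x (h x * S x))).
    by rewrite ler_wpM2l// mulr_ge0// mulr_ge0// ltW.
  rewrite -EZ; last by apply: bm_integ; exact: bmM.
  apply: (@le_trans _ _ (\int[P]_x (c ^+ 2 + S x ^+ 2))).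
    apply: Ele.
    - by apply: bm_integ; apply: bmM => //; exact: bmM.
    - by apply: bm_integ; apply: bmD => //; exact: bmX.
    move=> x; have hx := h1 x.
    have : (h x * S x) ^+ 2 <= S x ^+ 2.
      rewrite exprMn ler_piMl ?sqr_ge0// -real_normK ?num_real//.
      by rewrite exprn_ile1.
    have := sqr_ge0 (c - h x * S x); rewrite sqrrB; lra.
  by rewrite ED ?Ecst ?lerD2l//; apply: bm_integ => //; exact: bmX.
rewrite (_ : 2 * c * c = c ^+ 2 + c ^+ 2) ?lerD2l; last by ring.
rewrite /c exprMn expr2 -mulrA ler_pM2l// -ler_pdivlMr ?exprn_gt0//.
by rewrite leNgt truncnS_gt.
Qed.

End renyi.

(** * Smooth approximation of continuous functions *)
Section uniform_on_segment.
Context {R : realType}.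

(** Compactness of the segment: the radius does not depend on [y]. *)
Lemma uniformly_near_segment (f : R * R -> R) (L e : R) : continuous f -> 0 < e ->
  exists2 r, 0 < r & forall c t y, `|c| <= r -> `|t| <= r -> `|y| <= L ->
    `|f (c, y + t) - f (0, y)| <= e.
Proof.
move=> cf e0.
have /compact_near_coveringP/(_ (R * R)%type (nbhs ((0, 0) : R * R))
  (fun ct y => `|f (ct.1, y + ct.2) - f (0, y)| <= e) _) := @segment_compact R (- L) L.
case=> [x _|].
  have e20 : 0 < e / 2 by rewrite divr_gt0.
  have /cvgrPdist_lt/(_ _ e20) := cf (0, x).
  move=> /nbhs_ballP[r /= r0 rf].
  have r20 : 0 < r / 2 by rewrite divr_gt0.
  exists (ball x (r / 2), ball ((0, 0) : R * R) (r / 2)) => /=.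
    by split; apply: nbhsx_ballx.
  move=> [y [c t]] /= [xy [/= c0 t0]].
  have fy : `|f (0, x) - f (0, y)| < e / 2.
    apply: rf; split => /=; first exact: ballxx.
    by apply: le_ball xy; lra.
  have fc : `|f (0, x) - f (c, y + t)| < e / 2.
    apply: rf; split => /=; first by apply: le_ball c0; lra.
    move: xy t0; rewrite /ball/= => xy; rewrite sub0r normrN => t0.
    rewrite opprD addrA (le_lt_trans (ler_normB _ _))//.
    by rewrite (_ : r = r / 2 + r / 2) ?ltrD//; field.
  rewrite distrC in fc; rewrite -(subrK (f (0, x)) (f (c, y + t))) -addrA.
  by rewrite (le_trans (ler_normD _ _))//; lra.
move=> [U V]/= [/nbhs_ballP[r /= r0 rU] /nbhs_ballP[s /= s0 sV]] UV.
have m0 : 0 < Num.min r s by rewrite lt_min r0.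
exists (Num.min r s / 2) => [|c t y cr tr yL]; first by rewrite divr_gt0.
have mr : Num.min r s <= r by rewrite ge_min lexx.
have ms : Num.min r s <= s by rewrite ge_min lexx orbT.
apply: (UV (c, t)) => /=; last by rewrite in_itv/= -ler_norml.
by split; [apply: rU|apply: sV]; rewrite /ball/= sub0r normrN; lra.
Qed.

End uniform_on_segment.

Section smooth_step.
Context {R : realType}.
Implicit Types (x y a b h : R).

Definition clamp x : R := Num.max 0 (Num.min x 1).

Lemma clamp01 x : 0 <= clamp x <= 1.
Proof.
by rewrite /clamp le_max lexx/= ge_max ler01/= ge_min lexx orbT.
Qed.

Lemma clamp_le0 x : x <= 0 -> clamp x = 0.
Proof.
move=> x0; rewrite /clamp min_l ?max_l//; exact: le_trans x0 ler01.
Qed.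

Lemma clamp_ge1 x : 1 <= x -> clamp x = 1.
Proof. by move=> x1; rewrite /clamp min_r// max_r. Qed.

Lemma clampE x : 0 <= x <= 1 -> clamp x = x.
Proof. by move=> /andP[x0 x1]; rewrite /clamp min_l// max_r. Qed.

Lemma measurable_clamp : measurable_fun [set: R] clamp.
Proof. by apply: measurable_maxr => //; exact: measurable_minr. Qed.

(** The quintic step [10 x^3 - 15 x^4 + 6 x^5] on the unit interval, constant
    outside: its first two derivatives vanish at both ends, so that the glued
    function satisfies a global third order Taylor estimate. *)
Definition smoothstep x : R := clamp x ^+ 3 * (10 - 15 * clamp x + 6 * clamp x ^+ 2).
Definition smoothstep1 x : R := 30 * clamp x ^+ 2 * (1 - clamp x) ^+ 2.
Definition smoothstep2 x : R := 60 * clamp x * (1 - clamp x) * (1 - 2 * clamp x).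

Lemma smoothstep_le0 x : x <= 0 -> smoothstep x = 0.
Proof. by move=> x0; rewrite /smoothstep clamp_le0// expr0n mul0r. Qed.

Lemma smoothstep_ge1 x : 1 <= x -> smoothstep x = 1.
Proof. by move=> x0; rewrite /smoothstep clamp_ge1//; ring. Qed.

Lemma smoothstep01 x : 0 <= smoothstep x <= 1.
Proof.
rewrite /smoothstep; have /andP[] := clamp01 x; set c := clamp x => c0 c1.
have c3 : 0 <= c ^+ 3 by rewrite exprn_ge0.
have d3 : 0 <= (1 - c) ^+ 3 by rewrite exprn_ge0// subr_ge0.
apply/andP; split; first by apply: mulr_ge0 => //; nra.
rewrite -subr_ge0 (_ : _ - _ = (1 - c) ^+ 3 * (1 + 3 * c + 6 * c ^+ 2)); last by ring.
by apply: mulr_ge0 => //; nra.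
Qed.

(** Covers the Taylor remainders when one of the two points lies outside the
    unit interval and the other is inside, at distance [c <= k] of the end. *)
Lemma smoothstep_near0 (c k : R) : 0 <= c <= 1 -> c <= k ->
  [/\ 0 <= c ^+ 3 * (10 - 15 * c + 6 * c ^+ 2) <= 10 * k ^+ 3,
      0 <= k * (30 * c ^+ 2 * (1 - c) ^+ 2) <= 30 * k ^+ 3 &
      `|k ^+ 2 / 2 * (60 * c * (1 - c) * (1 - 2 * c))| <= 30 * k ^+ 3].
Proof.
move=> /andP[c0 c1] ck.
have k0 : 0 <= k by exact: le_trans ck.
have c2k : c ^+ 2 <= k ^+ 2 by rewrite ler_pXn2r// nnegrE.
have c3k : c ^+ 3 <= k ^+ 3 by rewrite ler_pXn2r// nnegrE.
have c30 : 0 <= c ^+ 3 by rewrite exprn_ge0.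
have k30 : 0 <= k ^+ 3 by rewrite exprn_ge0.
have c20 : 0 <= c ^+ 2 by rewrite exprn_ge0.
have k20 : 0 <= k ^+ 2 by rewrite exprn_ge0.
have d0 : 0 <= 1 - c by rewrite subr_ge0.
have d1 : 1 - c <= 1 by lra.
have d2 : (1 - c) ^+ 2 <= 1 by rewrite exprn_ile1.
split.
- apply/andP; split; first by apply: mulr_ge0 => //; nra.
  rewrite [leRHS]mulrC; apply: ler_pM => //; nra.
- apply/andP; split; first by rewrite !mulr_ge0// sqr_ge0.
  rewrite (_ : 30 * k ^+ 3 = k * (30 * k ^+ 2 * 1)); last by ring.
  rewrite ler_wpM2l//; apply: ler_pM => //; rewrite ?mulr_ge0 ?sqr_ge0//.
  by nra.
- rewrite (_ : _ * _ = 30 * (k ^+ 2 * c * ((1 - c) * (1 - 2 * c)))); last by field.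
  rewrite normrM [`|30|]ger0_norm// ler_wpM2l// normrM.
  rewrite [k ^+ 3]exprSr -[leRHS]mulr1; apply: ler_pM => //.
    by rewrite ger0_norm ?mulr_ge0// ler_wpM2l.
  rewrite normrM ger0_norm// mulr_ile1// ler_norml; lra.
Qed.

Lemma smoothstep_taylor x h :
  `|smoothstep (x + h) - smoothstep x - h * smoothstep1 x - h ^+ 2 / 2 * smoothstep2 x|
  <= 100 * `|h| ^+ 3.
Proof.
set y := x + h; have hE : h = y - x by rewrite /y addrC addKr.
rewrite {}hE; move: y => {h} y.
have c01 := clamp01 y.
have k30 : 0 <= `|y - x| ^+ 3 by rewrite exprn_ge0.
have [x0|x0] := leP x 0.
  rewrite [smoothstep x]smoothstep_le0// /smoothstep1 /smoothstep2 clamp_le0//.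
  have -> : smoothstep y - 0 - (y - x) * (30 * 0 ^+ 2 * (1 - 0) ^+ 2) -
    (y - x) ^+ 2 / 2 * (60 * 0 * (1 - 0) * (1 - 2 * 0)) = smoothstep y by ring.
  have ck : clamp y <= `|y - x|.
    have [y0|y0] := leP y 0; first by rewrite clamp_le0.
    rewrite /clamp ge_max normr_ge0/= ge_min; apply/orP; left.
    by rewrite ger0_norm ?subr_ge0; lra.
  by have [/andP[h1 h2] _ _] := smoothstep_near0 c01 ck; rewrite ger0_norm /smoothstep//; lra.
have [x1|x1] := leP 1 x.
  rewrite [smoothstep x]smoothstep_ge1// /smoothstep1 /smoothstep2 clamp_ge1//.
  have -> : smoothstep y - 1 - (y - x) * (30 * 1 ^+ 2 * (1 - 1) ^+ 2) -
    (y - x) ^+ 2 / 2 * (60 * 1 * (1 - 1) * (1 - 2 * 1)) = - (1 - smoothstep y) by ring.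
  have c01' : 0 <= 1 - clamp y <= 1 by lra.
  have ck : 1 - clamp y <= `|y - x|.
    have [y0|y0] := leP 1 y; first by rewrite clamp_ge1// subrr.
    have : y <= clamp y.
      by rewrite /clamp le_max le_min lexx (ltW y0) orbT.
    by rewrite distrC ger0_norm ?subr_ge0; lra.
  have [/andP[h1 h2] _ _] := smoothstep_near0 c01' ck; rewrite normrN ger0_norm.
    apply: (@le_trans _ _ (10 * `|y - x| ^+ 3)); last lra.
    by apply: le_trans h2; rewrite /smoothstep; apply: le_of_eq; ring.
  by apply: le_trans h1 _; rewrite /smoothstep; apply: le_of_eq; ring.
have cx : clamp x = x by rewrite clampE// !ltW.
have x01 : 0 <= x <= 1 by rewrite !ltW.
rewrite /smoothstep1 /smoothstep2 cx.
have [y0|y0] := leP y 0.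
  rewrite [smoothstep y]smoothstep_le0// /smoothstep cx.
  have xk : x <= `|y - x| by rewrite distrC ger0_norm; lra.
  have kE : y - x = - `|y - x| by rewrite distrC ger0_norm; lra.
  have [/andP[h1 h2] /andP[h3 h4] h5] := smoothstep_near0 x01 xk.
  move: h1 h2 h3 h4 h5 k30.
  rewrite [y - x in X in _ -> _ -> _ -> _ -> _ -> _ -> X]kE normrN normr_id sqrrN.
  set k := `|y - x|; set p := x ^+ 3 * _; set q := 30 * _ * _; set r := 60 * _ * _ * _.
  move=> h1 h2 h3 h4; rewrite !ler_norml => /andP[h5 h6] k30; apply/andP; split; lra.
have [y1|y1] := leP 1 y.
  rewrite [smoothstep y]smoothstep_ge1// /smoothstep cx.
  have x01' : 0 <= 1 - x <= 1 by lra.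
  have xk : 1 - x <= y - x by lra.
  have kE : `|y - x| = y - x by rewrite ger0_norm; lra.
  have [+ + +] := smoothstep_near0 x01' xk.
  rewrite (_ : (1 - x) ^+ 3 * _ = 1 - x ^+ 3 * (10 - 15 * x + 6 * x ^+ 2)); last by ring.
  rewrite (_ : 30 * (1 - x) ^+ 2 * _ = 30 * x ^+ 2 * (1 - x) ^+ 2); last by ring.
  rewrite (_ : _ / 2 * _ = - ((y - x) ^+ 2 / 2 * (60 * x * (1 - x) * (1 - 2 * x)))); last by ring.
  move: k30; rewrite kE normrN ler_norml.
  set p := x ^+ 3 * _; set q := (y - x) * _; set r := _ / 2 * _; set k := (y - x) ^+ 3.
  move=> k30 /andP[h1 h2] /andP[h3 h4] /andP[h5 h6].
  by rewrite ler_norml; apply/andP; split; lra.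
rewrite /smoothstep cx clampE; last by rewrite !ltW.
set h := y - x; have -> : y = x + h by rewrite /h addrC subrK.
rewrite (_ : _ - _ = h ^+ 3 *
  (10 - 60 * x + 60 * x ^+ 2 + (30 * x - 15) * h + 6 * h ^+ 2)); last by field.
rewrite normrM normrX [leLHS]mulrC ler_wpM2r// ?exprn_ge0//.
have h1 : -1 <= h <= 1 by rewrite /h; apply/andP; split; lra.
move: h1 x01 => /andP[h1 h1'] /andP[x0' x1']; rewrite ler_norml; apply/andP; split; nra.
Qed.

Lemma bm_smoothstep : bm smoothstep.
Proof.
have mc := measurable_clamp; split; last first.
  by exists 1 => x; have /andP[? ?] := smoothstep01 x; rewrite ger0_norm.
apply: measurable_funM; first exact: measurable_funX.
apply: measurable_funD; first by apply: measurable_funB => //; exact: measurable_funM.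
by apply: measurable_funM => //; exact: measurable_funX.
Qed.

Lemma bm_clamp : bm clamp.
Proof.
split; first exact: measurable_clamp.
by exists 1 => x; have /andP[? ?] := clamp01 x; rewrite ger0_norm.
Qed.

Lemma taylor3_smoothstep : taylor3 smoothstep smoothstep1 smoothstep2 100.
Proof.
have bc := bm_clamp; have b1 : bm (fun x => 1 - clamp x) by apply: bmB.
split=> //; last exact: smoothstep_taylor; first exact: bm_smoothstep.
- by apply: bmM; [apply: bmM|] => //; exact: bmX.
- by apply: bmM; [apply: bmM => //|apply: bmB => //]; apply: bmM.
Qed.

End smooth_step.

Section taylor_closure.
Context {R : realType}.
Implicit Types (F G : R -> R) (a b c C : R).

Lemma taylor3_cst c : taylor3 (fun=> c) (fun=> 0) (fun=> 0) 0.
Proof.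
by split => // x h; rewrite subrr !mulr0 !subr0 normr0 mul0r.
Qed.

Lemma taylor3D F F1 F2 C G G1 G2 D : taylor3 F F1 F2 C -> taylor3 G G1 G2 D ->
  taylor3 (fun x => F x + G x) (fun x => F1 x + G1 x) (fun x => F2 x + G2 x) (C + D).
Proof.
move=> [bF bF1 bF2 C0 FT] [bG bG1 bG2 D0 GT]; split; try exact: bmD.
  exact: addr_ge0.
move=> x h; rewrite mulrDl; apply: (le_trans _ (lerD (FT x h) (GT x h))).
apply: (le_trans _ (ler_normD _ _)).
by apply: le_of_eq; congr (`|_|); ring.
Qed.

Lemma taylor3Z c F F1 F2 C : taylor3 F F1 F2 C ->
  taylor3 (fun x => c * F x) (fun x => c * F1 x) (fun x => c * F2 x) (`|c| * C).
Proof.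
move=> [bF bF1 bF2 C0 FT]; split; try (by apply: bmM).
  exact: mulr_ge0.
move=> x h; rewrite -[leRHS]mulrA; apply: (le_trans _ (ler_wpM2l (normr_ge0 c) (FT x h))).
by rewrite -normrM; apply: le_of_eq; congr (`|_|); ring.
Qed.

Lemma taylor3_affine a b F F1 F2 C : taylor3 F F1 F2 C ->
  taylor3 (fun x => F ((x - a) * b)) (fun x => b * F1 ((x - a) * b))
    (fun x => b ^+ 2 * F2 ((x - a) * b)) (`|b| ^+ 3 * C).
Proof.
move=> [bF bF1 bF2 C0 FT].
have m : measurable_fun [set: R] (fun x : R => (x - a) * b).
  by apply: measurable_funM => //; exact: measurable_funB.
have bc G : bm G -> bm (fun x : R => G ((x - a) * b)) by move=> bG; exact: bm_comp m bG.
split; rewrite ?mulr_ge0 ?exprn_ge0//; first exact: bc.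
- by apply: bmM => //; exact: bc.
- by apply: bmM => //; exact: bc.
move=> x h; have := FT ((x - a) * b) (h * b).
rewrite (_ : C * _ = `|b| ^+ 3 * C * `|h| ^+ 3); last by rewrite normrM; ring.
apply: le_trans; rewrite (_ : (x + h - a) * b = (x - a) * b + h * b); last by ring.
by apply: le_of_eq; congr (`|_|); field.
Qed.

End taylor_closure.

Section smooth_interpolation.
Context {R : realType}.
Variables (f : R -> R) (x0 r : R).
Hypothesis r0 : 0 < r.

Let node (i : nat) : R := x0 + i%:R * r.

(** A finite sum of rescaled steps which passes through the values of [f] at
    [x0], [x0 + r], ..., [x0 + m * r]. *)
Fixpoint interpolant (m : nat) (x : R) : R :=
  if m is n.+1 then
    interpolant n x + (f (node n.+1) - f (node n)) * smoothstep ((x - node n) * r^-1)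
  else f x0.

Lemma taylor3_interpolant m : exists F1 F2 C, taylor3 (interpolant m) F1 F2 C.
Proof.
elim: m => [|m [F1 [F2 [C ih]]]].
  by do 3 eexists; exact: taylor3_cst.
do 3 eexists; apply: (taylor3D ih); apply: taylor3Z; apply: taylor3_affine.
exact: taylor3_smoothstep.
Qed.

Let nodeS i : node i.+1 = node i + r.
Proof. by rewrite /node -natr1; ring. Qed.

Lemma interpolant_ge m x : node m <= x -> interpolant m x = f (node m).
Proof.
elim: m => [|m ih]; first by rewrite /node mul0r addr0.
rewrite nodeS => h /=; rewrite ih; last by rewrite (le_trans _ h)// lerDl ltW.
rewrite smoothstep_ge1 ?mulr1 ?nodeS; first by rewrite addrC subrK.
by rewrite ler_pdivlMr// mul1r; lra.
Qed.

(** Between two nodes the interpolant is a convex combination of the values of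
    [f] there. The disjunctions let the first and the last node control the
    half-lines beyond them. *)
Lemma interpolant_near m x (c e : R) :
  (forall i, (i <= m)%N -> (i = 0%N \/ node i - r <= x) ->
     (i = m \/ x <= node i + r) -> `|f (node i) - c| <= e) ->
  `|interpolant m x - c| <= e.
Proof.
elim: m c => [|m ih] c H.
  by have := H 0%N (leqnn _) (or_introl erefl) (or_introl erefl); rewrite /node mul0r addr0.
have [xm|xm] := leP x (node m).
  rewrite /= smoothstep_le0 ?mulr0 ?addr0; last first.
    by rewrite pmulr_lle0 ?invr_gt0// subr_le0.
  apply: ih => i im h1 h2; apply: H => //; first exact: leqW.
  by right; case: h2 => [->|//]; rewrite (le_trans xm)// lerDl ltW.
rewrite /= interpolant_ge; last exact: ltW.
have hm1 : `|f (node m.+1) - c| <= e.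
  by apply: H => //; [right; rewrite nodeS addrK ltW|left].
have [xm1|xm1] := leP x (node m.+1); last first.
  rewrite smoothstep_ge1 ?mulr1; first by rewrite addrCA subrr addr0.
  by rewrite ler_pdivlMr// mul1r; move: xm1; rewrite nodeS; lra.
have hm : `|f (node m) - c| <= e.
  apply: H => //; right; last by rewrite -nodeS.
  by rewrite (le_trans _ (ltW xm))// gerBl ltW.
move: (smoothstep _) (smoothstep01 ((x - node m) * r^-1)) => t /andP[t0 t1].
rewrite (_ : _ - c = (1 - t) * (f (node m) - c) + t * (f (node m.+1) - c)); last by ring.
rewrite (le_trans (ler_normD _ _))// !normrM (ger0_norm t0).
rewrite (ger0_norm (_ : 0 <= 1 - t)) ?subr_ge0//.
rewrite (_ : e = (1 - t) * e + t * e); last by ring.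
by apply: lerD; rewrite ler_wpM2l// subr_ge0.
Qed.

End smooth_interpolation.

Section smooth_approximation.
Context {R : realType}.

Lemma smooth_approx (f : R * R -> R) (M L e : R) : continuous f -> 0 < L -> 0 < e ->
  (forall p, `|f p| <= M) ->
  exists G F1 F2 C r, [/\ taylor3 G F1 F2 C, 0 < r, (forall x, `|G x| <= M) &
    forall c y, `|c| <= r -> `|y| <= L -> `|f (c, y) - G y| <= e].
Proof.
move=> cf L0 e0 fM; have e20 : 0 < e / 2 by rewrite divr_gt0.
have [s s0 sf] := uniformly_near_segment L cf e20.
pose r := Num.min s L; have r0 : 0 < r by rewrite lt_min s0.
have rs : r <= s by rewrite ge_min lexx.
pose m := (Num.trunc (2 * L / r)).+1.
pose g y := f (0, y).
have [F1 [F2 [C tG]]] := taylor3_interpolant g (- L) r m.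
exists (interpolant g (- L) r m), F1, F2, C, r; split => //.
  move=> x; rewrite -[interpolant _ _ _ _ _]subr0; apply: interpolant_near => // i _ _ _.
  by rewrite subr0 fM.
move=> c y cr yL.
have mL : L < - L + m%:R * r.
  have : 2 * L / r < m%:R by rewrite /m truncnS_gt.
  by rewrite ltr_pdivrMr//; lra.
have h1 : `|f (c, y) - g y| <= e / 2.
  have := sf c 0 y (le_trans cr rs); rewrite normr0 addr0; apply => //.
  exact: ltW.
have h2 : `|interpolant g (- L) r m y - g y| <= e / 2.
  move: yL; rewrite ler_norml => /andP[yL1 yL2].
  apply: interpolant_near => // i im hi1 hi2.
  have ym : `|- L + i%:R * r - y| <= s.
    rewrite (le_trans _ rs)// ler_norml; apply/andP; split.
      by case: hi2 => [->|?]; lra.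
    by case: hi1 => [->|?]; rewrite ?mul0r; lra.
  have := sf 0 (- L + i%:R * r - y) y _ ym; rewrite normr0 /g.
  rewrite (_ : y + _ = - L + i%:R * r); last by ring.
  by apply; [exact: ltW|rewrite ler_norml yL1].
rewrite (_ : _ - _ = (f (c, y) - g y) - (interpolant g (- L) r m y - g y)); last by ring.
by rewrite (le_trans (ler_normB _ _))//; lra.
Qed.

End smooth_approximation.

(** * Functions of the first draws *)
Section filtration.
Context d (T : measurableType d) (R : realType) (P : probability T R).
Context (S : finType) (Y : nat -> T -> S).
Hypothesis mY : forall (n : nat) (B : {set S}), (0 < n)%N ->
  measurable (Y n @^-1` [set` B]).

(** [Y 0] is not a draw: the [i]-th coordinate is [Y i.+1]. *)
Definition hist n (w : T) : {ffun 'I_n -> S} := [ffun i : 'I_n => Y i.+1 w].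

(** Measurability with respect to [past Y n], as [S] is finite (see
    [past_adapted] and [adapted_past]). *)
Definition adapted (U : Type) n (g : T -> U) :=
  forall w w', hist n w = hist n w' -> g w = g w'.

Lemma histP n w w' : hist n w = hist n w' <->
  forall k, (0 < k <= n)%N -> Y k w = Y k w'.
Proof.
split=> [h [//|k] /= kn|h].
  by have /ffunP/(_ (Ordinal kn)) := h; rewrite !ffunE.
by apply/ffunP => i; rewrite !ffunE; apply: h => /=.
Qed.

Lemma adapted_le U m n (g : T -> U) : (m <= n)%N -> adapted m g -> adapted n g.
Proof.
move=> mn ag w w' /histP h; apply: ag; apply/histP => k /andP[k0 km].
by apply: h; rewrite k0 (leq_trans km).
Qed.

Lemma adapted_Y n k : (0 < k <= n)%N -> adapted n (Y k).
Proof. by move=> kn w w' /histP/(_ k kn). Qed.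

Lemma atom_past n (h : {ffun 'I_n -> S}) : past Y n [set w | hist n w = h].
Proof.
pose G := \bigcup_(k in [set k | (0 < k <= n)%N]) preimage_set_system setT (Y k) setT.
suff : @measurable _ (g_sigma_algebraType G) [set w | hist n w = h] by [].
rewrite (_ : [set w | _] = \bigcap_(i in [set: 'I_n]) (Y i.+1 @^-1` [set h i])).
  apply: fin_bigcap_measurable => [|i _]; first exact: finite_finset.
  apply: sub_sigma_algebra.
  exists i.+1; first by rewrite /= ltn_ord.
  by exists [set h i] => //; rewrite setTI.
apply/seteqP; split => w /=.
  by move=> <- i _; rewrite /= ffunE.
by move=> hw; apply/ffunP => i; rewrite ffunE; exact: hw.
Qed.

Lemma past_adapted n (E : set T) : past Y n E -> adapted n E.
Proof.
move: E; apply: smallest_sub => [|E [k kn [B _ <-]]]; last first.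
  by move=> w w' /(adapted_Y kn) h; rewrite /setI/preimage/= h.
split.
- by [].
- by move=> A aA w w' /aA h; rewrite /setD/= h.
- move=> A aA w w' ww; apply/propext; split => -[i _ Ai]; exists i => //.
    by rewrite -(aA i _ _ ww).
  by rewrite (aA i _ _ ww).
Qed.

Lemma adapted_past n (E : set T) : adapted n E -> past Y n E.
Proof.
move=> aE.
pose G := \bigcup_(k in [set k | (0 < k <= n)%N]) preimage_set_system setT (Y k) setT.
suff : @measurable _ (g_sigma_algebraType G) E by [].
rewrite (_ : E = \bigcup_(h in [set h | exists2 w, E w & hist n w = h])
   [set w | hist n w = h]).
  by apply: fin_bigcup_measurable => [|h _]; [exact: finite_finset|exact: atom_past].
apply/seteqP; split => w; first by move=> Ew; exists (hist n w) => //; exists w.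
by move=> [h [w' Ew' <-] /= /aE ->].
Qed.

Lemma past_measurable n (E : set T) : past Y n E -> measurable E.
Proof.
move: E; apply: smallest_sub => [|E [k /= /andP[k0 _] [B _ <-]]].
  exact: sigma_algebra_measurable.
rewrite setTI (_ : B = [set` [set s : S | s \in B]%SET]); first exact: mY.
by apply/seteqP; split => s /=; rewrite !inE.
Qed.

Lemma adapted_measurable_fun d' (U : measurableType d') n (g : T -> U) :
  adapted n g -> measurable_fun setT g.
Proof.
move=> ag _ B mB; rewrite setTI; apply: (@past_measurable n); apply: adapted_past.
by move=> w w' /ag h; rewrite /preimage/= h.
Qed.

(** The value of an adapted [g] on the atom [hist n = h]; an empty atom gets
    0. *)
Definition atom_val n (g : T -> R) (h : {ffun 'I_n -> S}) : R :=
  if pselect (exists w, hist n w = h) is left e then g (projT1 (cid e)) else 0.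

Lemma atom_valE n g w : adapted n g -> atom_val g (hist n w) = g w.
Proof.
move=> ag; rewrite /atom_val; case: pselect => [e|[]]; last by exists w.
by apply: ag; case: (cid e).
Qed.

Lemma adapted_sum n g w : adapted n g ->
  g w = \sum_(h : {ffun 'I_n -> S}) atom_val g h * (\1_[set w | hist n w = h] w : R).
Proof.
move=> ag; rewrite (bigD1 (hist n w))//= big1 ?addr0 => [|h hw].
  by rewrite atom_valE// indicE mem_set ?mulr1.
by rewrite indicE memNset ?mulr0//= => hE; rewrite hE eqxx in hw.
Qed.

Lemma adapted_bm n (g : T -> R) : adapted n g -> bm g.
Proof.
move=> ag; split; first exact: adapted_measurable_fun ag.
exists (\sum_(h : {ffun 'I_n -> S}) `|atom_val g h|) => w.
rewrite -(atom_valE w ag) (bigD1 (hist n w))//= lerDl.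
exact: sumr_ge0.
Qed.

Lemma cond_exp_adapted n (X V : T -> R) :
  is_cond_exp P (past Y n) X V -> adapted n V.
Proof.
move=> [_ _ mV _] w w' ww.
have aV := past_adapted (mV [set V w] (measurable_set1 _)).
have : (V @^-1` [set V w]) w' by rewrite -(aV _ _ ww).
by move=> /= ->.
Qed.

(** The defining property of the conditional expectation gives the identity on
    each atom of the past, and [g] is a finite combination of indicators of
    atoms. *)
Lemma cond_exp_test n (X V g : T -> R) : bm X ->
  is_cond_exp P (past Y n) X V -> adapted n g ->
  \int[P]_w (g w * V w) = \int[P]_w (g w * X w).
Proof.
move=> bX condV ag; have aV := cond_exp_adapted condV.
have [_ _ _ VX] := condV.
have bV := adapted_bm aV.
have m1 h : bm (\1_[set w | hist n w = h] : T -> R).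
  by apply: bm_indic; exact: (past_measurable (atom_past h)).
have key U : bm U -> \int[P]_w (g w * U w) = \sum_(h : {ffun 'I_n -> S})
    atom_val g h * \int[P]_(w in [set w | hist n w = h]) U w.
  move=> bU; transitivity (\int[P]_w (\sum_(h : {ffun 'I_n -> S})
      atom_val g h * (\1_[set w | hist n w = h] w * U w))).
    apply: eq_Rintegral => w _; rewrite {1}(adapted_sum w ag) mulr_suml.
    by apply: eq_bigr => h _; rewrite mulrA.
  rewrite Esum => [|h]; last by apply: bmM => //; exact: bmM.
  apply: eq_bigr => h _; rewrite EZ; last exact/bm_integ/bmM.
  congr (_ * _); rewrite [RHS]Rintegral_mkcond.
  apply: eq_Rintegral => w _; rewrite patchE indicE.
  by case: (w \in _); rewrite ?mul1r ?mul0r.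
rewrite !key//; apply: eq_bigr => h _; congr (_ * _).
by rewrite /Rintegral VX//; exact: atom_past.
Qed.

End filtration.

(** * Increments of the predictive probabilities *)
Section urn.
Context d (T : measurableType d) (R : realType) (P : probability T R).
Context (S : finType) (Y : nat -> T -> S) (alpha theta : R) (A : {set S}).
Hypothesis alpha_bounds : 0 <= alpha < 1.
Hypothesis theta_bound : - alpha < theta.
Hypothesis mY : forall (n : nat) (B : {set S}), (0 < n)%N ->
  measurable (Y n @^-1` [set` B]).
Hypothesis predY : forall (B : {set S}) (n : nat), (0 < n)%N ->
  exists2 V : T -> R,
    is_cond_exp P (past Y n) (hit R Y B n.+1) V &
    {ae P, forall w, V w = predictive P Y alpha theta B n w}.

Local Notation pred := (predictive P Y alpha theta).
Local Notation occ := (occ Y).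
Local Notation seen := (seen R Y).
Local Notation nu := (law1 P Y).

Definition blocks n w : R := \sum_(y : S) seen n y w.
(** The indicator of the event that the next draw lies in [B] and has not
    occurred yet. *)
Definition fresh (B : {set S}) n w : R :=
  \sum_(y in B) (1 - seen n y w) * (Y n.+1 w == y)%:R.

Lemma adapted_occ n y : adapted Y n (occ n y).
Proof.
move=> w w' /histP h; rewrite /Defs.occ !big_nat; apply: eq_bigr => k.
by rewrite ltnS => kn; rewrite (h _ kn).
Qed.

Lemma adapted_seen n y : adapted Y n (seen n y).
Proof. by move=> w w' ww; rewrite /Defs.seen (adapted_occ _ ww). Qed.

Lemma adapted_blocks n : adapted Y n (blocks n).
Proof. by move=> w w' ww; apply: eq_bigr => y _; exact: adapted_seen. Qed.

Lemma adapted_pred B n : adapted Y n (pred B n).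
Proof.
move=> w w' ww; rewrite /predictive; congr ((_ + (_ + _ * _) * _) / _).
  by apply: eq_bigr => y _; rewrite (adapted_occ _ ww) (adapted_seen _ ww).
exact: adapted_blocks.
Qed.

Lemma adapted_hit B n : (0 < n)%N -> adapted Y n (hit R Y B n).
Proof.
by move=> n0 w w' ww; rewrite /hit (@adapted_Y _ _ _ _ n n _ _ _ ww)// n0 leqnn.
Qed.

Lemma seenP n y w : seen n y w = 0 /\ occ n y w = 0%N \/
  seen n y w = 1 /\ (0 < occ n y w)%N.
Proof.
by rewrite /Defs.seen -lt0n; case: posnP => h /=; [left|right].
Qed.

Lemma occS n y w : occ n.+1 y w = (occ n y w + (Y n.+1 w == y))%N.
Proof. by rewrite /Defs.occ big_nat_recr. Qed.

Lemma occ_seen n y w : (occ n y w)%:R * seen n y w = (occ n y w)%:R.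
Proof. by have [[-> ->]|[-> _]] := seenP n y w; rewrite ?mul0r ?mulr1. Qed.

Lemma seenS n y w :
  seen n.+1 y w = seen n y w + (1 - seen n y w) * (Y n.+1 w == y)%:R.
Proof.
have [[s0 o0]|[s1 o1]] := seenP n y w.
  rewrite s0 add0r subr0 mul1r /Defs.seen occS o0 add0n.
  by case: (Y n.+1 w == y).
rewrite s1 subrr mul0r addr0 /Defs.seen occS.
by rewrite -lt0n addn_gt0 o1.
Qed.

Lemma sum_indicator (B : {set S}) (s : S) :
  \sum_(y in B) (s == y)%:R = (s \in B)%:R :> R.
Proof.
have [sB|sB] := boolP (s \in B).
  by rewrite (bigD1 s)//= eqxx big1 ?addr0// => y /andP[_ /negbTE ys]; rewrite eq_sym ys.
rewrite big1// => y yB; case: eqP => // sy; by rewrite -sy (negbTE sB) in yB.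
Qed.

Lemma sum_occ n w : (\sum_(y : S) occ n y w)%N = n.
Proof.
elim: n => [|n ih]; first by rewrite big1// => y _; rewrite /Defs.occ big_geq.
under eq_bigr do rewrite occS.
rewrite big_split/= ih (bigD1 (Y n.+1 w))//= eqxx big1 ?addn0 ?addn1// => y.
by rewrite eq_sym => /negbTE ->.
Qed.

Lemma law1_01 B : 0 <= nu B <= 1.
Proof.
rewrite /law1; have m := @mY 1 B isT; apply/andP; split; first exact: fine_ge0.
rewrite -lee_fin fineK ?probability_le1//.
by rewrite fin_num_measure.
Qed.

Lemma theta_addn_gt0 n : (0 < n)%N -> 0 < theta + n%:R.
Proof.
move=> n0; have : 1 <= n%:R :> R by rewrite ler1n.
move: alpha_bounds theta_bound => /andP[_ a1] tb n1; lra.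
Qed.

Lemma seen01 n y w : 0 <= seen n y w <= 1.
Proof. by have [[-> _]|[-> _]] := seenP n y w; rewrite lexx ler01. Qed.

(** The first draw has been seen; with [- alpha < theta] this makes the weight
    of new values nonnegative. *)
Lemma blocks_ge1 n w : (0 < n)%N -> 1 <= blocks n w.
Proof.
case: n => // n _; rewrite /blocks (bigD1 (Y 1 w))//= -[leLHS]addr0 lerD//.
  rewrite /Defs.seen /Defs.occ big_nat_recl//= eqxx.
  by rewrite add1n.
by apply: sumr_ge0 => y _; have /andP[] := seen01 n.+1 y w.
Qed.

Lemma blocks_le n w : 0 <= blocks n w <= #|S|%:R.
Proof.
apply/andP; split.
  by apply: sumr_ge0 => y _; have /andP[] := seen01 n y w.
rewrite /blocks -sumr_const ler_sum// => y _.
by have /andP[] := seen01 n y w.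
Qed.

Lemma new_weight_ge0 n w : (0 < n)%N -> 0 <= theta + alpha * blocks n w.
Proof.
move=> n0; have := blocks_ge1 w n0; move: alpha_bounds => /andP[a0 a1] b1.
have := theta_bound; have : alpha * 1 <= alpha * blocks n w by rewrite ler_wpM2l.
lra.
Qed.

Lemma seen_weight_ge0 n y w : 0 <= ((occ n y w)%:R - alpha) * seen n y w.
Proof.
have [[-> _]|[-> o]] := seenP n y w; first by rewrite mulr0.
rewrite mulr1 subr_ge0; move: alpha_bounds => /andP[_ /ltW a1].
by rewrite (le_trans a1)// ler1n.
Qed.

Lemma pred_numeratorE B n w : (0 < n)%N -> (theta + n%:R) * pred B n w =
  \sum_(y in B) ((occ n y w)%:R - alpha) * seen n y w +
  (theta + alpha * blocks n w) * nu B.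
Proof.
by move=> n0; rewrite /predictive mulrC divfK// gt_eqF// theta_addn_gt0.
Qed.

Lemma pred01 B n w : (0 < n)%N -> 0 <= pred B n w <= 1.
Proof.
move=> n0; have t0 := theta_addn_gt0 n0; have w0 := new_weight_ge0 w n0.
have /andP[nu0 nu1] := law1_01 B.
rewrite -(pmulr_rge0 _ t0) -(ler_pM2l t0 (pred B n w)) mulr1 pred_numeratorE//.
apply/andP; split.
  by rewrite addr_ge0 ?mulr_ge0// sumr_ge0// => y _; exact: seen_weight_ge0.
apply: (@le_trans _ _ (\sum_(y : S) ((occ n y w)%:R - alpha) * seen n y w +
   (theta + alpha * blocks n w))).
  apply: lerD; last by rewrite ler_piMr.
  rewrite big_mkcond/= ler_sum// => y _; case: ifP => // _; exact: seen_weight_ge0.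
under eq_bigr do rewrite mulrBl occ_seen.
rewrite big_split/= sumrN -mulr_sumr -/(blocks n w) -natr_sum sum_occ.
by apply: le_of_eq; ring.
Qed.

(** A draw adds 1 to its count; if it is fresh it also pays the discount
    [alpha] and increases the number of values seen. *)
Lemma pred_succ B n w : (0 < n)%N ->
  (theta + n.+1%:R) * pred B n.+1 w = (theta + n%:R) * pred B n w +
  hit R Y B n.+1 w + alpha * (nu B * fresh [set: S]%SET n w - fresh B n w).
Proof.
move=> n0; rewrite !pred_numeratorE//.
rewrite (eq_bigr (fun y => ((occ n y w)%:R - alpha) * seen n y w +
  ((Y n.+1 w == y)%:R - alpha * ((1 - seen n y w) * (Y n.+1 w == y)%:R)))); last first.
  move=> y _; rewrite !mulrBl !occ_seen seenS occS natrD; ring.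
rewrite big_split/= sumrB -mulr_sumr -/(fresh B n w) sum_indicator.
rewrite -/(hit R Y B n.+1 w).
have -> : blocks n.+1 w = blocks n w + fresh [set: S]%SET n w.
  rewrite /blocks; under eq_bigr do rewrite seenS.
  rewrite big_split/=; congr (_ + _).
  by rewrite /fresh; apply: eq_bigl => y; rewrite inE.
ring.
Qed.

Lemma fresh01 (B : {set S}) n w :
  0 <= fresh B n w <= fresh [set: S]%SET n w /\ fresh [set: S]%SET n w <= 1.
Proof.
have t0 y : 0 <= (1 - seen n y w) * (Y n.+1 w == y)%:R.
  by have /andP[_ s1] := seen01 n y w; rewrite mulr_ge0// subr_ge0.
split; [apply/andP; split|].
- by apply: sumr_ge0.
- rewrite /fresh big_mkcond [leRHS]big_mkcond/= ler_sum// => y _; rewrite inE.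
  by case: ifP.
- rewrite -[leRHS](_ : (Y n.+1 w \in [set: S]%SET)%:R = 1); last by rewrite inE.
  rewrite -sum_indicator ler_sum// => y _; rewrite ler_piMl//.
  by have /andP[s0 _] := seen01 n y w; rewrite gerBl.
Qed.

(** The conditional probability of the event [fresh B n] given the past. *)
Definition fresh_prob (B : {set S}) n w : R :=
  \sum_(y in B) (1 - seen n y w) * pred [set y]%SET n w.

Lemma adapted_fresh_prob B n : adapted Y n (fresh_prob B n).
Proof.
move=> w w' ww; apply: eq_bigr => y _.
by rewrite (adapted_seen _ ww) (adapted_pred _ ww).
Qed.

Let bm_adapted n (g : T -> R) : adapted Y n g -> bm g.
Proof. exact: adapted_bm. Qed.

Lemma bm_pred B n : bm (pred B n).
Proof. by apply: (@bm_adapted n); exact: adapted_pred. Qed.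

Lemma bm_hit B n : bm (hit R Y B n.+1).
Proof. by apply: (@bm_adapted n.+1); exact: adapted_hit. Qed.

(** The hypothesis on the predictive distribution as an identity between
    integrals, in which the version [V] no longer appears. *)
Lemma E_hit B n (g : T -> R) : (0 < n)%N -> adapted Y n g ->
  \int[P]_w (g w * hit R Y B n.+1 w) = \int[P]_w (g w * pred B n w).
Proof.
move=> n0 ag; have [V condV Vpred] := predY B n0.
have bh := bm_hit B n; have bp := bm_pred B n; have bg := bm_adapted ag.
have aV : adapted Y n V by exact: cond_exp_adapted condV.
have bV := bm_adapted aV.
rewrite -(cond_exp_test mY bh condV ag); apply: E_ae.
- by have [] := bmM bg bV.
- by have [] := bmM bg bp.
- by apply: filterS Vpred => w ->.
Qed.

Lemma adapted_fresh B n : adapted Y n.+1 (fresh B n).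
Proof.
move=> w w' ww; apply: eq_bigr => y _.
rewrite (adapted_le (leqnSn n) (@adapted_seen n y) ww).
by rewrite (@adapted_Y _ _ _ Y n.+1 n.+1 _ _ _ ww)//= leqnn.
Qed.

Lemma bm_fresh B n : bm (fresh B n).
Proof. by apply: (@bm_adapted n.+1); exact: adapted_fresh. Qed.

Lemma bm_fresh_prob B n : bm (fresh_prob B n).
Proof. by apply: (@bm_adapted n); exact: adapted_fresh_prob. Qed.

Lemma E_fresh B n (g : T -> R) : (0 < n)%N -> adapted Y n g ->
  \int[P]_w (g w * fresh B n w) = \int[P]_w (g w * fresh_prob B n w).
Proof.
move=> n0 ag; pose G y w := g w * (1 - seen n y w).
have aG y : adapted Y n (G y).
  by move=> w w' ww; rewrite /G (ag _ _ ww) (adapted_seen _ ww).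
transitivity (\int[P]_w \sum_(y in B) G y w * hit R Y [set y]%SET n.+1 w).
  apply: eq_Rintegral => w _; rewrite mulr_sumr; apply: eq_bigr => y _.
  by rewrite /hit finset.in_set1 mulrA.
transitivity (\int[P]_w \sum_(y in B) G y w * pred [set y]%SET n w); last first.
  apply: eq_Rintegral => w _; rewrite mulr_sumr; apply: eq_bigr => y _.
  by rewrite [RHS]mulrA.
under eq_Rintegral do rewrite -big_enum/=.
under [RHS]eq_Rintegral do rewrite -big_enum/=.
rewrite !Esum; last 2 first.
- by move=> y; apply: bmM; [exact: bm_adapted (aG y)|exact: bm_pred].
- by move=> y; apply: bmM; [exact: bm_adapted (aG y)|exact: bm_hit].
by apply: eq_bigr => y _; exact: E_hit.
Qed.

Definition fresh_cst : R := #|S|%:R * (`|theta| + #|S|%:R).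

Lemma fresh_cst_ge0 : 0 <= fresh_cst.
Proof. by rewrite mulr_ge0// addr_ge0. Qed.

(** An unseen value [y] only receives the share [law1 [set y]] of the weight
    [theta + alpha * blocks], which stays bounded. *)
Lemma fresh_prob_le B n w : (0 < n)%N -> 0 <= fresh_prob B n w <= fresh_cst / (theta + n%:R).
Proof.
move=> n0; have t0 := theta_addn_gt0 n0.
have h y : 0 <= (1 - seen n y w) * pred [set y]%SET n w
    <= (`|theta| + #|S|%:R) / (theta + n%:R).
  have d0 : 0 <= (`|theta| + #|S|%:R) / (theta + n%:R).
    by apply: divr_ge0; [exact: addr_ge0|exact: ltW].
  have [[s0 _]|[-> _]] := seenP n y w; last by rewrite subrr mul0r lexx.
  have /andP[p0 _] := pred01 [set y]%SET w n0.
  rewrite s0 subr0 mul1r p0/= ler_pdivlMr// mulrC pred_numeratorE// big_set1 s0 mulr0 add0r.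
  have /andP[nu0 nu1] := law1_01 [set y]%SET.
  have w0 := new_weight_ge0 w n0.
  rewrite (@le_trans _ _ (theta + alpha * blocks n w))//; first by rewrite ler_piMr.
  have /andP[b0 b1] := blocks_le n w; rewrite lerD ?ler_norm//.
  move: alpha_bounds => /andP[a0 /ltW a1].
  by rewrite (le_trans _ b1)// ler_piMl.
apply/andP; split; first by apply: sumr_ge0 => y _; have /andP[] := h y.
apply: (@le_trans _ _ (\sum_(y : S) (`|theta| + #|S|%:R) / (theta + n%:R))); last first.
  by rewrite sumr_const /fresh_cst -mulrA -[_ *+ _]mulr_natl cardT.
rewrite /fresh_prob big_mkcond/= ler_sum// => y _; have /andP[h1 h2] := h y.
by case: ifP => // _; exact: le_trans h2.
Qed.

(** The deviation of the urn from an exact martingale. *)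
Definition fresh_bias n w : R := nu A * fresh [set: S]%SET n w - fresh A n w.

Lemma fresh_bias_le n w : `|fresh_bias n w| <= fresh [set: S]%SET n w.
Proof.
have [/andP[f0 f1] _] := fresh01 A n w; have /andP[nu0 nu1] := law1_01 A.
have F0 := le_trans f0 f1.
have : nu A * fresh [set: S]%SET n w <= fresh [set: S]%SET n w by rewrite ler_piMl.
have : 0 <= nu A * fresh [set: S]%SET n w by rewrite mulr_ge0.
by move=> h1 h2; rewrite /fresh_bias ler_norml; apply/andP; split; lra.
Qed.

Lemma pred_incr n w : (0 < n)%N -> pred A n.+1 w - pred A n w =
  (theta + n.+1%:R)^-1 * (hit R Y A n.+1 w - pred A n w + alpha * fresh_bias n w).
Proof.
move=> n0; have t0 := theta_addn_gt0 (ltn0Sn n).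
apply: (mulfI (lt0r_neq0 t0)); rewrite mulVKf ?lt0r_neq0// mulrBr pred_succ//.
by rewrite /fresh_bias -natr1; ring.
Qed.

Lemma hit01 n w : hit R Y A n w = 0 \/ hit R Y A n w = 1.
Proof. by rewrite /hit; case: (_ \in A); [right|left]. Qed.

Lemma alpha_fresh_bias_le1 n w : `|alpha * fresh_bias n w| <= 1.
Proof.
have [_ f1] := fresh01 A n w; have c := fresh_bias_le n w.
move: alpha_bounds => /andP[a0 /ltW a1].
by rewrite normrM ger0_norm// mulr_ile1// (le_trans c).
Qed.

Lemma pred_incr_le n w : (0 < n)%N ->
  `|pred A n.+1 w - pred A n w| <= 2 / (theta + n.+1%:R).
Proof.
move=> n0; have t0 := theta_addn_gt0 (ltn0Sn n).
rewrite pred_incr// normrM ger0_norm ?invr_ge0 ?(ltW t0)// mulrC.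
rewrite ler_wpM2r ?invr_ge0 ?(ltW t0)//.
have := alpha_fresh_bias_le1 n w; rewrite ler_norml => /andP[c1 c2].
have /andP[p0 p1] := pred01 A w n0.
by case: (hit01 n.+1 w) => ->; rewrite ler_norml; apply/andP; split; lra.
Qed.

(** The terms in [hit] and [pred] cancel by [E_hit]; only the bias remains, and
    it is replaced by its conditional expectation. *)
Lemma E_drift n (g : T -> R) : (0 < n)%N -> adapted Y n g ->
  `|\int[P]_w (g w * (pred A n.+1 w - pred A n w))| <=
  fresh_cst / ((theta + n%:R) * (theta + n.+1%:R)) * \int[P]_w `|g w|.
Proof.
move=> n0 ag; have t0 := theta_addn_gt0 n0; have t1 := theta_addn_gt0 (ltn0Sn n).
set m := (theta + n.+1%:R)^-1; have m0 : 0 <= m by rewrite invr_ge0 ltW.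
have bg := bm_adapted ag; have bp := bm_pred A n.
have bh := bm_hit A n.
have bF B := bm_fresh B n.
have bf B := bm_fresh_prob B n.
have gb B : bm (fun w => g w * fresh B n w) by exact: bmM.
have gb' B : bm (fun w => g w * fresh_prob B n w) by exact: bmM.
have -> : \int[P]_w (g w * (pred A n.+1 w - pred A n w)) =
    \int[P]_w (m * alpha * (g w * (nu A * fresh_prob [set: S]%SET n w - fresh_prob A n w))).
  transitivity (\int[P]_w (m * (g w * hit R Y A n.+1 w - g w * pred A n w) +
     m * alpha * (nu A * (g w * fresh [set: S]%SET n w) - g w * fresh A n w))).
    by apply: eq_Rintegral => w _; rewrite pred_incr// -/m /fresh_bias; ring.
  rewrite ED; last 2 first.
  - by apply: bm_integ; apply: bmM => //; apply: bmB; exact: bmM.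
  - by apply: bm_integ; apply: bmM => //; apply: bmB => //; exact: bmM.
  rewrite EZ; last by apply: bm_integ; apply: bmB; exact: bmM.
  rewrite EB ?E_hit// ?subrr ?mulr0 ?add0r; [|by apply/bm_integ/bmM..].
  rewrite !EZ; last 2 first.
  - by apply: bm_integ; apply: bmM => //; apply: bmB => //; exact: bmM.
  - by apply: bm_integ; apply: bmB => //; exact: bmM.
  congr (_ * _); rewrite EB; last 2 first.
  - by apply: bm_integ; exact: bmM.
  - exact: bm_integ.
  rewrite EZ ?E_fresh//; last exact: bm_integ.
  rewrite -EZ; last exact: bm_integ.
  rewrite -EB; last 2 first.
  - by apply: bm_integ; exact: bmM.
  - exact: bm_integ.
  by apply: eq_Rintegral => w _; ring.
rewrite -EZ; last exact/bm_integ/bm_norm.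
apply: Enorm_le.
- by apply: bm_integ; apply: bmM => //; apply: bmM => //; apply: bmB => //; exact: bmM.
- by apply: bm_integ; apply: bmM => //; exact: bm_norm.
move=> w.
have /andP[f0 f1] := fresh_prob_le A w n0.
have /andP[F0 F1] := fresh_prob_le [set: S]%SET w n0.
have /andP[nu0 nu1] := law1_01 A.
move: alpha_bounds => /andP[a0 /ltW a1].
have h1 : nu A * fresh_prob [set: S]%SET n w <= fresh_prob [set: S]%SET n w by rewrite ler_piMl.
have h2 : 0 <= nu A * fresh_prob [set: S]%SET n w by rewrite mulr_ge0.
set X := nu A * _ - _.
have hX : `|X| <= fresh_cst / (theta + n%:R).
  by rewrite /X ler_norml; apply/andP; split; lra.
rewrite (_ : `|_| = (alpha * `|X|) * (m * `|g w|)); last first.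
  by rewrite !normrM (ger0_norm m0) (ger0_norm a0); ring.
rewrite (_ : _ / _ * _ = fresh_cst / (theta + n%:R) * (m * `|g w|)); last first.
  by rewrite /m invfM; ring.
by rewrite ler_wpM2r ?mulr_ge0// (le_trans _ hX)// ler_piMl.
Qed.

(** Since [hit] takes the values 0 and 1, the square of [hit - p] has
    conditional mean [p * (1 - p)]; all other terms contain the bias as a
    factor. *)
Lemma E_quadratic n (g : T -> R) : (0 < n)%N -> adapted Y n g ->
  `|\int[P]_w (g w * (pred A n.+1 w - pred A n w) ^+ 2) -
    (theta + n.+1%:R)^-1 ^+ 2 * \int[P]_w (g w * (pred A n w * (1 - pred A n w)))| <=
  3 * fresh_cst / ((theta + n%:R) * (theta + n.+1%:R) ^+ 2) * \int[P]_w `|g w|.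
Proof.
move=> n0 ag; have t0 := theta_addn_gt0 n0; have t1 := theta_addn_gt0 (ltn0Sn n).
set m := (theta + n.+1%:R)^-1; have m0 : 0 <= m by rewrite invr_ge0 ltW.
have bg := bm_adapted ag; have bp := bm_pred A n.
have bp1 : bm (fun w => 1 - 2 * pred A n w) by apply: bmB => //; exact: bmM.
have bpp : bm (fun w => pred A n w * (1 - pred A n w)) by apply: bmM => //; exact: bmB.
have bh := bm_hit A n.
have bF B := bm_fresh B n.
have bc : bm (fresh_bias n) by apply: bmB => //; exact: bmM.
pose rem w := alpha * fresh_bias n w *
  (2 * (hit R Y A n.+1 w - pred A n w) + alpha * fresh_bias n w).
have br : bm rem.
  apply: bmM; first exact: bmM.
  by apply: bmD; apply: bmM => //; exact: bmB.
have -> : \int[P]_w (g w * (pred A n.+1 w - pred A n w) ^+ 2) =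
   m ^+ 2 * \int[P]_w (g w * (pred A n w * (1 - pred A n w))) +
   m ^+ 2 * \int[P]_w (g w * rem w).
  (* [hit ^+ 2 = hit] makes the square affine in [hit]. *)
  transitivity (\int[P]_w (m ^+ 2 * (g w * (1 - 2 * pred A n w) * hit R Y A n.+1 w
     + (g w * pred A n w ^+ 2 + g w * rem w)))).
    apply: eq_Rintegral => w _; rewrite pred_incr// -/m /rem.
    by case: (hit01 n.+1 w) => ->; ring.
  rewrite EZ; last first.
    apply/bm_integ/bmD; first by apply: bmM => //; exact: bmM.
    by apply: bmD; apply: bmM => //; exact: bmX.
  rewrite -mulrDr; congr (_ * _).
  rewrite ED; last 2 first.
  - by apply/bm_integ/bmM => //; exact: bmM.
  - by apply/bm_integ/bmD; apply: bmM => //; exact: bmX.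
  rewrite (@E_hit A n (fun w => g w * (1 - 2 * pred A n w)))//; last first.
    by move=> w w' ww; rewrite (ag _ _ ww) (adapted_pred _ ww).
  rewrite ED; last 2 first.
  - by apply/bm_integ/bmM => //; exact: bmX.
  - exact/bm_integ/bmM.
  rewrite addrA; congr (_ + _).
  rewrite -ED; last 2 first.
  - by apply/bm_integ/bmM => //; exact: bmM.
  - by apply/bm_integ/bmM => //; exact: bmX.
  by apply: eq_Rintegral => w _; ring.
rewrite addrAC subrr add0r normrM ger0_norm ?exprn_ge0//.
have key : `|\int[P]_w (g w * rem w)| <= 3 * fresh_cst / (theta + n%:R) * \int[P]_w `|g w|.
  apply: (@le_trans _ _ (\int[P]_w (3 * (`|g w| * fresh [set: S]%SET n w)))).
    apply: Enorm_le; first exact/bm_integ/bmM.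
      by apply/bm_integ/bmM => //; apply: bmM => //; exact: bm_norm.
    move=> w; rewrite normrM mulrCA ler_wpM2l// /rem -mulrA normrM.
    move: alpha_bounds => /andP[a0 /ltW a1]; rewrite (ger0_norm a0).
    have cl := fresh_bias_le n w; have acl := alpha_fresh_bias_le1 n w.
    have /andP[p0 p1] := pred01 A w n0.
    rewrite normrM -[leRHS]mul1r; apply: ler_pM => //; rewrite ?mulr_ge0//.
    rewrite [leRHS]mulrC; apply: ler_pM => //.
    move: acl; rewrite ler_norml => /andP[c1 c2].
    by case: (hit01 n.+1 w) => ->; rewrite ler_norml; apply/andP; split; lra.
  rewrite EZ; last by apply/bm_integ/bmM => //; exact: bm_norm.
  rewrite (@E_fresh _ n (fun w => `|g w|))//; last first.
    by move=> w w' ww; rewrite (ag _ _ ww).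
  rewrite -[3 * fresh_cst / _]mulrA -[leRHS]mulrA ler_wpM2l//.
  rewrite -[leRHS]EZ; last exact/bm_integ/bm_norm.
  apply: Ele.
  - by apply/bm_integ/bmM; [exact: bm_norm|exact: bm_fresh_prob].
  - by apply/bm_integ/bmM => //; exact: bm_norm.
  move=> w; rewrite mulrC ler_wpM2r//.
  by have /andP[] := fresh_prob_le [set: S]%SET w n0.
apply: (le_trans (ler_wpM2l (exprn_ge0 2 m0) key)).
apply: le_of_eq.
by rewrite /m invfM -exprVn; ring.
Qed.

(** [theta] may be negative, but it exceeds [- 1]. *)
Lemma theta_addn_ge : exists2 c : R, 0 < c <= 1 & forall n, (0 < n)%N ->
  c * n%:R <= theta + n%:R.
Proof.
move: alpha_bounds => /andP[a0 a1]; have tb := theta_bound.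
exists (Num.min 1 (1 + theta)).
  by rewrite lt_min ltr01/= ge_min lexx/= andbT; lra.
move=> n n0; have n1 : 1 <= n%:R :> R by rewrite ler1n.
have [t0|t0] := leP 0 theta.
  rewrite min_l; lra.
rewrite min_r; last lra.
nra.
Qed.

(** The estimates above with all denominators expressed by [n]; the second
    moment is normalised by [n * n.+1] because these numbers telescope. *)
Lemma urn_increments : exists2 C : R, 0 < C & forall n, (0 < n)%N -> [/\
  (forall w, `|pred A n.+1 w - pred A n w| <= C / n%:R),
  (forall g : T -> R, adapted Y n g ->
    `|\int[P]_w (g w * (pred A n.+1 w - pred A n w))| <= C / n%:R ^+ 2 * \int[P]_w `|g w|) &
  (forall g : T -> R, adapted Y n g ->
    `|\int[P]_w (g w * (pred A n.+1 w - pred A n w) ^+ 2) -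
      (n%:R * n.+1%:R)^-1 * \int[P]_w (g w * (pred A n w * (1 - pred A n w)))| <=
     C / n%:R ^+ 3 * \int[P]_w `|g w|)].
Proof.
have [c /andP[c0 c1] clin] := theta_addn_ge.
pose D : R := (1 + `|theta|) ^+ 2 * 3.
have D0 : 0 <= D by rewrite mulr_ge0// sqr_ge0.
have k0 := fresh_cst_ge0.
pose C := 2 / c + fresh_cst / c ^+ 2 + (3 * fresh_cst / c ^+ 3 + D / c ^+ 2).
exists C.
  rewrite /C ltr_wpDr//; first by rewrite addr_ge0// !divr_ge0 ?mulr_ge0 ?exprn_ge0 ?(ltW c0).
  by rewrite ltr_wpDr// ?divr_gt0// divr_ge0 ?exprn_ge0 ?(ltW c0).
move=> n n0; have n1 : 1 <= n%:R :> R by rewrite ler1n.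
have t0 := theta_addn_gt0 n0; have t1 := theta_addn_gt0 (ltn0Sn n).
have x0 : 0 < n%:R :> R by rewrite ltr0n.
set x : R := n%:R in n1 x0 t0 *.
have t1E : theta + n.+1%:R = theta + x + 1 by rewrite -natr1 addrA.
pose u := (c * x)^-1.
have u0 : 0 < u by rewrite invr_gt0 mulr_gt0.
set i0 := (theta + x)^-1; set i1 := (theta + n.+1%:R)^-1.
have i00 : 0 <= i0 by rewrite invr_ge0 ltW.
have i10 : 0 <= i1 by rewrite invr_ge0 ltW.
have i0u : i0 <= u by rewrite lef_pV2 ?posrE ?mulr_gt0// clin.
have i1i0 : i1 <= i0 by rewrite lef_pV2 ?posrE// t1E lerDl.
have i1u : i1 <= u by exact: le_trans i0u.
have i1u2 : i1 ^+ 2 <= u ^+ 2 by rewrite ler_pXn2r// nnegrE ltW.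
have C1 : 2 / c <= C.
  by rewrite /C -addrA lerDl addr_ge0// ?addr_ge0// divr_ge0 ?mulr_ge0 ?exprn_ge0 ?(ltW c0).
have C2 : fresh_cst / c ^+ 2 <= C.
  rewrite /C -addrA addrCA lerDl addr_ge0//; first by rewrite divr_ge0// ltW.
  by rewrite addr_ge0// divr_ge0 ?mulr_ge0 ?exprn_ge0 ?(ltW c0).
have C3 : 3 * fresh_cst / c ^+ 3 + D / c ^+ 2 <= C.
  by rewrite /C lerDr addr_ge0// divr_ge0 ?exprn_ge0 ?(ltW c0).
split.
- move=> w; apply: (le_trans (pred_incr_le w n0)); rewrite -/i1.
  apply: (@le_trans _ _ (2 * u)); first by rewrite ler_wpM2l.
  by rewrite /u invfM mulrA ler_wpM2r// invr_ge0 ltW.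
- move=> g ag; apply: (le_trans (E_drift n0 ag)).
  apply: ler_wpM2r; first by apply: E_ge0 => w; exact: normr_ge0.
  apply: (@le_trans _ _ (fresh_cst * (u * u))).
    by rewrite invfM ler_wpM2l//; apply: ler_pM.
  rewrite (_ : fresh_cst * (u * u) = fresh_cst / c ^+ 2 / x ^+ 2).
    by rewrite ler_wpM2r// invr_ge0 exprn_ge0// ltW.
  by rewrite /u; field; rewrite !gt_eqF.
move=> g ag; set J := \int[P]_w (g w * (pred A n w * (1 - pred A n w))).
have bp := bm_pred A n; have bg := bm_adapted ag.
set G := \int[P]_w `|g w|.
have G0 : 0 <= G by apply: E_ge0 => w; exact: normr_ge0.
have JG : `|J| <= G.
  apply: Enorm_le; [| |move=> w].
  - by apply/bm_integ/bmM => //; apply: bmM => //; exact: bmB.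
  - exact/bm_integ/bm_norm.
  have /andP[p0 p1] := pred01 A w n0.
  rewrite normrM ler_piMr//; move: (pred A n w) p0 p1 => q p0 p1.
  by rewrite ler_norml; apply/andP; split; nra.
have h1 := E_quadratic n0 ag; rewrite -/J -/G in h1.
have e1 : 3 * fresh_cst / ((theta + n%:R) * (theta + n.+1%:R) ^+ 2) <=
    3 * fresh_cst / c ^+ 3 / x ^+ 3.
  rewrite (_ : 3 * fresh_cst / c ^+ 3 / x ^+ 3 = 3 * fresh_cst * (u * u ^+ 2)); last first.
    by rewrite /u; field; rewrite !gt_eqF.
  rewrite ler_wpM2l ?mulr_ge0// invfM -exprVn; apply: ler_pM => //.
  exact: exprn_ge0.
have xx : (x * n.+1%:R)^-1 <= (x ^+ 2)^-1.
  rewrite lef_pV2 ?posrE ?exprn_gt0 ?mulr_gt0// -natr1 -/x.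
  by rewrite expr2 ler_wpM2l ?(ltW x0)// lerDl.
have e2 : `|i1 ^+ 2 - (x * n.+1%:R)^-1| <= D / c ^+ 2 / x ^+ 3.
  have -> : i1 ^+ 2 - (x * n.+1%:R)^-1 =
      (x * (x + 1) - (theta + x + 1) ^+ 2) * (i1 ^+ 2 * (x * n.+1%:R)^-1).
    have x1 : 0 < x + 1 by rewrite ltr_wpDr.
    have tx1 : 0 < theta + x + 1 by rewrite -t1E.
    rewrite /i1 t1E -natr1 -/x; field.
    by rewrite !gt_eqF.
  have -> : D / c ^+ 2 / x ^+ 3 = (D * x) * (u ^+ 2 * (x ^+ 2)^-1).
    by rewrite /u; field; rewrite !gt_eqF.
  rewrite normrM; apply: ler_pM => //.
    rewrite /D; have a0 := normr_ge0 theta.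
    have p := ler_norm theta; have q : - theta <= `|theta| by rewrite -normrN ler_norm.
    have sq : theta ^+ 2 = `|theta| ^+ 2 by rewrite real_normK// num_real.
    rewrite ler_norml; apply/andP; split; nra.
  rewrite ger0_norm ?mulr_ge0 ?exprn_ge0 ?invr_ge0 ?mulr_ge0 ?(ltW x0) ?(ltW t1)//.
  by apply: ler_pM => //; rewrite ?exprn_ge0// invr_ge0 mulr_ge0 ?(ltW x0).
set I := \int[P]_w _ in h1 *.
have -> : I - (x * n.+1%:R)^-1 * J = (I - i1 ^+ 2 * J) + (i1 ^+ 2 - (x * n.+1%:R)^-1) * J.
  by ring.
apply: (le_trans (ler_normD _ _)).
apply: (@le_trans _ _ ((3 * fresh_cst / c ^+ 3 + D / c ^+ 2) / x ^+ 3 * G)); last first.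
  by rewrite ler_wpM2r// ler_wpM2r// invr_ge0 exprn_ge0// ltW.
rewrite [(_ + D / _) / _]mulrDl [leRHS]mulrDl; apply: lerD.
  by apply: (le_trans h1); rewrite ler_wpM2r.
by rewrite normrM; apply: ler_pM.
Qed.

End urn.

(** * Summation, continuity and measurability *)
Section sums.
Context {R : realType}.

(** Comparison with a telescoping sum: [k^-2 <= 2 (k^-1 - (k + 1)^-1)]. *)
Lemma le_inv_sq_steps (f : nat -> R) (B : R) n : (0 < n)%N -> 0 <= B ->
  (forall k, (n <= k)%N -> f k.+1 <= f k + B / k%:R ^+ 2) ->
  forall k, (n <= k)%N -> f k <= f n + 2 * B / n%:R.
Proof.
move=> n0 B0 fS k nk.
suff : f k <= f n + 2 * B * (n%:R^-1 - k%:R^-1).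
  move=> /le_trans; apply; rewrite lerD2l ler_wpM2l ?mulr_ge0//.
  by rewrite gerBl invr_ge0.
elim: k nk => [|k ih].
  by rewrite leqn0 => /eqP nE; rewrite nE in n0.
rewrite leq_eqVlt => /predU1P[<-|nk]; first by rewrite subrr mulr0 addr0.
apply: (le_trans (fS k nk)).
have k0 : 0 < k%:R :> R by rewrite ltr0n (leq_trans n0).
have k1 : 1 <= k%:R :> R by rewrite ler1n (leq_trans n0).
have : B / k%:R ^+ 2 <= 2 * B * (k%:R^-1 - k.+1%:R^-1).
  rewrite -natr1 (_ : 2 * B * _ = B * (2 / (k%:R * (k%:R + 1)))); last first.
    by field; rewrite !gt_eqF// ltr_wpDr.
  have kk : 0 < k%:R * (k%:R + 1) :> R by rewrite mulr_gt0// ltr_wpDr.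
  rewrite ler_wpM2l// ler_pdivlMr// [leLHS]mulrC ler_pdivrMr ?exprn_gt0//.
  by have : k%:R * 1 <= k%:R * k%:R :> R; [rewrite ler_wpM2l// ltW|rewrite expr2; lra].
move=> h; apply: (le_trans (lerD (ih nk) h)).
by apply: le_of_eq; ring.
Qed.
End sums.

Section smooth_continuity.
Context {R : realType}.

Lemma taylor3_cvg (F F1 F2 : R -> R) C (x_ : nat -> R) (x : R) :
  taylor3 F F1 F2 C -> x_ n @[n --> \oo] --> x -> F (x_ n) @[n --> \oo] --> F x.
Proof.
move=> [bF bF1 bF2 C0 FT] xx.
suff : F (x_ n) - F x @[n --> \oo] --> (0 : R).
  move=> h; rewrite -[F x]add0r.
  under eq_fun do rewrite -[F (x_ _)](subrK (F x)).
  by apply: cvgD => //; exact: cvg_cst.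
have dx : x_ n - x @[n --> \oo] --> (0 : R).
  by rewrite -(subrr x); apply: cvgB => //; exact: cvg_cst.
have dn : `|x_ n - x| @[n --> \oo] --> (0 : R).
  by rewrite -(normr0 R); exact: cvg_norm.
have up : `|x_ n - x| * `|F1 x| + `|x_ n - x| * `|x_ n - x| * `|F2 x / 2| +
   C * (`|x_ n - x| * `|x_ n - x| * `|x_ n - x|) @[n --> \oo] --> (0 : R).
  rewrite [X in _ --> X](_ : 0 = 0 * `|F1 x| + 0 * 0 * `|F2 x / 2| + C * (0 * 0 * 0)); last by ring.
  apply: cvgD; first apply: cvgD.
  - by apply: cvgMl.
  - by apply: cvgMl; apply: cvgM.
  - by apply: cvgMr; apply: cvgM => //; exact: cvgM.
apply: norm_cvg0.
apply: (@squeeze_cvgr _ _ _ _ (fun=> 0) _ _ _ 0 _ up); last exact: cvg_cst.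
apply: nearW => n; rewrite normr_ge0/=.
have := FT x (x_ n - x); rewrite [x + _]addrC subrK.
set h := x_ n - x => FTh.
rewrite (_ : F (x_ n) - F x = (F (x_ n) - F x - h * F1 x - h ^+ 2 / 2 * F2 x) +
  (h * F1 x + h * h * (F2 x / 2))); last by field.
rewrite (le_trans (ler_normD _ _))// addrC lerD//.
  by rewrite (le_trans (ler_normD _ _))// !normrM.
by apply: (le_trans FTh); rewrite !exprS expr0 mulr1 mulrA.
Qed.

Lemma clamp_lip (a b : R) : `|clamp a - clamp b| <= `|a - b|.
Proof.
wlog ab : a b / a <= b.
  move=> H; have [ab|/ltW ba] := leP a b; first exact: H.
  by rewrite distrC (distrC a); exact: H.
have [b0|b0] := leP b 0.
  by rewrite !clamp_le0 ?subrr ?normr0// (le_trans ab).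
have [a1|a1] := leP 1 a.
  by rewrite !clamp_ge1 ?subrr ?normr0// (le_trans a1).
have bE : clamp b <= b by rewrite /clamp ge_max ltW//= ge_min lexx.
have aE : a <= clamp a by rewrite /clamp le_max le_min lexx (ltW a1) orbT.
have cab : clamp a <= clamp b.
  by rewrite /clamp; apply: le_max2 => //; apply: le_min2.
by rewrite distrC (distrC a) !ger0_norm ?subr_ge0// lerB.
Qed.

Lemma continuous_gauss_avg_var (F F1 F2 : R -> R) C : taylor3 F F1 F2 C ->
  continuous (fun v => gauss_avg (clamp v) F 0).
Proof.
move=> tF v; have [_ _ /bmP[M M0 F2M] C0 _] := tF.
have K0 : 0 < C * cube_cst + M.
  by rewrite ltr_wpDl// mulr_ge0// /cube_cst mulr_ge0// expR_ge0.
apply/cvgrPdist_le => e e0.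
have h : \forall u \near v, `|clamp v - clamp u| <= e / (C * cube_cst + M).
  near=> u; apply: (le_trans (clamp_lip _ _)).
  near: u; have /cvgrPdist_le : (id : R -> R) u @[u --> v] --> v by exact: cvg_id.
  by apply; rewrite divr_gt0.
apply: filterS h => u h.
apply: (le_trans (gauss_avg_lip 0 (clamp01 v) (clamp01 u) tF F2M)).
by rewrite mulrC -ler_pdivlMr.
Unshelve. all: by end_near. Qed.

End smooth_continuity.

Section planar.
Context {R : realType}.

(** The measurable sets of the plane are generated by rectangles; an open set
    is the countable union of the rational squares that it contains. *)
Lemma continuous_measurable_fun2 (f : R * R -> R) : continuous f ->
  measurable_fun [set: R * R] f.
Proof.
move=> cf; apply: (measurability _ (RGenOpens.measurableE R)).
move=> _ [_ [a [b ->] <-]]; rewrite setTI.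
have oU : open (f @^-1` `]a, b[%classic).
  by move/continuousP : cf; apply; exact: interval_open.
move: (f @^-1` _) oU => U oU.
pose box (p : rat * rat * nat) : set (R * R) :=
  ball (ratr p.1.1 : R) (p.2.+1%:R^-1) `*` ball (ratr p.1.2 : R) (p.2.+1%:R^-1).
rewrite (_ : U = \bigcup_p (if `[<box p `<=` U>] then box p else set0)).
  apply: countable_bigcupT_measurable => // p; case: ifP => // _.
  by apply: measurableX; apply: measurable_ball.
apply/seteqP; split => [[x y] Uxy|xy [p _]]; last first.
  by case: ifPn => // /asboolP; apply.
have /nbhs_ballP[e /= e0 eU] : nbhs (x, y) U by exact: open_nbhs_nbhs.
pose n := Num.trunc (2 / e).
pose r : R := n.+1%:R^-1.
have r0 : 0 < r by rewrite invr_gt0.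
have re : 2 * r < e by rewrite ltr_pdivrMr// mulrC -ltr_pdivrMr// truncnS_gt.
have approx (z : R) : exists t : rat, `|ratr t - z| < r.
  have /rat_in_itvoo[t] : z - r < z + r by lra.
  rewrite in_itv/= => /andP[t1 t2]; exists t.
  by rewrite ltr_norml; apply/andP; split; lra.
have near (z z' t : R) : `|t - z| < r -> `|t - z'| < r -> `|z - z'| < e.
  by rewrite !ltr_norml => /andP[? ?] /andP[? ?]; apply/andP; split; lra.
have [s sx] := approx x; have [t ty] := approx y.
exists (s, t, n) => //; rewrite ifT; first by split.
apply/asboolP => -[x' y'] [/= hx hy]; apply: eU.
by split; apply: near => //=; [exact: sx|exact: hx|exact: ty|exact: hy].
Qed.

(** Measurability in the variance, through the kernel [gauss_kernel]. *)
Lemma bm_gauss_avg_var d (T : measurableType d) (V : T -> R) (F : R -> R) (x : R) :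
  measurable_fun [set: T] V -> bm F -> bm (fun w => gauss_avg (V w) F x).
Proof.
move=> mV bF; have [mF _] := bF; have [M M0 FM] := bmP bF.
pose L : {mfun T >-> R} := HB.pack V (isMeasurableFun.Build _ _ _ _ _ mV).
pose g (p : T * R) : \bar R := (F (x + p.2) + M)%:E.
have g0 p : (0 <= g p)%E.
  by have := FM (x + p.2); rewrite ler_norml lee_fin => /andP[? _]; lra.
have mg : measurable_fun setT g.
  apply/measurable_EFinP; apply: measurable_funD => //.
  apply: (measurableT_comp mF); apply: measurable_funD => //.
have mI := @measurable_fun_integral_finite_kernel _ _ _ _ _ g (gauss_kernel L) g0 mg.
have gE w : gauss_avg (V w) F x = fine (\int[gauss_kernel L w]_y g (w, y)) - M.
  rewrite gauss_avgE; transitivity (\int[gauss 0 (V w)]_y (F (x + y) + M) - M) => //.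
  by rewrite ED ?Ecst ?addrK//; [exact: integ_shift|exact: bm_integ].
split; last first.
  by exists M => w; rewrite gauss_avgE; apply: Enorm_cst => //; exact: integ_shift.
rewrite (_ : (fun w => _) = (fun w => fine (\int[gauss_kernel L w]_y g (w, y)) - M)).
  by apply: measurable_funB => //; exact: (measurableT_comp _ mI).
by apply/funext.
Qed.

End planar.

(** * Limit theorem for almost martingales *)
Section almost_martingale.
Context d (T : measurableType d) (R : realType) (P : probability T R).
Context (S : finType) (Y : nat -> T -> S).
Hypothesis mY : forall (n : nat) (B : {set S}), (0 < n)%N ->
  measurable (Y n @^-1` [set` B]).
Variables (q : nat -> T -> R) (C : R).
Hypothesis aq : forall n, adapted Y n (q n).
Hypothesis q01 : forall n w, 0 <= q n w <= 1.
Hypothesis C0 : 0 < C.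
Hypothesis q_step : forall n w, (0 < n)%N -> `|q n.+1 w - q n w| <= C / n%:R.
Hypothesis q_drift : forall n (g : T -> R), (0 < n)%N -> adapted Y n g ->
  `|\int[P]_w (g w * (q n.+1 w - q n w))| <= C / n%:R ^+ 2 * \int[P]_w `|g w|.
Hypothesis q_quad : forall n (g : T -> R), (0 < n)%N -> adapted Y n g ->
  `|\int[P]_w (g w * (q n.+1 w - q n w) ^+ 2) -
    (n%:R * n.+1%:R)^-1 * \int[P]_w (g w * (q n w * (1 - q n w)))|
  <= C / n%:R ^+ 3 * \int[P]_w `|g w|.

Let bmA n (g : T -> R) : adapted Y n g -> bm g.
Proof. exact: adapted_bm. Qed.

Lemma bm_q n : bm (q n).
Proof. by apply: (@bmA n); exact: aq. Qed.

Lemma bm_q2 n : bm (fun w => q n w * (1 - q n w)).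
Proof. by apply: bmM; [exact: bm_q|apply: bmB => //; exact: bm_q]. Qed.

Definition dist_cst : R := 2 * (2 * C + C ^+ 2).

Lemma dist_cst_ge0 : 0 <= dist_cst.
Proof. by have c0 := ltW C0; rewrite mulr_ge0// addr_ge0 ?mulr_ge0 ?exprn_ge0. Qed.

(** Orthogonality of martingale increments, up to the drift: the squared
    distance grows by [O(k^-2)] at step [k]. *)
Lemma sq_dist_le n k : (0 < n <= k)%N ->
  \int[P]_w ((q k w - q n w) ^+ 2) <= dist_cst / n%:R.
Proof.
move=> /andP[n0 nk].
pose f k := \int[P]_w ((q k w - q n w) ^+ 2).
have f0 : f n = 0.
  by rewrite /f; under eq_Rintegral do rewrite subrr expr0n; rewrite Ecst.
have c0 := ltW C0.
rewrite -/(f k) (_ : dist_cst / n%:R = f n + 2 * (2 * C + C ^+ 2) / n%:R); last by rewrite f0 add0r.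
apply: le_inv_sq_steps => //; first by rewrite addr_ge0 ?mulr_ge0 ?exprn_ge0.
move=> {nk}j nj; have j0 : (0 < j)%N by exact: leq_trans nj.
have jr : 0 < j%:R :> R by rewrite ltr0n.
have bj := bm_q j; have bn := bm_q n; have bj1 := bm_q j.+1.
have bd : bm (fun w => q j w - q n w) by exact: bmB.
have bx : bm (fun w => q j.+1 w - q j w) by exact: bmB.
have ad : adapted Y j (fun w => q j w - q n w).
  by move=> w w' ww; rewrite (aq ww) (adapted_le nj (@aq n) ww).
rewrite /f.
have -> : \int[P]_w ((q j.+1 w - q n w) ^+ 2) = \int[P]_w ((q j w - q n w) ^+ 2) +
   (2 * \int[P]_w ((q j w - q n w) * (q j.+1 w - q j w)) +
    \int[P]_w ((q j.+1 w - q j w) ^+ 2)).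
  rewrite -EZ; last exact/bm_integ/bmM.
  rewrite -ED; [|by apply/bm_integ/bmM => //; exact: bmM|exact/bm_integ/bmX].
  rewrite -ED; [|exact/bm_integ/bmX|].
    by apply: eq_Rintegral => w _; ring.
  by apply/bm_integ/bmD; [apply: bmM => //; exact: bmM|exact: bmX].
rewrite lerD2l [leRHS]mulrDl lerD//.
  rewrite -mulrA ler_wpM2l// (le_trans (ler_norm _))//.
  apply: (le_trans (q_drift j0 ad)).
  rewrite ler_piMr ?divr_ge0 ?exprn_ge0//.
  apply: Ele_cst; first exact/bm_integ/bm_norm.
  move=> w; have /andP[a1 a2] := q01 j w; have /andP[b1 b2] := q01 n w.
  by rewrite ler_norml; apply/andP; split; lra.
apply: Ele_cst; first exact/bm_integ/bmX.
move=> w; rewrite -exprVn -exprMn -real_normK ?num_real// ler_pXn2r ?nnegrE ?divr_ge0//.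
exact: q_step.
Qed.

(** From the second to the first moment by [2 * s * `|x| <= s ^+ 2 * x ^+ 2 + 1]
    with [s = sqrt n]. *)
Lemma norm_dist_le n k : (0 < n <= k)%N ->
  \int[P]_w `|q k w - q n w| <= (dist_cst + 1) / (2 * Num.sqrt n%:R).
Proof.
move=> nk; have /andP[n0 _] := nk.
set s := Num.sqrt n%:R; have s0 : 0 < s by rewrite sqrtr_gt0 ltr0n.
have ss : s ^+ 2 = n%:R by rewrite sqr_sqrtr.
have bd : bm (fun w => q k w - q n w) by apply: bmB; exact: bm_q.
apply: (@le_trans _ _ (\int[P]_w (s / 2 * (q k w - q n w) ^+ 2 + (2 * s)^-1))).
  apply: Ele.
  - exact/bm_integ/bm_norm.
  - by apply/bm_integ/bmD => //; apply: bmM => //; exact: bmX.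
  move=> w; set x := q k w - q n w.
  rewrite -[x ^+ 2]real_normK ?num_real//.
  rewrite -subr_ge0 (_ : _ - _ = (s * `|x| - 1) ^+ 2 / (2 * s)); last by field; rewrite gt_eqF.
  by rewrite divr_ge0 ?sqr_ge0// mulr_ge0// ltW.
rewrite ED ?Ecst; [|by apply/bm_integ/bmM => //; exact: bmX|exact: bm_integ].
rewrite EZ; last exact/bm_integ/bmX.
have := sq_dist_le nk; rewrite -ss => h.
apply: (@le_trans _ _ (s / 2 * (dist_cst / s ^+ 2) + (2 * s)^-1)).
  by rewrite lerD2r ler_wpM2l// divr_ge0// ltW.
by apply: le_of_eq; field; rewrite gt_eqF.
Qed.

(** For fixed [n], [x k] is the current value of the rescaled fluctuation and
    [v k] the variance that it still has to accumulate after step [k]. *)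
Section lindeberg.
Variables (F F1 F2 : R -> R) (D M : R).
Hypothesis tF : taylor3 F F1 F2 D.
Hypothesis M0 : 0 < M.
Hypothesis F1M : forall x, `|F1 x| <= M.
Hypothesis F2M : forall x, `|F2 x| <= M.
Variable n : nat.
Hypothesis n0 : (0 < n)%N.
Variable g : T -> R.
Hypothesis ag : adapted Y n g.
Hypothesis g1 : forall w, `|g w| <= 1.

Let s : R := Num.sqrt n%:R.
Let x k w : R := s * (q n w - q k w).
Let v k w : R := n%:R * (q n w * (1 - q n w)) / k%:R.

Let s0 : 0 < s. Proof. by rewrite sqrtr_gt0 ltr0n. Qed.
Let ss : s ^+ 2 = n%:R. Proof. by rewrite sqr_sqrtr. Qed.

Let qq01 k w : 0 <= q k w * (1 - q k w) <= 1.
Proof.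
have := q01 k w; move: (q k w) => y /andP[? ?].
by apply/andP; split; nra.
Qed.

Let adap (h : R -> R -> R -> R) k l : (n <= k)%N ->
  adapted Y k (fun w => g w * h (x k w) (v l w) (q k w)).
Proof.
move=> nk w w' ww; rewrite (adapted_le nk ag ww) /x /v.
by rewrite (adapted_le nk (@aq n) ww) (aq ww).
Qed.

(** The contributions of the drift, of the second moment and of the third order
    remainders, in this order. *)
Definition step_cst : R := C * M + (C * M + M * (dist_cst + 1) / 2) / 2 + D * (C ^+ 3 + cube_cst).

Let U k : R := \int[P]_w (g w * gauss_avg (v k w) F (x k w)).

(** Write [h = x k.+1 - x k] and [de = v k - v k.+1]. Expanding
    [gauss_avg (v k.+1) F] at [x k] along [h], and in the variance along [de],
    leaves [h * F1 + (h ^+ 2 - de) / 2 * F2] and cubic errors. The drift bound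
    makes the mean of the first term small. In the second term the conditional
    mean of [h ^+ 2] is close to [n * q k * (1 - q k) / (k * k.+1)], which
    differs from [de] only through [q k] in place of [q n]. *)
Lemma lindeberg_step k : (n <= k)%N ->
  `|U k.+1 - U k| <= step_cst * s / k%:R ^+ 2.
Proof.
move=> nk; have k0 : (0 < k)%N by exact: leq_trans nk.
have kr : 0 < k%:R :> R by rewrite ltr0n.
have nkr : n%:R <= k%:R :> R by rewrite ler_nat.
have s1 : 1 <= s by rewrite -[leLHS]sqrtr1 ler_sqrt ?ler1n// ltr0n.
have [bF bF1 bF2 D0 FT] := tF.
pose de w := n%:R * (q n w * (1 - q n w)) / (k%:R * k.+1%:R).
pose h w := - s * (q k.+1 w - q k w).
pose H1 w := gauss_avg (v k.+1 w) F1 (x k w).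
pose H2 w := gauss_avg (v k.+1 w) F2 (x k w).
have a1 : adapted Y k (fun w => g w * H1 w).
  exact: (adap (fun a b _ => gauss_avg b F1 a)).
have a2 : adapted Y k (fun w => g w * H2 w).
  exact: (adap (fun a b _ => gauss_avg b F2 a)).
have b1 := bmA a1; have b2 := bmA a2; have bg := bmA ag.
have bh : bm h by apply: bmM => //; apply: bmB; exact: bm_q.
have bde : bm de by apply: bmM => //; apply: bmM => //; exact: bm_q2.
have bU j : (n <= j)%N -> bm (fun w => g w * gauss_avg (v j w) F (x j w)).
  by move=> nj; apply: bmA; exact: (adap (fun a b _ => gauss_avg b F a) j nj).
have n1k w : `|g w * H1 w| <= M.
  rewrite normrM -[M]mul1r; apply: ler_pM => //.
  by rewrite /H1 gauss_avgE; apply: Enorm_cst => //; exact: integ_shift.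
have n2k w : `|g w * H2 w| <= M.
  rewrite normrM -[M]mul1r; apply: ler_pM => //.
  by rewrite /H2 gauss_avgE; apply: Enorm_cst => //; exact: integ_shift.
pose er w := g w * gauss_avg (v k.+1 w) F (x k.+1 w) - g w * gauss_avg (v k w) F (x k w)
   - h w * (g w * H1 w) - (h w ^+ 2 - de w) / 2 * (g w * H2 w).
have ber : bm er.
  apply: bmB; last first.
    by apply: bmM => //; apply: bmM => //; apply: bmB => //; exact: bmX.
  by apply: bmB; [apply: bmB; apply: bU => //; exact: leqW|exact: bmM].
have erE w : `|er w| <= D * (C ^+ 3 + cube_cst) * s / k%:R ^+ 2.
  have de0 : 0 <= de w.
    by have /andP[q0 _] := qq01 n w; apply: divr_ge0; apply: mulr_ge0.
  have v0 : 0 <= v k.+1 w.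
    by have /andP[q0 _] := qq01 n w; apply: divr_ge0 => //; exact: mulr_ge0.
  have vE : v k w = de w + v k.+1 w.
    have kr1 : 0 < k%:R + 1 :> R by rewrite ltr_wpDr.
    by rewrite /v /de -natr1; field; rewrite !gt_eqF.
  have xE : x k.+1 w = x k w + h w by rewrite /x /h; ring.
  have tG := taylor3_gauss_avg (v k.+1 w) tF; have [_ _ _ _ GT] := tG.
  have e1 := GT (x k w) (h w).
  have e2 := gauss_avg_expand (x k w) de0 tG.
  rewrite (gauss_avg_conv (x k w) de0 v0 bF) -vE in e2.
  have h3 : `|h w| ^+ 3 <= C ^+ 3 * s / k%:R ^+ 2.
    have hC : `|h w| <= s * (C / k%:R).
      by rewrite /h normrM normrN (gtr0_norm s0) ler_wpM2l ?(ltW s0)//; exact: q_step.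
    apply: (@le_trans _ _ ((s * (C / k%:R)) ^+ 3)).
      by rewrite ler_pXn2r// nnegrE// mulr_ge0 ?divr_ge0 ?(ltW s0) ?(ltW C0).
    rewrite (_ : (s * (C / k%:R)) ^+ 3 = C ^+ 3 * s / k%:R ^+ 2 * (n%:R / k%:R)); last first.
      by rewrite -ss; field; rewrite gt_eqF.
    rewrite ler_piMr ?mulr_ge0 ?invr_ge0 ?exprn_ge0 ?(ltW s0) ?(ltW C0)//.
    by rewrite ler_pdivrMr// mul1r.
  have d3 : Num.sqrt (de w) ^+ 3 <= s / k%:R ^+ 2.
    have dC : Num.sqrt (de w) <= s / k%:R.
      rewrite -[leRHS]ger0_norm ?divr_ge0 ?(ltW s0)// -sqrtr_sqr ler_sqrt ?sqr_ge0//.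
      rewrite /de expr_div_n ss expr2; have /andP[q0 q1] := qq01 n w.
      rewrite -[X in _ <= X / _]mulr1; apply: ler_pM => //.
      - by rewrite mulr_ge0.
      - by rewrite ler_wpM2l.
      by rewrite lef_pV2 ?posrE ?mulr_gt0// -natr1 ler_wpM2l ?(ltW kr)// lerDl.
    apply: (@le_trans _ _ ((s / k%:R) ^+ 3)).
      by rewrite ler_pXn2r// nnegrE// divr_ge0// (ltW s0).
    rewrite (_ : (s / k%:R) ^+ 3 = s / k%:R ^+ 2 * (n%:R / k%:R)); last first.
      by rewrite -ss; field; rewrite gt_eqF.
    rewrite ler_piMr ?mulr_ge0 ?invr_ge0 ?exprn_ge0 ?(ltW s0)//.
    by rewrite ler_pdivrMr// mul1r.
  have -> : er w = g w * ((gauss_avg (v k.+1 w) F (x k w + h w) - gauss_avg (v k.+1 w) F (x k w)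
     - h w * H1 w - h w ^+ 2 / 2 * H2 w) -
     (gauss_avg (v k w) F (x k w) - gauss_avg (v k.+1 w) F (x k w) - de w / 2 * H2 w)).
    by rewrite /er xE; field.
  rewrite normrM -[leRHS]mul1r; apply: ler_pM => //.
  apply: (le_trans (ler_normB _ _)); apply: (le_trans (lerD e1 e2)).
  rewrite (_ : D * (C ^+ 3 + cube_cst) * s / k%:R ^+ 2 =
     D * (C ^+ 3 * s / k%:R ^+ 2) + D * cube_cst * (s / k%:R ^+ 2)); last by ring.
  apply: lerD; first by rewrite ler_wpM2l.
  by rewrite ler_wpM2l// mulr_ge0// /cube_cst mulr_ge0// expR_ge0.
have -> : U k.+1 - U k = - s * \int[P]_w (g w * H1 w * (q k.+1 w - q k w)) +
  2^-1 * (n%:R * \int[P]_w (g w * H2 w * (q k.+1 w - q k w) ^+ 2) -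
    \int[P]_w (g w * H2 w * de w)) + \int[P]_w er w.
  have bqq : bm (fun w => q k.+1 w - q k w) by apply: bmB; exact: bm_q.
  rewrite /U -EB; [|apply: bm_integ; exact: bU (leqW nk)|apply: bm_integ; exact: bU].
  rewrite -EZ; last exact/bm_integ/bmM.
  rewrite -[n%:R * _]EZ; last by apply/bm_integ/bmM => //; exact: bmX.
  rewrite -EB; last 2 first.
  - by apply/bm_integ/bmM => //; apply: bmM => //; exact: bmX.
  - by apply/bm_integ/bmM.
  rewrite -EZ; last first.
    apply/bm_integ/bmB; last exact: bmM.
    by apply: bmM => //; apply: bmM => //; exact: bmX.
  rewrite -ED; last 2 first.
  - by apply/bm_integ/bmM => //; exact: bmM.
  - apply/bm_integ/bmM => //; apply: bmB; last exact: bmM.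
    by apply: bmM => //; apply: bmM => //; exact: bmX.
  rewrite -ED; last 2 first.
  - apply/bm_integ/bmD; first by apply: bmM => //; exact: bmM.
    apply/bmM => //; apply: bmB; last exact: bmM.
    by apply: bmM => //; apply: bmM => //; exact: bmX.
  - exact: bm_integ.
  by apply: eq_Rintegral => w _; rewrite /er /h -ss; field.
have EM (G : T -> R) : bm G -> (forall w, `|G w| <= M) -> \int[P]_w `|G w| <= M.
  by move=> bG GM; apply: Ele_cst => //; apply/bm_integ/bm_norm.
have k2 : 0 <= (k%:R ^+ 2)^-1 :> R by rewrite invr_ge0 exprn_ge0.
have t1 : `|- s * \int[P]_w (g w * H1 w * (q k.+1 w - q k w))| <= C * M * s / k%:R ^+ 2.
  rewrite normrM normrN (gtr0_norm s0).
  rewrite (_ : C * M * s / k%:R ^+ 2 = s * (C / k%:R ^+ 2 * M)); last by ring.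
  rewrite ler_wpM2l ?(ltW s0)//; apply: (le_trans (q_drift k0 a1)).
  by rewrite ler_wpM2l ?mulr_ge0 ?(ltW C0)//; exact: EM.
have t3 : `|\int[P]_w er w| <= D * (C ^+ 3 + cube_cst) * s / k%:R ^+ 2.
  by apply: Enorm_cst => //; exact: bm_integ.
have t2 : `|n%:R * \int[P]_w (g w * H2 w * (q k.+1 w - q k w) ^+ 2) -
    \int[P]_w (g w * H2 w * de w)| <= (C * M + M * (dist_cst + 1) / 2) * s / k%:R ^+ 2.
  set I := \int[P]_w (_ * (_ - _) ^+ 2).
  pose J j := \int[P]_w (g w * H2 w * (q j w * (1 - q j w))).
  have -> : \int[P]_w (g w * H2 w * de w) = n%:R / (k%:R * k.+1%:R) * J n.
    rewrite -EZ; last by apply/bm_integ/bmM => //; exact: bm_q2.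
    by apply: eq_Rintegral => w _; rewrite /de; ring.
  have -> : n%:R * I - n%:R / (k%:R * k.+1%:R) * J n =
    n%:R * (I - (k%:R * k.+1%:R)^-1 * J k) + n%:R / (k%:R * k.+1%:R) * (J k - J n) by ring.
  rewrite (le_trans (ler_normD _ _))// 2!mulrDl lerD//.
    rewrite normrM ger0_norm//; apply: (@le_trans _ _ (n%:R * (C / k%:R ^+ 3 * M))).
      rewrite ler_wpM2l//; apply: (le_trans (q_quad k0 a2)).
      by rewrite ler_wpM2l ?mulr_ge0 ?invr_ge0 ?exprn_ge0 ?(ltW C0)//; exact: EM.
    rewrite (_ : n%:R * (C / k%:R ^+ 3 * M) = C * M / k%:R ^+ 2 * (n%:R / k%:R)); last first.
      by field; rewrite gt_eqF.
    rewrite (_ : C * M * s / _ = C * M / k%:R ^+ 2 * s); last by ring.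
    rewrite ler_wpM2l ?mulr_ge0 ?(ltW C0) ?(ltW M0)//.
    by rewrite (le_trans _ s1)// ler_pdivrMr// mul1r.
  have JJ : `|J k - J n| <= M * ((dist_cst + 1) / (2 * s)).
    have bqk := bm_q2 k; have bqn := bm_q2 n.
    rewrite /J -EB; [|exact/bm_integ/bmM|exact/bm_integ/bmM].
    apply: (@le_trans _ _ (\int[P]_w (M * `|q k w - q n w|))).
      have bkn : bm (fun w => q k w - q n w) by apply: bmB; exact: bm_q.
      apply: Enorm_le.
      - by apply/bm_integ/bmB; exact: bmM.
      - by apply/bm_integ/bmM => //; exact: bm_norm.
      move=> w; rewrite -mulrBr normrM; apply: ler_pM => //.
      have := q01 k w; have := q01 n w; move: (q k w) (q n w) => y z /andP[z0 z1] /andP[y0 y1].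
      rewrite (_ : _ - _ = (y - z) * (1 - y - z)); last by ring.
      rewrite normrM ler_piMr// ler_norml; apply/andP; split; lra.
    rewrite EZ; last by apply/bm_integ/bm_norm/bmB; exact: bm_q.
    by rewrite ler_wpM2l ?(ltW M0)// norm_dist_le// n0.
  have pos : 0 <= n%:R / (k%:R * k.+1%:R) :> R by apply: divr_ge0 => //; exact: mulr_ge0.
  rewrite normrM (ger0_norm pos).
  rewrite (_ : M * (dist_cst + 1) / 2 * s / k%:R ^+ 2 =
    n%:R / k%:R ^+ 2 * (M * ((dist_cst + 1) / (2 * s)))); last first.
    by rewrite -ss; field; rewrite !gt_eqF.
  apply: ler_pM => //; rewrite ler_wpM2l// lef_pV2 ?posrE ?exprn_gt0 ?mulr_gt0//.
  by rewrite -natr1 expr2 ler_wpM2l ?(ltW kr)// lerDl.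
rewrite (le_trans (ler_normD _ _))//.
rewrite (_ : step_cst * s / _ = (C * M * s / k%:R ^+ 2 +
  2^-1 * ((C * M + M * (dist_cst + 1) / 2) * s / k%:R ^+ 2)) +
  D * (C ^+ 3 + cube_cst) * s / k%:R ^+ 2); last by rewrite /step_cst; ring.
apply: lerD => //; rewrite (le_trans (ler_normD _ _))//; apply: lerD => //.
by rewrite normrM ger0_norm ?invr_ge0// ler_wpM2l// invr_ge0.
Qed.

Lemma step_cst_ge0 : 0 <= step_cst.
Proof.
have [_ _ _ D0 _] := tF; have c0 := ltW C0; have m0 := ltW M0; have k0 := dist_cst_ge0.
have k30 : 0 <= cube_cst :> R by rewrite /cube_cst mulr_ge0// expR_ge0.
by rewrite /step_cst !addr_ge0 ?mulr_ge0 ?addr_ge0 ?mulr_ge0 ?addr_ge0 ?exprn_ge0.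
Qed.

Lemma lindeberg_sum k : (n <= k)%N -> `|U k - U n| <= 2 * step_cst / s.
Proof.
move=> nk.
have := @le_inv_sq_steps R (fun j => `|U j - U n|) (step_cst * s) n n0.
move=> /(_ (mulr_ge0 step_cst_ge0 (ltW s0)) _ k nk).
rewrite subrr normr0 add0r (_ : 2 * (step_cst * s) / n%:R = 2 * step_cst / s); last first.
  by rewrite -ss; field; rewrite gt_eqF.
apply => j nj; rewrite (_ : U j.+1 - U n = (U j - U n) + (U j.+1 - U j)); last by ring.
by rewrite (le_trans (ler_normD _ _))// lerD2l; exact: lindeberg_step.
Qed.

Variable Z : T -> R.
Hypothesis mZ : measurable_fun [set: T] Z.
Hypothesis qZ : {ae P, forall w, q k w @[k --> \oo] --> Z w}.

(** As [k] grows, the remaining variance [v k] vanishes and [x k] converges, so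
    that [U k] tends to the first integral; [U n] is the second one. *)
Lemma lindeberg_limit :
  `|\int[P]_w (g w * F (s * (q n w - Z w))) -
    \int[P]_w (g w * gauss_avg (q n w * (1 - q n w)) F 0)| <= 2 * step_cst / s.
Proof.
have [bF bF1 bF2 D0 FT] := tF; have [mF [MF FMF]] := bF.
have bg := bmA ag; have [mg _] := bg.
have k30 : 0 <= cube_cst :> R by rewrite /cube_cst mulr_ge0// expR_ge0.
have Kn0 : 0 <= D * cube_cst + M by rewrite addr_ge0 ?mulr_ge0 ?(ltW M0).
have mx k : measurable_fun setT (x k).
  by have [] : bm (x k) by apply: bmM => //; apply: bmB; exact: bm_q.
have bFx k : bm (fun w => g w * F (x k w)).
  apply: bmM => //; split; first exact: measurableT_comp.
  by exists MF => w.
have Un : U n = \int[P]_w (g w * gauss_avg (q n w * (1 - q n w)) F 0).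
  apply: eq_Rintegral => w _; rewrite /x subrr mulr0 /v [n%:R * _ / _]mulrAC divff ?mul1r//.
  by rewrite pnatr_eq0 -lt0n.
set L := \int[P]_w (g w * F (s * (q n w - Z w))).
have FL : \int[P]_w (g w * F (x k w)) @[k --> \oo] --> L.
  apply: (@E_dct _ _ _ _ _ _ (1 * MF)).
  - by move=> k; have [] := bFx k.
  - apply: measurable_funM => //; apply: (measurableT_comp mF).
    apply: measurable_funM => //; apply: measurable_funB => //.
    by have [] := bm_q n.
  - by move=> k w; rewrite normrM; apply: ler_pM.
  - apply: filterS qZ => w /= qw; apply: cvgMr; apply: (taylor3_cvg tF).
    by apply: cvgMr; apply: cvgB => //; exact: cvg_cst.
rewrite -Un; apply/ler_addgt0Pr => e e0.
have e20 : 0 < e / 2 by rewrite divr_gt0.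
have /cvgrPdist_le/(_ _ e20)[N1 _ hN1] := FL.
pose N2 := (Num.trunc ((D * cube_cst + M) * n%:R / (e / 2))).+1.
pose k := maxn n (maxn N1 N2).
have nk : (n <= k)%N by rewrite leq_max leqnn.
have k0 : (0 < k)%N by exact: leq_trans nk.
have h1 : `|L - \int[P]_w (g w * F (x k w))| <= e / 2.
  by apply: hN1; rewrite /= /k !leq_max leqnn orbT.
have kr : 0 < k%:R :> R by rewrite ltr0n.
have nkr : n%:R / k%:R <= 1 :> R by rewrite ler_pdivrMr// mul1r ler_nat.
have h2 : `|U k - \int[P]_w (g w * F (x k w))| <= e / 2.
  rewrite /U -EB; [|apply: bm_integ|exact: bm_integ]; last first.
    by apply: (@bmA k); exact: (adap (fun a b _ => gauss_avg b F a)).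
  apply: Enorm_cst => [|w].
    apply/bm_integ/bmB => //.
    by apply: (@bmA k); exact: (adap (fun a b _ => gauss_avg b F a)).
  rewrite -mulrBr normrM -[e / 2]mul1r; apply: ler_pM => //.
  have /andP[q0 q1] := qq01 n w.
  have v0 : 0 <= v k w by apply: divr_ge0 => //; exact: mulr_ge0.
  have vn : v k w <= n%:R / k%:R by rewrite /v ler_wpM2r ?invr_ge0// ler_piMr.
  have v01 : 0 <= v k w <= 1 by rewrite v0 (le_trans vn).
  apply: (le_trans (gauss_avg_near (x k w) v01 tF F2M)).
  apply: (le_trans (ler_wpM2l Kn0 vn)).
  rewrite mulrA ler_pdivrMr// -ler_pdivrMl// mulrC.
  have : (D * cube_cst + M) * n%:R / (e / 2) < N2%:R by rewrite /N2 truncnS_gt.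
  move=> /ltW /le_trans; apply; rewrite ler_nat.
  by rewrite /k !leq_max leqnn !orbT.
have h3 := lindeberg_sum nk.
rewrite (_ : L - U n = (L - \int[P]_w (g w * F (x k w))) -
  (U k - \int[P]_w (g w * F (x k w))) + (U k - U n)); last by ring.
rewrite (le_trans (ler_normD _ _))// [leRHS]addrC lerD//.
by rewrite (le_trans (ler_normB _ _))// [e]splitr lerD.
Qed.

End lindeberg.

(** Rescaled fluctuations and their Gaussian average have the same asymptotic
    integrals on every event. The clamp is the identity on [Z * (1 - Z)]; it
    makes the Gaussian average continuous on the whole line. In [gap'] the
    limit is replaced by [q k], which makes it a function of finitely many
    draws. *)
Section stable_limit.
Variables (F F1 F2 : R -> R) (D : R).
Hypothesis tF : taylor3 F F1 F2 D.
Variable Z : T -> R.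
Hypothesis mZ : measurable_fun [set: T] Z.
Hypothesis Z01 : forall w, 0 <= Z w <= 1.
Hypothesis qZ : {ae P, forall w, q k w @[k --> \oo] --> Z w}.

Let gap n w : R :=
  F (Num.sqrt n%:R * (q n w - Z w)) - gauss_avg (clamp (Z w * (1 - Z w))) F 0.

Let gap' n k w : R :=
  F (Num.sqrt n%:R * (q n w - q k w)) - gauss_avg (clamp (q k w * (1 - q k w))) F 0.

Let Z2_01 w : 0 <= Z w * (1 - Z w) <= 1.
Proof.
by have := Z01 w; move: (Z w) => y /andP[? ?]; apply/andP; split; nra.
Qed.

Let q2_01 k w : 0 <= q k w * (1 - q k w) <= 1.
Proof.
by have := q01 k w; move: (q k w) => y /andP[? ?]; apply/andP; split; nra.
Qed.

Let bmZ : bm Z.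
Proof.
by split => //; exists 1 => w; have /andP[? ?] := Z01 w; rewrite ger0_norm.
Qed.

Let bmZ2 : bm (fun w => Z w * (1 - Z w)).
Proof. by apply: bmM => //; apply: bmB. Qed.

Let gap_bound : exists2 M : R, 0 < M & forall u y, `|F u - gauss_avg y F 0| <= M.
Proof.
have [bF _ _ _ _] := tF; have [M M0 FM] := bmP bF.
exists (M + M) => [|u y]; first exact: addr_gt0.
rewrite (le_trans (ler_normB _ _))// lerD// gauss_avgE.
by apply: Enorm_cst => //; exact: integ_shift.
Qed.

Let bm_gap_gen (h1 h2 : T -> R) : measurable_fun setT h1 -> measurable_fun setT h2 ->
  bm (fun w => F (h1 w) - gauss_avg (clamp (h2 w)) F 0).
Proof.
move=> mh1 mh2; have [bF _ _ _ _] := tF; apply: bmB; first exact: bm_comp mh1 bF.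
apply: bm_gauss_avg_var => //; exact: (measurableT_comp measurable_clamp).
Qed.

Let bm_gap n : bm (gap n).
Proof.
apply: bm_gap_gen; last by case: bmZ2.
apply: measurable_funM => //; apply: measurable_funB => //.
by case: (bm_q n).
Qed.

Let bm_gap' n k : bm (gap' n k).
Proof.
apply: bm_gap_gen; last by case: (bm_q2 k).
apply: measurable_funM => //; apply: measurable_funB.
  by case: (bm_q n).
by case: (bm_q k).
Qed.

(** Against a function of finitely many draws: [lindeberg_limit], followed by
    the replacement of [q n] by its limit in the variance. *)
Lemma gap_adapted_cvg0 m (g : T -> R) : adapted Y m g -> (forall w, `|g w| <= 1) ->
  \int[P]_w (g w * gap n w) @[n --> \oo] --> (0 : R).
Proof.
move=> ag g1; have [bF /bmP[M1 M10 F1M] /bmP[M2 M20 F2M] D0 _] := tF.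
pose M := M1 + M2; have M0 : 0 < M by exact: addr_gt0.
have F1M' u : `|F1 u| <= M by rewrite (le_trans (F1M u))// lerDl ltW.
have F2M' u : `|F2 u| <= M by rewrite (le_trans (F2M u))// lerDr ltW.
pose K := step_cst D M; pose K' := D * cube_cst + M.
have bg := bmA ag.
apply/cvgr0P => e e0.
have dV : \int[P]_w `|q n w * (1 - q n w) - Z w * (1 - Z w)| @[n --> \oo] --> (0 : R).
  rewrite -[X in _ --> X](Ecst P); apply: (@E_dct _ _ _ _ _ _ 1).
  - by move=> n; case: (bm_norm (bmB (bm_q2 n) bmZ2)).
  - exact: measurable_cst.
  - move=> n w; rewrite normr_id; have /andP[? ?] := q2_01 n w.
    by have /andP[? ?] := Z2_01 w; rewrite ler_norml; apply/andP; split; lra.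
  - apply: filterS qZ => w /= qw; rewrite -[X in _ --> X](normr0 R).
    apply: cvg_norm; rewrite -[X in _ --> X](subrr (Z w * (1 - Z w))).
    apply: cvgB; last exact: cvg_cst.
    by apply: cvgM => //; apply: cvgB => //; exact: cvg_cst.
have K'0 : 0 < K'.
  by rewrite /K' ltr_wpDl// mulr_ge0// /cube_cst mulr_ge0// expR_ge0.
have /cvgr0P/(_ (e / (2 * K')))[|N1 hN1] := dV; first by rewrite divr_gt0// mulr_gt0.
have K0 : 0 <= K by exact: step_cst_ge0 tF M0.
pose N2 := (Num.trunc ((4 * K / e) ^+ 2)).+1.
exists (maxn (maxn N1 N2) m.+1) => n; rewrite !geq_max => /andP[/andP[nN1 nN2] nm].
have n0 : (0 < n)%N by exact: leq_trans nm.
have agn : adapted Y n g by exact: adapted_le (ltnW nm) ag.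
have h1 := lindeberg_limit tF M0 F1M' F2M' n0 agn g1 mZ qZ.
have bgap := bm_gap n.
have bFn : bm (fun w => F (Num.sqrt n%:R * (q n w - Z w))).
  have [mF [MF FMF]] := bF; split; last by exists MF => w.
  apply: (measurableT_comp mF); apply: measurable_funM => //.
  by apply: measurable_funB => //; case: (bm_q n).
have bgq : bm (fun w => gauss_avg (q n w * (1 - q n w)) F 0).
  by apply: bm_gauss_avg_var => //; case: (bm_q2 n).
have bgz : bm (fun w => gauss_avg (clamp (Z w * (1 - Z w))) F 0).
  apply: bm_gauss_avg_var => //; apply: (measurableT_comp measurable_clamp).
  by case: bmZ2.
have -> : \int[P]_w (g w * gap n w) =
  (\int[P]_w (g w * F (Num.sqrt n%:R * (q n w - Z w))) -
    \int[P]_w (g w * gauss_avg (q n w * (1 - q n w)) F 0)) +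
  \int[P]_w (g w * (gauss_avg (q n w * (1 - q n w)) F 0 - gauss_avg (clamp (Z w * (1 - Z w))) F 0)).
  rewrite -EB; [|exact/bm_integ/bmM|exact/bm_integ/bmM].
  rewrite -ED; last 2 first.
  - by apply/bm_integ/bmB; exact: bmM.
  - by apply/bm_integ/bmM => //; exact: bmB.
  by apply: eq_Rintegral => w _; rewrite /gap; ring.
rewrite (le_trans (ler_normD _ _))// [e]splitr lerD//.
  apply: (le_trans h1); rewrite -/K.
  have s0 : 0 < Num.sqrt n%:R :> R by rewrite sqrtr_gt0 ltr0n.
  rewrite ler_pdivrMr// -ler_pdivrMl ?divr_gt0//.
  rewrite (_ : (e / 2)^-1 * (2 * K) = 4 * K / e); last by field; rewrite gt_eqF.
  have : (4 * K / e) ^+ 2 <= n%:R.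
    apply: (@le_trans _ _ N2%:R); last by rewrite ler_nat.
    by apply: ltW; rewrite /N2 truncnS_gt.
  move=> h; rewrite -[leLHS]ger0_norm; last by rewrite divr_ge0 ?mulr_ge0 ?(ltW e0).
  by rewrite -sqrtr_sqr ler_sqrt.
apply: (@le_trans _ _ (\int[P]_w (K' * `|q n w * (1 - q n w) - Z w * (1 - Z w)|))).
  apply: Enorm_le.
  - by apply/bm_integ/bmM => //; exact: bmB.
  - by apply/bm_integ/bmM => //; apply: bm_norm; apply: bmB => //; exact: bm_q2.
  move=> w; rewrite normrM -[leRHS]mul1r; apply: ler_pM => //.
  by rewrite (clampE (Z2_01 w)); exact: (gauss_avg_lip 0 (q2_01 n w) (Z2_01 w) tF F2M').
rewrite EZ; last by apply/bm_integ/bm_norm/bmB => //; exact: bm_q2.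
rewrite -ler_pdivlMl//; have := hN1 n nN1.
rewrite ger0_norm; last by apply: E_ge0 => w; exact: normr_ge0.
by move=> /le_trans; apply; apply: le_of_eq; field; rewrite !gt_eqF.
Qed.

(** [renyi_mixing] asks for the asymptotic orthogonality of the gaps among
    themselves. As [k] grows, [gap' m k] converges in mean to [gap m], and
    [gap_adapted_cvg0] applies to it. *)
Lemma marginal_mixing (H : set T) : measurable H ->
  \int[P]_w (\1_H w * gap n w) @[n --> \oo] --> (0 : R).
Proof.
move=> mH; have [M M0 FM] := gap_bound.
apply: (@renyi_mixing _ _ _ _ gap _ M).
- by move=> n; case: (bm_gap n).
- by move=> n w; exact: FM.
- exact: bm_indic.
- by move=> w; rewrite indicE; case: (w \in H); rewrite ?normr1 ?normr0.
move=> m; apply/cvgr0P => e e0.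
have dg : \int[P]_w `|gap' m k w - gap m w| @[k --> \oo] --> (0 : R).
  rewrite -[X in _ --> X](Ecst P); apply: (@E_dct _ _ _ _ _ _ (M + M)).
  - by move=> n; case: (bm_norm (bmB (bm_gap' m n) (bm_gap m))).
  - exact: measurable_cst.
  - move=> n w; rewrite normr_id (le_trans (ler_normB _ _))//.
    by apply: lerD; exact: FM.
  - apply: filterS qZ => w /= qw; rewrite -[X in _ --> X](normr0 R).
    apply: cvg_norm; rewrite -[X in _ --> X](subrr (gap m w)).
    apply: cvgB; last exact: cvg_cst.
    apply: cvgB.
      apply: (taylor3_cvg tF); apply: cvgMr; apply: cvgB => //; exact: cvg_cst.
    apply: (@cvg_comp _ _ _ (fun k => q k w * (1 - q k w))
      (fun v => gauss_avg (clamp v) F 0) _ (nbhs (Z w * (1 - Z w)))).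
      by apply: cvgM => //; apply: cvgB => //; exact: cvg_cst.
    exact: (continuous_gauss_avg_var tF).
have e2 : 0 < e / (2 * M) by rewrite divr_gt0// mulr_gt0.
have /cvgr0P/(_ _ e2)[k hk] := dg.
have {}hk := hk k (leqnn k).
rewrite ger0_norm in hk; last by apply: E_ge0 => w; exact: normr_ge0.
pose G w := M^-1 * gap' m k w.
have aG : adapted Y (maxn m k) G.
  move=> w w' ww; rewrite /G /gap'.
  by rewrite (adapted_le (leq_maxl m k) (@aq m) ww) (adapted_le (leq_maxr m k) (@aq k) ww).
have G1 w : `|G w| <= 1.
  rewrite normrM ger0_norm ?invr_ge0 ?(ltW M0)// -ler_pdivlMl ?invr_gt0// invrK mulr1.
  exact: FM.
have /cvgr0P/(_ (e / (2 * M)) e2)[N hN] := gap_adapted_cvg0 aG G1.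
exists N => n nN.
have bgn := bm_gap n; have bgm := bm_gap m; have bgk := bm_gap' m k.
have bG := bmA aG.
have -> : \int[P]_w (gap m w * gap n w) = M * \int[P]_w (G w * gap n w) -
   \int[P]_w ((gap' m k w - gap m w) * gap n w).
  rewrite -EZ; last exact/bm_integ/bmM.
  rewrite -EB; last 2 first.
  - by apply/bm_integ/bmM => //; exact: bmM.
  - by apply/bm_integ/bmM => //; exact: bmB.
  by apply: eq_Rintegral => w _; rewrite /G; field; rewrite gt_eqF.
rewrite (le_trans (ler_normB _ _))// [e]splitr lerD//.
  rewrite normrM gtr0_norm// -ler_pdivlMl//; apply: (le_trans (hN n nN)).
  by apply: le_of_eq; field; rewrite gt_eqF.
apply: (@le_trans _ _ (\int[P]_w (M * `|gap' m k w - gap m w|))).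
  apply: Enorm_le.
  - by apply/bm_integ/bmM => //; exact: bmB.
  - by apply/bm_integ/bmM => //; apply/bm_norm/bmB.
  by move=> w; rewrite normrM mulrC; apply: ler_pM => //; exact: FM.
rewrite EZ; last by apply/bm_integ/bm_norm/bmB.
rewrite -ler_pdivlMl//; apply: (le_trans hk).
by apply: le_of_eq; field; rewrite gt_eqF.
Qed.

End stable_limit.
Section joint_limit.
Variable Z : T -> R.
Hypothesis mZ : measurable_fun [set: T] Z.
Hypothesis Z01 : forall w, 0 <= Z w <= 1.
Hypothesis qZ : {ae P, forall w, q k w @[k --> \oo] --> Z w}.

Let bmZ : bm Z.
Proof.
by split => //; exists 1 => w; have /andP[? ?] := Z01 w; rewrite ger0_norm.
Qed.

Lemma sq_dist_limit_le n : (0 < n)%N -> n%:R * \int[P]_w ((q n w - Z w) ^+ 2) <= dist_cst.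
Proof.
move=> n0; have nr : 0 < n%:R :> R by rewrite ltr0n.
rewrite -ler_pdivlMl// mulrC.
have h : \int[P]_w ((q k w - q n w) ^+ 2) @[k --> \oo] --> \int[P]_w ((Z w - q n w) ^+ 2).
  apply: (@E_dct _ _ _ _ _ _ 1).
  - by move=> k; case: (bmX 2 (bmB (bm_q k) (bm_q n))).
  - by case: (bmX 2 (bmB bmZ (bm_q n))).
  - move=> k w; rewrite normrX exprn_ile1//.
    have /andP[? ?] := q01 k w; have /andP[? ?] := q01 n w.
    by rewrite ler_norml; apply/andP; split; lra.
  - apply: filterS qZ => w /= qw.
    have hB : q k w - q n w @[k --> \oo] --> Z w - q n w.
      by apply: cvgB => //; exact: cvg_cst.
    by under eq_fun do rewrite expr2; rewrite expr2; exact: cvgM.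
have -> : \int[P]_w ((q n w - Z w) ^+ 2) = \int[P]_w ((Z w - q n w) ^+ 2).
  by apply: eq_Rintegral => w _; rewrite -sqrrN opprB.
apply: (cvgr_to_le h).
by exists n => // k /= nk; apply: sq_dist_le; rewrite n0.
Qed.

Variables (c : nat -> T -> R) (B : R).
Hypothesis mc : forall n, measurable_fun setT (c n).
Hypothesis c_le : forall n w, (0 < n)%N -> `|c n w| <= B / Num.sqrt n%:R.
Variables (f : R * R -> R) (M : R).
Hypothesis cf : continuous f.
Hypothesis fM : forall p, `|f p| <= M.

(** [f] is compared with a smooth function [G] of the second coordinate. On
    [`|u| <= L] they are close; outside, the difference is at most
    [2 * M * (u ^+ 2 / L ^+ 2)], whose integral is small by [sq_dist_limit_le]
    for the fluctuations, and by the variance for the Gaussian average. *)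
Lemma joint_mixing (H : set T) : measurable H ->
  \int[P]_w (\1_H w * (f (c n w, Num.sqrt n%:R * (q n w - Z w)) -
    gauss_avg (clamp (Z w * (1 - Z w))) (fun y => f (0, y)) 0)) @[n --> \oo] --> (0 : R).
Proof.
move=> mH; apply/cvgr0P => e e0.
have M0 : 0 <= M by exact: le_trans (fM (0, 0)).
have mf := continuous_measurable_fun2 cf.
pose f0 y := f (0, y).
have bf0 : bm f0.
  split; last by exists M => y; exact: fM.
  by apply: (measurableT_comp mf); exact: pair1_measurable.
have kv := dist_cst_ge0.
have e4 : 0 < e / 4 by rewrite divr_gt0.
(* [L] makes the two tail terms, [dist_cst] for the fluctuations and 1 for the
   Gaussian average, together at most [e / 4]. *)
pose A := 2 * M * (dist_cst + 1) + 1.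
have A0 : 0 < A by rewrite ltr_wpDl// !mulr_ge0// addr_ge0.
pose L := Num.sqrt (A / (e / 4)).
have L0 : 0 < L by rewrite sqrtr_gt0 divr_gt0.
have L2 : L ^+ 2 = A / (e / 4) by rewrite sqr_sqrtr// ltW// divr_gt0.
have [G [F1 [F2 [D [r [tG r0 GM fG]]]]]] := smooth_approx cf L0 e4 fM.
have [bG _ _ _ _] := tG.
have /cvgr0P/(_ _ e4)[N1 hN1] := marginal_mixing tG mZ Z01 qZ mH.
pose N2 := (Num.trunc ((`|B| / r) ^+ 2)).+1.
exists (maxn (maxn N1 N2) 1) => n; rewrite !geq_max => /andP[/andP[nN1 nN2] n0].
have nr : 0 < n%:R :> R by rewrite ltr0n.
have s0 : 0 < Num.sqrt n%:R :> R by rewrite sqrtr_gt0.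
set s := Num.sqrt n%:R in s0 *.
pose Dn w := s * (q n w - Z w).
have bD : bm Dn by apply: bmM => //; apply: bmB => //; exact: bm_q.
have cr w : `|c n w| <= r.
  apply: (le_trans (c_le w n0)); rewrite -/s ler_pdivrMr// mulrC -ler_pdivrMr//.
  apply: (@le_trans _ _ (`|B| / r)).
    by rewrite ler_wpM2r ?ler_norm// invr_ge0 ltW.
  rewrite -[leLHS]ger0_norm; last by rewrite divr_ge0// ltW.
  rewrite -sqrtr_sqr ler_sqrt// (@le_trans _ _ N2%:R)// ?ler_nat//.
  by apply: ltW; rewrite /N2 truncnS_gt.
have tail (y u : R) : `|f (y, u) - G u| <= 2 * M.
  rewrite (le_trans (ler_normB _ _))// (_ : 2 * M = M + M); last by ring.
  by apply: lerD.
have fGtail (y u : R) : `|y| <= r -> `|f (y, u) - G u| <= e / 4 + 2 * M * (u ^+ 2 / L ^+ 2).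
  move=> yr; have [uL|uL] := leP `|u| L.
    rewrite (le_trans (fG _ _ yr uL))// lerDl.
    by apply: mulr_ge0; [exact: mulr_ge0|rewrite divr_ge0 ?sqr_ge0].
  rewrite (le_trans (tail y u))// ler_wpDl ?(ltW e4)//.
  rewrite ler_peMr ?mulr_ge0// ler_pdivlMr ?exprn_gt0// mul1r.
  by rewrite -[leRHS]real_normK ?num_real// ler_pXn2r ?nnegrE ?(ltW L0)// ltW.
pose V w := clamp (Z w * (1 - Z w)).
have gG w : `|gauss_avg (V w) f0 0 - gauss_avg (V w) G 0| <= e / 4 + 2 * M * (1 / L ^+ 2).
  have /andP[v0 v1] := clamp01 (Z w * (1 - Z w)); rewrite -/(V w) in v0 v1.
  rewrite !gauss_avgE -EB; [|exact: integ_shift|exact: integ_shift].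
  have i2 : integ (gauss 0 (V w)) (fun y => 2 * M * (L ^+ 2)^-1 * y ^+ 2).
    by apply: integZ; exact: integ_gauss_pow.
  apply: (@le_trans _ _ (\int[gauss 0 (V w)]_y (e / 4 + 2 * M * (L ^+ 2)^-1 * y ^+ 2))).
    apply: Enorm_le.
    - by apply: integB; exact: integ_shift.
    - by apply: integD => //; exact: bm_integ.
    move=> y; rewrite add0r (le_trans (fGtail 0 y _)) ?normr0 ?(ltW r0)//.
    by apply: le_of_eq; ring.
  rewrite ED ?Ecst//; last exact: bm_integ.
  rewrite EZ; last exact: integ_gauss_pow.
  have [_ ->] := gauss_moments v0.
  rewrite lerD2l mul1r ler_piMr// mulr_ge0 ?mulr_ge0//.
  by rewrite invr_ge0 exprn_ge0// ltW.
have bfc : bm (fun w => f (c n w, Dn w)).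
  split; last by exists M => w; exact: fM.
  apply: (measurableT_comp mf); apply: measurable_fun_pair => //.
  by case: bD.
have bGD : bm (fun w => G (Dn w)) by apply: (bm_comp _ bG); case: bD.
have mV : measurable_fun setT V.
  by apply: (measurableT_comp measurable_clamp); case: (bmM bmZ (bmB (bm_cst T 1) bmZ)).
have bgG : bm (fun w => gauss_avg (V w) G 0) by exact: bm_gauss_avg_var.
have bgf : bm (fun w => gauss_avg (V w) f0 0) by exact: bm_gauss_avg_var.
have bH := bm_indic R mH.
have H1 w : 0 <= (\1_H w : R) <= 1 by rewrite indicE; case: (w \in H); rewrite ?lexx ?ler01.
pose u1 w := \1_H w * (G (Dn w) - gauss_avg (V w) G 0).
pose u2 w := \1_H w * (f (c n w, Dn w) - G (Dn w)).
pose u3 w := \1_H w * (gauss_avg (V w) f0 0 - gauss_avg (V w) G 0).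
have bu1 : bm u1 by apply: bmM => //; exact: bmB.
have bu2 : bm u2 by apply: bmM => //; exact: bmB.
have bu3 : bm u3 by apply: bmM => //; exact: bmB.
have -> : \int[P]_w (\1_H w * (f (c n w, Dn w) - gauss_avg (V w) f0 0)) =
   \int[P]_w u1 w + \int[P]_w u2 w - \int[P]_w u3 w.
  rewrite -ED; [|exact: bm_integ|exact: bm_integ].
  rewrite -EB; [|apply: bm_integ; exact: bmD|exact: bm_integ].
  by apply: eq_Rintegral => w _; rewrite /u1 /u2 /u3; ring.
have h1 : `|\int[P]_w u1 w| <= e / 4 by exact: hN1.
have hH (x y : R) w : `|x| <= y -> `|\1_H w * x| <= y.
  move=> xy; have /andP[h0 h1'] := H1 w.
  by rewrite normrM ger0_norm// (le_trans _ xy)// ler_piMl.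
have h3 : `|\int[P]_w u3 w| <= e / 4 + 2 * M * (1 / L ^+ 2).
  by apply: Enorm_cst => [|w]; [exact: bm_integ|apply: hH; exact: gG].
have h2 : `|\int[P]_w u2 w| <= e / 4 + 2 * M * (dist_cst / L ^+ 2).
  have bD2 := bmX 2 bD.
  apply: (@le_trans _ _ (\int[P]_w (e / 4 + 2 * M / L ^+ 2 * (Dn w ^+ 2)))).
    apply: Enorm_le; [exact: bm_integ|by apply: bm_integ; apply: bmD => //; exact: bmM|].
    move=> w; apply: hH; rewrite (le_trans (fGtail _ _ (cr w)))//.
    by apply: le_of_eq; ring.
  rewrite ED ?Ecst; [|exact: bm_integ|by apply: bm_integ; exact: bmM].
  rewrite EZ; last exact: bm_integ.
  rewrite lerD2l (_ : 2 * M * (dist_cst / L ^+ 2) = 2 * M / L ^+ 2 * dist_cst); last by ring.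
  rewrite ler_wpM2l ?divr_ge0 ?mulr_ge0 ?exprn_ge0 ?(ltW L0)//.
  apply: le_trans (sq_dist_limit_le n0).
  rewrite -EZ; last by apply/bm_integ/bmX/bmB => //; exact: bm_q.
  apply: le_of_eq; apply: eq_Rintegral => w _.
  by rewrite /Dn exprMn /s sqr_sqrtr.
have hA : 2 * M * (dist_cst / L ^+ 2) + 2 * M * (1 / L ^+ 2) <= e / 4.
  rewrite (_ : _ + _ = 2 * M * (dist_cst + 1) / L ^+ 2); last by ring.
  by rewrite ler_pdivrMr ?exprn_gt0// L2 [leRHS]mulrC divfK ?gt_eqF// /A lerDl.
rewrite (le_trans (ler_normB _ _))// (le_trans (lerD (ler_normD _ _) (lexx _)))//.
lra.
Qed.

End joint_limit.
End almost_martingale.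

(** * Almost sure convergence *)
Section almost_sure_convergence.
Context d (T : measurableType d) (R : realType) (P : probability T R).
Variables (q : nat -> T -> R) (C K : R).
Hypothesis bq : forall n, bm (q n).
Hypothesis C0 : 0 <= C.
Hypothesis K0 : 0 <= K.
Hypothesis q_step : forall n w, (0 < n)%N -> `|q n.+1 w - q n w| <= C / n%:R.
Hypothesis q_dist : forall n k, (0 < n <= k)%N ->
  \int[P]_w `|q k w - q n w| <= K / Num.sqrt n%:R.

Lemma dist_le n k w : (0 < n <= k)%N ->
  `|q k w - q n w| <= C * (k%:R - n%:R) / n%:R.
Proof.
move=> /andP[n0]; elim: k => [|k ih].
  by rewrite leqn0 => /eqP nE; rewrite nE in n0.
rewrite leq_eqVlt => /predU1P[<-|nk]; first by rewrite !subrr normr0 mulr0 mul0r.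
have nr : 0 < n%:R :> R by rewrite ltr0n.
rewrite (_ : q k.+1 w - q n w = (q k.+1 w - q k w) + (q k w - q n w)); last by ring.
rewrite (le_trans (ler_normD _ _))//.
rewrite (_ : C * _ / _ = C / n%:R + C * (k%:R - n%:R) / n%:R); last first.
  by rewrite -natr1; field; rewrite gt_eqF.
apply: lerD; last exact: ih.
rewrite (le_trans (q_step _ (leq_trans n0 nk)))// ler_wpM2l// lef_pV2 ?posrE//.
  by rewrite ler_nat.
by rewrite ltr0n (leq_trans n0).
Qed.

(** Fourth powers are sparse enough for [1 / sqrt (N j)] to be summable, and
    dense enough for [(N j.+1 - N j) / N j] to tend to 0. *)
Let N (j : nat) : nat := (j.+1 ^ 4)%N.

Let N_gt0 j : (0 < N j)%N. Proof. by rewrite expn_gt0. Qed.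

Let NE j : (N j)%:R = (j.+1%:R : R) ^+ 4. Proof. by rewrite natrX. Qed.

Let N_le j : (N j <= N j.+1)%N. Proof. by rewrite leq_exp2r. Qed.

Let N_ge j n : (N j <= n)%N -> exists2 i, (j <= i)%N & (N i <= n < N i.+1)%N.
Proof.
move=> jn.
have ex : exists i, (N i <= n)%N by exists j.
have bd i : (N i <= n)%N -> (i <= n)%N.
  move=> h; apply: leq_trans h; rewrite /N; apply: (@leq_trans (i.+1 ^ 1)).
    by rewrite expn1.
  exact: leq_pexp2l.
exists (ex_maxn ex bd); case: ex_maxnP => i h1 h2; first exact: h2.
by rewrite h1 ltnNge; apply/negP => /h2; rewrite ltnn.
Qed.

Let gap_small i n w : (N i <= n < N i.+1)%N ->
  `|q n w - q (N i) w| <= 15 * C / i.+1%:R.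
Proof.
move=> /andP[h1 h2]; apply: (le_trans (dist_le w _)); first by rewrite N_gt0.
have i0 : 0 < i.+1%:R :> R by rewrite ltr0n.
have n4 : n%:R <= (i.+1%:R + 1) ^+ 4 :> R.
  by have := ltnW h2; rewrite -(ler_nat R) NE -[i.+2%:R]natr1.
rewrite NE ler_pdivrMr ?exprn_gt0//.
rewrite (_ : 15 * C / i.+1%:R * i.+1%:R ^+ 4 = C * (15 * i.+1%:R ^+ 3)); last first.
  by field; rewrite gt_eqF.
rewrite ler_wpM2l//; set x : R := i.+1%:R in i0 n4 *.
have x1 : 1 <= x by rewrite /x ler1n.
have h : (x + 1) ^+ 4 - x ^+ 4 <= 15 * x ^+ 3.
  rewrite (_ : _ - _ = 4 * x ^+ 3 + 6 * x ^+ 2 + 4 * x + 1); last by ring.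
  have x2 : x <= x ^+ 2 by rewrite expr2 ler_peMl// ltW.
  have x3 : x ^+ 2 <= x ^+ 3 by rewrite [x ^+ 3]exprS ler_peMl// exprn_ge0// ltW.
  lra.
by apply: le_trans h; rewrite lerB.
Qed.

(** The variation along the subsequence [N] is integrable, hence finite almost
    everywhere; [gap_small] extends the convergence to all indices. *)
Lemma ae_cvg : {ae P, forall w, cvgn (q ^~ w)}.
Proof.
pose D j w := `|q (N j.+1) w - q (N j) w|.
have bD j : bm (D j) by apply/bm_norm/bmB.
have mD j : measurable_fun setT (fun w => (D j w)%:E).
  by apply/measurable_EFinP; case: (bD j).
have intDj j : \int[P]_w D j w <= K / j.+1%:R ^+ 2.
  have := @q_dist (N j) (N j.+1); rewrite N_gt0 N_le => /(_ isT).
  rewrite NE (_ : j.+1%:R ^+ 4 = (j.+1%:R ^+ 2) ^+ 2 :> R); last by rewrite -exprM.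
  by rewrite sqrtr_sqr ger0_norm ?exprn_ge0.
have sumD k : \sum_(0 <= j < k) \int[P]_w D j w <= 2 * K.
  suff : \sum_(0 <= j < k) \int[P]_w D j w <= 2 * K * (1 - k.+1%:R^-1).
    move=> /le_trans; apply; apply: ler_piMr; first exact: mulr_ge0.
    by rewrite lerBlDr lerDl invr_ge0.
  elim: k => [|k ih]; first by rewrite big_geq// invr1 subrr mulr0.
  rewrite big_nat_recr//=; apply: (le_trans (lerD ih (intDj k))).
  rewrite -[k.+2%:R]natr1; set x : R := k.+1%:R.
  have x1 : 1 <= x by rewrite /x ler1n.
  have x0 : 0 < x by lra.
  have x10 : 0 < x + 1 by lra.
  rewrite -subr_ge0 (_ : _ - _ = K * (x - 1) / (x ^+ 2 * (x + 1))); last first.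
    by field; rewrite !gt_eqF.
  by rewrite divr_ge0 ?mulr_ge0 ?exprn_ge0 ?subr_ge0 ?(ltW x0) ?(ltW x10).
have fin : (\int[P]_w (\sum_(0 <= j <oo) (D j w)%:E) < +oo)%E.
  rewrite integral_nneseries//; last by move=> j w _; rewrite lee_fin normr_ge0.
  apply: (@le_lt_trans _ _ (2 * K)%:E); last by rewrite ltry.
  apply: lime_le.
    by apply: is_cvg_nneseries => n _ _; apply: integral_ge0 => w _; rewrite lee_fin normr_ge0.
  apply: nearW => k.
  under eq_bigr do rewrite (EFin_Rintegral (bm_integ P (bD _))).
  by rewrite sumEFin lee_fin.
have intD : P.-integrable setT (fun w => \sum_(0 <= j <oo) (D j w)%:E)%E.
  apply/integrableP; split.
    apply: ge0_emeasurable_sum => [j w _ _|j _]; last exact: mD.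
    by rewrite lee_fin; exact: normr_ge0.
  rewrite (eq_integral (fun w => \sum_(0 <= j <oo) (D j w)%:E)%E) => [|w _]; first exact: fin.
  by rewrite gee0_abs//; apply: nneseries_ge0 => j _ _; rewrite lee_fin; exact: normr_ge0.
have := integrable_ae measurableT intD.
apply: filterS => w /(_ Logic.I) finw.
pose u j := q (N j.+1) w - q (N j) w.
have cu : cvgn (series u).
  apply: normed_cvg.
  apply: nondecreasing_is_cvgn.
    by apply: nondecreasing_series => j _ _; exact: normr_ge0.
  exists (fine (\sum_(0 <= j <oo) (D j w)%:E)%E) => _ [k _ <-].
  rewrite -lee_fin fineK// /series/= -sumEFin.
  by apply: nneseries_lim_ge => j _ _; rewrite lee_fin normr_ge0.
have cN : cvgn (fun j => q (N j) w).
  have -> : (fun j => q (N j) w) = (fun j => q (N 0) w + series u j).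
    apply/funext => j; rewrite /series/= /u telescope_sumr//.
    by rewrite addrC subrK.
  by apply: is_cvgD => //; exact: is_cvg_cst.
apply/cvg_ex; exists (limn (fun j => q (N j) w)).
apply/cvgrPdist_le => e e0.
have e20 : 0 < e / 2 by rewrite divr_gt0.
have /cvgrPdist_le/(_ _ e20)[J1 _ hJ1] :
  (fun j => q (N j) w) @ \oo --> limn (fun j => q (N j) w) by exact: cN.
pose J2 := Num.trunc (15 * C / (e / 2)).
exists (N (maxn J1 J2)) => // n /= nN.
have [i ji iN] := N_ge nN.
have h1 := gap_small w iN.
have h2 : `|limn (fun j => q (N j) w) - q (N i) w| <= e / 2.
  by apply: hJ1 => /=; rewrite (leq_trans _ ji)// leq_maxl.
have h3 : 15 * C / i.+1%:R <= e / 2.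
  rewrite ler_pdivrMr ?ltr0n// [leRHS]mulrC -ler_pdivrMr//.
  apply: (@le_trans _ _ J2.+1%:R); first by apply: ltW; rewrite /J2 truncnS_gt.
  by rewrite ler_nat ltnS (leq_trans _ ji)// leq_maxr.
rewrite -(subrK (q (N i) w) (limn _)) -addrA (le_trans (ler_normD _ _))//.
by rewrite [`|q (N i) w - _|]distrC [e]splitr lerD// (le_trans h1).
Qed.

End almost_sure_convergence.

(** * Conditional laws as integrals *)
Section second_projection.
Context d d' (T : measurableType d) (S : measurableType d') (R : realType).
Variable N : R.-pker T ~> S.

(** [N] as a kernel on [unit * T], the shape expected by the composition of
    kernels. *)
Definition kernel_snd (p : unit * T) : {measure set S -> \bar R} := N p.2.

Let measurable_kernel_snd U : measurable U -> measurable_fun setT (kernel_snd ^~ U).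
Proof.
by move=> mU; exact: (measurableT_comp (measurable_kernel N U mU) measurable_snd).
Qed.

HB.instance Definition _ :=
  isKernel.Build _ _ (unit * T)%type S R kernel_snd measurable_kernel_snd.

Let prob_kernel_snd p : kernel_snd p setT = 1%E.
Proof. exact: prob_kernel. Qed.

HB.instance Definition _ :=
  Kernel_isProbability.Build _ _ (unit * T)%type S R kernel_snd prob_kernel_snd.

End second_projection.

Section mixture_integral.
Context d d' (T : measurableType d) (S : measurableType d') (R : realType).
Variables (P : probability T R) (N : R.-pker T ~> S).

Let mP : measurable_fun [set: unit] (fun=> P : pprobability T R).
Proof. exact: measurable_cst. Qed.

(** A mixture is the composition of [P], seen as a kernel from a point, with
    [N]. *)
Definition mixture : {measure set S -> \bar R} :=
  kcomp (kprobability mP) (kernel_snd N) tt.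

Lemma mixtureE B : mixture B = (\int[P]_w N w B)%E.
Proof. by []. Qed.

Lemma ge0_integral_mixture (f : S -> \bar R) : (forall z, (0 <= f z)%E) ->
  measurable_fun [set: S] f ->
  (\int[mixture]_z f z = \int[P]_w \int[N w]_z f z)%E.
Proof. by move=> f0 mf; exact: integral_kcomp. Qed.

Lemma mixture_setT : mixture setT = 1%E.
Proof.
rewrite mixtureE; under eq_integral do rewrite prob_kernel.
by rewrite integral_cst// mul1e; exact: probability_setT.
Qed.

End mixture_integral.

Section bounded_integral_shift.
Context d (T : measurableType d) (R : realType).
Variable m : {measure set T -> \bar R}.
Hypothesis m1 : m setT = 1%E.

(** Reduces bounded integrands to nonnegative ones. *)
Lemma integral_shift_bm (f : T -> R) (M : R) : bm f ->
  (\int[m]_x (f x)%:E = \int[m]_x (f x + M)%:E - M%:E)%E.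
Proof.
move=> [mf [K fK]].
have mfin : (m setT < +oo)%E by rewrite m1 ltry.
have ifn : m.-integrable setT (EFin \o f).
  apply: measurable_bounded_integrable => //.
  by exists K; split; [exact: num_real|move=> x Kx t _; exact: (le_trans (fK t) (ltW Kx))].
have iM : m.-integrable setT (EFin \o cst M).
  apply: measurable_bounded_integrable => //.
  by exists `|M|; split; [exact: num_real|move=> x Kx t _; exact: ltW].
rewrite integralD_EFin//= integral_cst//= m1 mule1 addeK//.
Qed.

End bounded_integral_shift.

Section conditioning.
Context d (T : measurableType d) (R : realType) (P : probability T R).
Variables (H : set T) (mH : measurable H) (H0 : (0 < P H)%E).

Definition condP : probability T R := mnormalize (mrestr P mH) P.

Let c : R := (fine (P H))^-1.

Lemma condPE A : condP A = (P (A `&` H) * c%:E)%E.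
Proof.
have PH : mrestr P mH setT = P H by rewrite /mrestr setTI.
have e0 : (P H == 0)%E = false by rewrite gt_eqF.
have e1 : (P H == +oo)%E = false by rewrite lt_eqF// (le_lt_trans (probability_le1 P mH))// ltry.
rewrite /condP/= /mnormalize/=. rewrite [mrestr _ _ setT]PH e0 e1.
by [].
Qed.

Let PHfin : P H \is a fin_num.
Proof. exact: fin_num_measure. Qed.

Let fPH : 0 < fine (P H).
Proof. by rewrite fine_gt0// H0 -ge0_fin_numE. Qed.

Let c0 : 0 <= c. Proof. by rewrite invr_ge0 ltW. Qed.

Lemma ge0_integral_condP (f : T -> \bar R) : measurable_fun setT f ->
  (forall x, (0 <= f x)%E) ->
  (\int[condP]_x f x = c%:E * \int[P]_(x in H) f x)%E.
Proof.
move=> mf f0.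
transitivity (\int[mscale (NngNum c0) (mrestr P mH)]_x f x)%E.
  apply: eq_measure_integral => A mA _; apply: (etrans (condPE A)).
  by rewrite /= /mscale/= muleC.
rewrite ge0_integral_mscale//=; congr (_ * _)%E.
rewrite -(setUv H) ge0_integral_setU//=; [|exact: measurableC|by rewrite setUv|].
  2: by apply/disj_setPCl.
rewrite [X in (_ + X)%E](_ : _ = 0%E) ?adde0.
  apply: eq_measure_integral => A mA AH.
  by rewrite /= /mrestr; congr (P _); apply/setIidl.
apply: null_set_integral => //.
- exact: measurableC.
- exact: measurable_funTS.
- by rewrite /= /mrestr setICl measure0.
Qed.

Lemma E_condP (f : T -> R) : bm f ->
  \int[condP]_w f w = c * \int[P]_w (\1_H w * f w).
Proof.
move=> bf; have [M M0 fM] := bmP bf.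
have bfM : bm (fun w => f w + M) by exact: bmD.
have bH := bm_indic R mH.
have f0 x : (0 <= (f x + M)%:E)%E.
  by have := fM x; rewrite ler_norml lee_fin => /andP[? _]; lra.
have mf : measurable_fun setT (fun x => (f x + M)%:E).
  by apply/measurable_EFinP; case: bfM.
have h := ge0_integral_condP mf f0.
have h1 : \int[condP]_w (f w + M) = c * \int[P]_w (\1_H w * (f w + M)).
  apply: EFin_inj; rewrite -EFin_Rintegral; last exact: bm_integ.
  rewrite h EFinM; congr (_ * _)%E; rewrite -EFin_Rintegral; last exact/bm_integ/bmM.
  rewrite [LHS]integral_mkcond; apply: eq_integral => w _.
  by rewrite patchE indicE; case: (w \in H); rewrite ?mul1r ?mul0r.
have -> : \int[condP]_w f w = \int[condP]_w (f w + M) - M.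
  by rewrite ED ?Ecst ?addrK//; exact: bm_integ.
rewrite h1 (_ : \int[P]_w (\1_H w * (f w + M)) = \int[P]_w (\1_H w * f w) +
   \int[P]_w (M * \1_H w)); last first.
  rewrite -ED; [|exact/bm_integ/bmM|exact/bm_integ/bmM].
  by apply: eq_Rintegral => w _; ring.
rewrite EZ; last exact: bm_integ.
have -> : \int[P]_w (\1_H w : R) = fine (P H).
  by rewrite /Rintegral integral_indic// setIT.
by rewrite /c; field; rewrite gt_eqF.
Qed.

Lemma integral_cond_law (X : T -> R * R) (f : R * R -> R) :
  measurable_fun setT X -> bm f ->
  (\int[cond_law P H X]_x (f x)%:E = (c * \int[P]_w (\1_H w * f (X w)))%:E)%E.
Proof.
move=> mX bf.
have bfX : bm (f \o X) by exact: bm_comp.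
rewrite -(E_condP bfX) -EFin_Rintegral; last exact: bm_integ.
transitivity (\int[pushforward condP X]_x (f x)%:E)%E.
  congr integral; apply/funext => B.
  by rewrite /cond_law setIC; exact: (esym (condPE _)).
rewrite [LHS](@integral_pushforward _ _ _ _ _ X mX condP setT (EFin \o f)) ?preimage_setT//.
- by apply/measurable_EFinP; case: bf.
- exact: (bm_integ condP bfX).
Qed.

Lemma cond_mixtureE (N : R.-pker T ~> (R * R)%type) B : measurable B ->
  cond_mixture P H N B = mixture condP N B.
Proof.
move=> mB; rewrite mixtureE /cond_mixture muleC; apply: esym.
exact: (ge0_integral_condP (measurable_kernel N B mB) (fun w => measure_ge0 (N w) B)).
Qed.

(** [cond_mixture] is a bare set function which agrees with a measure on
    measurable sets only, hence is one itself. *)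
Lemma integral_cond_mixture_mixture (N : R.-pker T ~> (R * R)%type) (f : R * R -> \bar R) :
  (\int[cond_mixture P H N]_x f x = \int[mixture condP N]_x f x)%E.
Proof.
pose cm := cond_mixture P H N.
have cm0 : cm set0 = 0%E by rewrite /cm cond_mixtureE ?measure0.
have cm_ge0 B : (0 <= cm B)%E.
  by rewrite /cm /cond_mixture mule_ge0// ?lee_fin//; exact: integral_ge0.
have cmS : semi_sigma_additive cm.
  move=> F mF tF mUF; rewrite [X in _ --> X]cond_mixtureE//.
  under eq_fun do under eq_bigr do rewrite /cm cond_mixtureE//.
  exact: measure_semi_sigma_additive.
pose cmM : {measure set (R * R) -> \bar R} :=
  HB.pack cm (isMeasure.Build _ _ _ cm cm0 cm_ge0 cmS).
transitivity (\int[cmM]_x f x)%E => //.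
by apply: eq_measure_integral => B mB _; exact: cond_mixtureE.
Qed.

Lemma integral_prod_kernel (L : {mfun T >-> R}) (f : R * R -> \bar R) w :
  measurable_fun setT f -> (forall x, (0 <= f x)%E) ->
  (\int[prod_kernel (kdirac (measurable_cst (0%R : R))) (gauss_kernel L) w]_z f z =
   \int[gauss 0%R (L w)]_y f (0%R, y))%E.
Proof.
move=> mf f0.
pose K0 : R.-pker T ~> R := kdirac (measurable_cst (0 : R) : measurable_fun [set: T] _).
pose m1 : probability R R := kernel_prob K0 w.
pose m2 : probability R R := kernel_prob (gauss_kernel L) w.
transitivity (\int[(m1 \x m2)%E]_z f z)%E => //.
rewrite (@fubini_tonelli1 _ _ _ _ _ m1 m2 f mf f0).
have mF : measurable_fun setT (fubini_F m2 f) by exact: measurable_fun_fubini_tonelli_F.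
transitivity (\int[\d_(0%R : R)]_x fubini_F m2 f x)%E => //.
by rewrite integral_dirac// diracT mul1e.
Qed.

Lemma integral_cond_mixture (L : {mfun T >-> R}) (f : R * R -> R) : bm f ->
  (\int[cond_mixture P H
     (prod_kernel (kdirac (measurable_cst (0%R : R))) (gauss_kernel L))]_x (f x)%:E =
   (c * \int[P]_w (\1_H w * gauss_avg (L w) (fun y => f (0%R, y)) 0%R)%R)%:E)%E.
Proof.
move=> bf; have [mf _] := bf; have [M M0 fM] := bmP bf.
set N := prod_kernel _ _.
have bf0 : bm (fun y => f (0, y)) by exact: (bm_comp (pair1_measurable (0 : R)) bf).
have bg : bm (fun w => gauss_avg (L w) (fun y => f (0, y)) 0) by exact: bm_gauss_avg_var.
rewrite -(E_condP bg) -EFin_Rintegral; last exact: bm_integ.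
apply: (etrans (integral_cond_mixture_mixture N _)).
rewrite (integral_shift_bm (mixture_setT condP N) M bf).
have f0 x : (0 <= (f x + M)%:E)%E.
  by have := fM x; rewrite ler_norml lee_fin => /andP[? _]; lra.
have mfM : measurable_fun setT (fun x => (f x + M)%:E).
  by apply/measurable_EFinP; apply: measurable_funD.
rewrite ge0_integral_mixture//.
have NE w : (\int[N w]_z (f z + M)%:E = (gauss_avg (L w) (fun y => f (0, y)) 0 + M)%:E)%E.
  apply: (etrans (integral_prod_kernel L w mfM f0)).
  have bs : bm (fun y => f (0, y) + M) by exact: bmD.
  rewrite (EFin_Rintegral (bm_integ (gauss 0 (L w)) bs)) gauss_avgE; apply: (congr1 EFin).
  rewrite ED ?Ecst; [|exact: bm_integ|exact: bm_integ].
  by congr (_ + _); apply: eq_Rintegral => y _; rewrite add0r.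
rewrite (eq_integral _ _ (fun w _ => NE w)).
have bgM : bm (fun w => gauss_avg (L w) (fun y => f (0, y)) 0 + M) by exact: bmD.
rewrite (EFin_Rintegral (bm_integ condP bgM)) (EFin_Rintegral (bm_integ condP bg)).
by rewrite ED ?Ecst; [rewrite EFinD addeK|exact: bm_integ|exact: bm_integ].
Qed.

End conditioning.

(** * Stable convergence of the predictions *)
Section predictions.
Context d (T : measurableType d) (R : realType) (P : probability T R).
Context (S : finType) (Y : nat -> T -> S) (alpha theta : R) (A : {set S}).
Hypothesis alpha_bounds : 0 <= alpha < 1.
Hypothesis theta_bound : - alpha < theta.
Hypothesis mY : forall (n : nat) (B : {set S}), (0 < n)%N ->
  measurable (Y n @^-1` [set` B]).
Hypothesis predY : forall (B : {set S}) (n : nat), (0 < n)%N ->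
  exists2 V : T -> R,
    is_cond_exp P (past Y n) (hit R Y B n.+1) V &
    {ae P, forall w, V w = predictive P Y alpha theta B n w}.
Variable Z : nat -> T -> R.
Hypothesis Z_def : forall n : nat, is_cond_exp P (past Y n) (hit R Y A n.+1) (Z n).

Local Notation pred := (predictive P Y alpha theta).

(** For [0 < n], an adapted version of [Z n]. The clamp keeps the values in the
    unit interval also for [n = 0], where [predictive] is meaningless. *)
Definition cpred n w : R := clamp (pred A n w).

Lemma cpredE n w : (0 < n)%N -> cpred n w = pred A n w.
Proof. by move=> n0; rewrite /cpred clampE// (pred01 P alpha_bounds theta_bound mY). Qed.

Lemma cpred01 n w : 0 <= cpred n w <= 1.
Proof. exact: clamp01. Qed.

Lemma adapted_cpred n : adapted Y n (cpred n).
Proof. by move=> w w' ww; rewrite /cpred (adapted_pred P alpha theta A ww). Qed.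

Lemma bm_cpred n : bm (cpred n).
Proof. by apply: (adapted_bm mY); exact: adapted_cpred. Qed.

Lemma adapted_Z n : adapted Y n (Z n).
Proof. exact: cond_exp_adapted (Z_def n). Qed.

Lemma bm_Z n : bm (Z n).
Proof. by apply: (adapted_bm mY); exact: adapted_Z. Qed.

Lemma cond_exp_cpred n : (0 < n)%N -> {ae P, forall w, Z n w = cpred n w}.
Proof.
move=> n0; pose g w := Z n w - pred A n w.
have ag : adapted Y n g.
  by move=> w w' ww; rewrite /g (adapted_Z ww) (adapted_pred P alpha theta A ww).
have bg : bm g by exact: (adapted_bm mY ag).
have bp := bm_pred P alpha theta mY A n.
have bh := bm_hit R mY A n.
have g2 : \int[P]_w (g w ^+ 2) = 0.
  transitivity (\int[P]_w (g w * Z n w - g w * pred A n w)).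
    by apply: eq_Rintegral => w _; rewrite /g; ring.
  rewrite EB; [|exact/bm_integ/bmM/bm_Z|exact/bm_integ/bmM].
  rewrite (cond_exp_test mY bh (Z_def n) ag).
  by rewrite (E_hit mY predY A n0 ag) subrr.
have := E_sq0 bg g2; apply: filterS => w; rewrite /g cpredE// => /eqP.
by rewrite subr_eq0 => /eqP.
Qed.

(** The difference [W - Z n] is itself adapted, and is used as test
    function. *)
Lemma drift_sq_le : exists2 C : R, 0 < C &
  forall (W : T -> R) n, (0 < n)%N -> is_cond_exp P (past Y n) (Z n.+1) W ->
  \int[P]_w ((W w - Z n w) ^+ 2) <= C / n%:R ^+ 4.
Proof.
have [C C0 urn] := urn_increments A alpha_bounds theta_bound mY predY.
exists (C ^+ 2) => [|W n n0 condW]; first exact: exprn_gt0.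
have [_ drift _] := urn n n0.
have aW := cond_exp_adapted condW.
pose g w := W w - Z n w.
have ag : adapted Y n g by move=> w w' ww; rewrite /g (adapted_Z ww) (aW _ _ ww).
have bg : bm g by exact: (adapted_bm mY ag).
have bW : bm W by exact: (adapted_bm mY aW).
have bp k := bm_pred P alpha theta mY A k.
have nr : 0 < n%:R :> R by rewrite ltr0n.
have gE : \int[P]_w (g w ^+ 2) = \int[P]_w (g w * (pred A n.+1 w - pred A n w)).
  transitivity (\int[P]_w (g w * W w - g w * Z n w)).
    by apply: eq_Rintegral => w _; rewrite /g; ring.
  rewrite EB; [|exact/bm_integ/bmM|exact/bm_integ/bmM/bm_Z].
  rewrite (cond_exp_test mY (bm_Z n.+1) condW ag).
  rewrite -EB; [|exact/bm_integ/bmM/bm_Z|exact/bm_integ/bmM/bm_Z].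
  apply: E_ae.
  - by case: (bmB (bmM bg (bm_Z n.+1)) (bmM bg (bm_Z n))).
  - by case: (bmM bg (bmB (bp n.+1) (bp n))).
  - near=> w; rewrite (_ : Z n.+1 w = pred A n.+1 w); last first.
      by rewrite -cpredE//; near: w; exact: cond_exp_cpred.
    rewrite (_ : Z n w = pred A n w); last by rewrite -cpredE//; near: w; exact: cond_exp_cpred.
    by ring.
set a := C / n%:R ^+ 2 in drift.
have a0 : 0 <= a by rewrite /a divr_ge0 ?exprn_ge0 ?ltW.
have h1 : \int[P]_w (g w ^+ 2) <= a * \int[P]_w `|g w|.
  by rewrite gE (le_trans (ler_norm _))// drift.
(* [a * |g| <= (a^2 + g^2) / 2] absorbs half of the left-hand side. *)
have h2 : a * \int[P]_w `|g w| <= 2^-1 * a ^+ 2 + 2^-1 * \int[P]_w (g w ^+ 2).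
  have bg2 : bm (fun w => g w ^+ 2) by exact: bmX.
  rewrite -EZ; last exact/bm_integ/bm_norm.
  rewrite -[X in _ <= X + _](Ecst P) -EZ; last exact: bm_integ.
  have bcg : bm (fun w => 2^-1 * g w ^+ 2) by apply: bmM => //; exact: bm_cst.
  have bca : bm (fun _ : T => 2^-1 * a ^+ 2) by exact: bm_cst.
  rewrite -ED; [|exact: bm_integ|exact: bm_integ].
  apply: Ele => [||w].
  - by apply: bm_integ; apply: bmM; [exact: bm_cst|exact: bm_norm].
  - exact/bm_integ/bmD.
  - have := sqr_ge0 (a - `|g w|); rewrite -[g w ^+ 2]real_normK ?num_real//.
    by move: (`|g w|) => y; nra.
have -> : C ^+ 2 / n%:R ^+ 4 = a ^+ 2 by rewrite /a; field; rewrite gt_eqF.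
rewrite -/g; move: (\int[P]_w (g w ^+ 2)) h1 h2 => x; lra.
Unshelve. all: by end_near. Qed.

Lemma drift_littleo (W : nat -> T -> R) :
  (forall n : nat, is_cond_exp P (past Y n) (Z n.+1) (W n)) ->
  (forall n : nat, 'E_P[fun w => ((W n w - Z n w) ^+ 2)%R]%E \is a fin_num) /\
  (fun n : nat => fine 'E_P[fun w => ((W n w - Z n w) ^+ 2)%R]%E)
    =o_\oo (fun n : nat => (n%:R ^- 3 : R)).
Proof.
move=> condW.
have bg n : bm (fun w => (W n w - Z n w) ^+ 2).
  by apply/bmX/bmB/bm_Z; apply: (adapted_bm mY); exact: cond_exp_adapted (condW n).
have EE n : 'E_P[fun w => ((W n w - Z n w) ^+ 2)%R]%E =
    (\int[P]_w ((W n w - Z n w) ^+ 2))%:E.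
  by rewrite unlock (EFin_Rintegral (bm_integ P (bg n))).
split=> [n|]; first by rewrite EE.
have [C C0 WC] := drift_sq_le.
apply/eqoP => e e0; near=> n.
have n0 : (0 < n)%N by near: n; exact: nbhs_infty_gt.
have nr : 0 < n%:R :> R by rewrite ltr0n.
rewrite EE/= ger0_norm; last by apply: E_ge0 => w; exact: sqr_ge0.
rewrite ger0_norm ?invr_ge0 ?exprn_ge0//.
apply: (le_trans (WC _ _ n0 (condW n))).
have -> : C / n%:R ^+ 4 = (C / n%:R) / n%:R ^+ 3 by field; rewrite gt_eqF.
apply: ler_wpM2r; first by rewrite invr_ge0 exprn_ge0// ltW.
rewrite ler_pdivrMr// mulrC -ler_pdivrMr//.
by near: n; exact: nbhs_infty_ger.
Unshelve. all: by end_near. Qed.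

Lemma cpred_increments : exists2 C : R, 0 < C & [/\
  (forall n w, (0 < n)%N -> `|cpred n.+1 w - cpred n w| <= C / n%:R),
  (forall n (g : T -> R), (0 < n)%N -> adapted Y n g ->
    `|\int[P]_w (g w * (cpred n.+1 w - cpred n w))| <= C / n%:R ^+ 2 * \int[P]_w `|g w|) &
  (forall n (g : T -> R), (0 < n)%N -> adapted Y n g ->
    `|\int[P]_w (g w * (cpred n.+1 w - cpred n w) ^+ 2) -
      (n%:R * n.+1%:R)^-1 * \int[P]_w (g w * (cpred n w * (1 - cpred n w)))| <=
    C / n%:R ^+ 3 * \int[P]_w `|g w|)].
Proof.
have [C C0 urn] := urn_increments A alpha_bounds theta_bound mY predY.
exists C => //.
have qfun n : (0 < n)%N -> cpred n = pred A n by move=> n0; apply/funext => w; exact: cpredE.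
split=> [n w n0|n g n0|n g n0]; have [h1 h2 h3] := urn n n0;
  rewrite (qfun n n0) (qfun n.+1 isT).
- exact: h1.
- exact: h2.
- exact: h3.
Qed.

Lemma cpred_ae_cvg : {ae P, forall w, cvgn (cpred ^~ w)}.
Proof.
have [C C0 [q_step q_drift q_quad]] := cpred_increments.
have K0 := dist_cst_ge0 C0.
apply: (@ae_cvg _ _ _ _ _ C ((dist_cst C + 1) / 2)) => //.
- exact: bm_cpred.
- exact: ltW.
- by rewrite divr_ge0// addr_ge0.
- move=> n k nk; have := norm_dist_le mY adapted_cpred cpred01 C0 q_step q_drift nk.
  by rewrite invfM mulrA.
Qed.

Lemma cond_exp_cpred_all : {ae P, forall w, forall n, (0 < n)%N -> Z n w = cpred n w}.
Proof.
apply: ae_foralln => n; have [n0|n0] := ltnP 0 n.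
  by have := cond_exp_cpred n0; apply: filterS.
by apply: aeW.
Qed.

(** The upper limit is a measurable function defined everywhere. *)
Lemma predictions_ae_cvg : exists Zlim : {mfun T >-> R},
  {ae P, forall w, Z n w @[n --> \oo] --> Zlim w}.
Proof.
pose L w : R := fine (limn_esup (fun n => (cpred n w)%:E)).
have mL : measurable_fun setT L.
  apply: (@measurableT_comp _ _ _ _ _ _ fine) => //.
  apply: measurable_fun_limn_esup => n.
  by apply/measurable_EFinP; case: (bm_cpred n).
pose LF : {mfun T >-> R} := HB.pack L (isMeasurableFun.Build _ _ _ _ L mL).
exists LF => /=.
near=> w.
have cq : cvgn (cpred ^~ w) by near: w; exact: cpred_ae_cvg.
have ZE : forall n, (0 < n)%N -> Z n w = cpred n w by near: w; exact: cond_exp_cpred_all.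
have -> : L w = limn (cpred ^~ w).
  have lq : (cpred n w)%:E @[n --> \oo] --> (limn (cpred ^~ w))%:E.
    by apply: cvg_EFin => //; apply: nearW.
  by rewrite /L is_cvg_limn_esupE; [rewrite (cvg_lim _ lq)|apply/cvg_ex; eexists; exact: lq].
apply: cvg_trans cq; apply: near_eq_cvg; near=> n.
by rewrite ZE//; near: n; exact: nbhs_infty_gt.
Unshelve. all: by end_near. Qed.

Lemma adapted_hit_mean n : adapted Y n (hit_mean R Y A n).
Proof.
move=> w w' ww; rewrite /hit_mean !big_nat; congr (_ * _); apply: eq_bigr => k kn.
by rewrite /hit (@adapted_Y _ _ _ Y n k kn _ _ ww).
Qed.

Definition freq_cst : R := 2 * (`|theta| + #|S|%:R).

(** Multiplied by [n], both sides count the draws in [A], up to [theta * cpred],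
    the discounts and the weight of new values. *)
Lemma hit_mean_cpred n w : (0 < n)%N -> `|hit_mean R Y A n w - cpred n w| <= freq_cst / n%:R.
Proof.
move=> n0; have nr : 0 < n%:R :> R by rewrite ltr0n.
have hE : n%:R * hit_mean R Y A n w = \sum_(y in A) (occ Y n y w)%:R :> R.
  rewrite /hit_mean mulrA mulfV ?gt_eqF// mul1r /hit.
  under eq_bigr do rewrite -sum_indicator.
  rewrite exchange_big/=; apply: eq_bigr => y _.
  by rewrite /occ natr_sum.
have pE := pred_numeratorE P Y alpha_bounds theta_bound A w n0.
have sE : \sum_(y in A) ((occ Y n y w)%:R - alpha) * seen R Y n y w =
    \sum_(y in A) (occ Y n y w)%:R - alpha * \sum_(y in A) seen R Y n y w.
  rewrite mulr_sumr -sumrB; apply: eq_bigr => y _.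
  by rewrite mulrBl occ_seen.
rewrite sE -hE -cpredE// in pE.
have /andP[b0 bS] := blocks_le R Y n w.
have /andP[s0 sS] : 0 <= \sum_(y in A) seen R Y n y w <= #|S|%:R.
  apply/andP; split; first by apply: sumr_ge0 => y _; rewrite ler0n.
  apply: le_trans bS; rewrite /blocks big_mkcond/= ler_sum// => y _.
  by case: ifP => // _; rewrite ler0n.
have /andP[nu0 nu1] := law1_01 P mY A.
have /andP[q0 q1] := cpred01 n w.
have /andP[a0 /ltW a1] := alpha_bounds.
rewrite ler_pdivlMr// -[n%:R in leLHS](ger0_norm (ltW nr)) -normrM.
move: (cpred n w) (hit_mean R Y A n w) (law1 P Y A) (blocks R Y n w)
  (\sum_(y in A) seen R Y n y w) pE b0 bS s0 sS nu0 nu1 q0 q1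
  => x h v b s pE b0 bS s0 sS v0 v1 x0 x1.
have -> : (h - x) * n%:R = theta * x + alpha * s - theta * v - alpha * b * v.
  rewrite (_ : (h - x) * n%:R = n%:R * h - (theta + n%:R) * x + theta * x); last by ring.
  by rewrite pE; ring.
have t1 : `|theta * x| <= `|theta| by rewrite normrM ler_piMr// ger0_norm.
have t2 : `|theta * v| <= `|theta| by rewrite normrM ler_piMr// ger0_norm.
have t3 : 0 <= alpha * s <= #|S|%:R.
  by rewrite mulr_ge0//=; apply: le_trans sS; rewrite ler_piMl.
have t4 : 0 <= alpha * b * v <= #|S|%:R.
  rewrite !mulr_ge0//=; apply: le_trans bS; rewrite mulrAC ler_piMl//.
  by rewrite mulr_ile1.
move: t1 t2 t3 t4; rewrite /freq_cst !ler_norml => /andP[? ?] /andP[? ?] /andP[? ?] /andP[? ?].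
apply/andP; split; lra.
Qed.

(** [joint_mixing], with [Z n] and [Zlim] replaced by versions that have values
    in the unit interval. *)
Lemma predictions_stable_cvg (Zlim : {mfun T >-> R}) :
  {ae P, forall w, Z n w @[n --> \oo] --> Zlim w} ->
  stable_cvg P
    (fun n w => (Num.sqrt n%:R * (hit_mean R Y A n w - Z n w),
                 Num.sqrt n%:R * (Z n w - Zlim w)))
    (prod_kernel (kdirac (measurable_cst (0 : R)))
                 (gauss_kernel (Zlim * (1 - Zlim)))).
Proof.
move=> Zcvg; have [C C0 [q_step q_drift q_quad]] := cpred_increments.
have mZlim : measurable_fun setT Zlim by exact: measurable_funPT.
have mZ n : measurable_fun setT (Z n) by case: (bm_Z n).
have mq n : measurable_fun setT (cpred n) by case: (bm_cpred n).
have mhm n : measurable_fun setT (hit_mean R Y A n).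
  by have [] := adapted_bm mY (@adapted_hit_mean n).
have msc n (h : T -> R) : measurable_fun setT h ->
    measurable_fun setT (fun w => Num.sqrt n%:R * h w).
  by move=> mh; apply: measurable_funM => //; exact: measurable_cst.
split=> [n|H mH H0 f cf [N [_ fN]]].
  by apply/measurable_fun_pairP; split; apply: msc; exact: measurable_funB.
have [M fM] : exists M : R, forall p, `|f p| <= M.
  by exists (N + 1) => p; apply: (fN (N + 1)) => //; rewrite ltrDl.
have mf := continuous_measurable_fun2 cf.
have bf : bm f by split => //; exists M.
have bf0 : bm (fun y => f (0, y)) by exact: (bm_comp (pair1_measurable (0 : R)) bf).
pose Z0 w := clamp (Zlim w).
have mZ0 : measurable_fun setT Z0 by exact: (measurableT_comp measurable_clamp).
have Z01 w : 0 <= Z0 w <= 1 by exact: clamp01.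
have qZlim : {ae P, forall w, cpred n w @[n --> \oo] --> Zlim w}.
  near=> w.
  have ZE : forall n, (0 < n)%N -> Z n w = cpred n w by near: w; exact: cond_exp_cpred_all.
  have Zw : Z n w @[n --> \oo] --> Zlim w by near: w.
  apply: cvg_trans Zw; apply: near_eq_cvg; near=> n.
  by rewrite ZE//; near: n; exact: nbhs_infty_gt.
have ZlimE : {ae P, forall w, Zlim w = Z0 w}.
  move: qZlim; apply: filterS => w qw; rewrite /Z0 clampE//; apply/andP; split.
    by apply: (cvgr_to_ge qw); apply: nearW => n; have /andP[] := cpred01 n w.
  by apply: (cvgr_to_le qw); apply: nearW => n; have /andP[] := cpred01 n w.
have qZ0 : {ae P, forall w, cpred n w @[n --> \oo] --> Z0 w}.
  by near=> w; rewrite -(_ : Zlim w = Z0 w); near: w.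
pose c n w : R := Num.sqrt n%:R * (hit_mean R Y A n w - cpred n w).
have mc n : measurable_fun setT (c n) by apply: msc; exact: measurable_funB.
have cB n w : (0 < n)%N -> `|c n w| <= freq_cst / Num.sqrt n%:R.
  move=> n0; have nr : 0 < n%:R :> R by rewrite ltr0n.
  have s0 : 0 < Num.sqrt n%:R :> R by rewrite sqrtr_gt0.
  rewrite /c normrM ger0_norm ?(ltW s0)//.
  apply: (le_trans (ler_wpM2l (ltW s0) (hit_mean_cpred w n0))).
  move: s0 (sqr_sqrtr (ltW nr)); move: (Num.sqrt _) => s s0 <-.
  by apply: le_of_eq; field; rewrite gt_eqF.
have := joint_mixing mY adapted_cpred cpred01 C0 q_step q_drift q_quad mZ0 Z01 qZ0 mc cB cf fM mH.
set G := fun w => gauss_avg (clamp (Z0 w * (1 - Z0 w))) (fun y => f (0, y)) 0.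
have bH := bm_indic R mH.
have bG : bm G.
  apply: bm_gauss_avg_var => //; apply: (measurableT_comp measurable_clamp).
  by apply: measurable_funM => //; apply: measurable_funB => //; exact: measurable_cst.
have bF n : bm (fun w => f (c n w, Num.sqrt n%:R * (cpred n w - Z0 w))).
  apply: (@bm_comp _ _ _ _ _ (fun w => (c n w, Num.sqrt n%:R * (cpred n w - Z0 w))) _ _ bf).
  apply/measurable_fun_pairP; split; first exact: mc.
  by apply: msc; exact: measurable_funB.
move=> lim0.
have lim1 : \int[P]_w (\1_H w * f (c n w, Num.sqrt n%:R * (cpred n w - Z0 w))) @[n --> \oo]
    --> \int[P]_w (\1_H w * G w).
  rewrite -[X in _ --> X]add0r (_ : (fun n => _) = (fun n =>
      \int[P]_w (\1_H w * (f (c n w, Num.sqrt n%:R * (cpred n w - Z0 w)) - G w)) +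
      \int[P]_w (\1_H w * G w))).
    by apply: cvgD; [exact: lim0|exact: cvg_cst].
  apply/funext => n; rewrite -ED; [|apply/bm_integ/bmM/bmB => //|exact/bm_integ/bmM].
  by apply: eq_Rintegral => w _; ring.
pose X n w : R * R := (Num.sqrt n%:R * (hit_mean R Y A n w - Z n w),
                       Num.sqrt n%:R * (Z n w - Zlim w)).
have mX n : measurable_fun setT (X n).
  by apply/measurable_fun_pairP; split; apply: msc; exact: measurable_funB.
have lim2 : \int[P]_w (\1_H w * f (X n w)) @[n --> \oo] -->
    \int[P]_w (\1_H w * gauss_avg ((Zlim * (1 - Zlim)) w) (fun y => f (0, y)) 0).
  rewrite (_ : \int[P]_w (\1_H w * gauss_avg _ _ 0) = \int[P]_w (\1_H w * G w)).
    apply: cvg_trans lim1; apply: near_eq_cvg; near=> n.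
    have n0 : (0 < n)%N by near: n; exact: nbhs_infty_gt.
    apply: E_ae.
    - by case: (bmM bH (bF n)).
    - by case: (bmM bH (bm_comp (mX n) bf)).
    - near=> w; rewrite /X /c (_ : Zlim w = Z0 w); last by near: w.
      by rewrite (_ : Z n w = cpred n w)//; near: w; exact: cond_exp_cpred.
  apply: E_ae.
  - have mL : measurable_fun setT (Zlim * (1 - Zlim) : T -> R) by exact: measurable_funPT.
    by case: (bmM bH (bm_gauss_avg_var 0 mL bf0)).
  - by case: (bmM bH bG).
  - near=> w; congr (_ * gauss_avg _ _ _).
    have -> : (Zlim * (1 - Zlim)) w = Zlim w * (1 - Zlim w) by [].
    rewrite (_ : Zlim w = Z0 w); last by near: w.
    by rewrite clampE//; have := Z01 w; move: (Z0 w) => z /andP[? ?]; apply/andP; split; nra.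
rewrite (integral_cond_mixture mH H0 _ bf).
under eq_fun do rewrite (integral_cond_law mH H0 (mX _) bf).
apply: cvg_EFin; first by apply: nearW.
by apply: cvgMr.
Unshelve. all: by end_near. Qed.

End predictions.

Theorem corollary6 (R : realType) (d : measure_display) (T : measurableType d)
    (P : probability T R) (S : finType) (alpha theta : R)
    (Y : nat -> T -> S) (A : {set S}) (Z : nat -> T -> R)
    (alpha_bounds : 0 <= alpha < 1)
    (theta_bound : - alpha < theta)
    (mY : forall (n : nat) (B : {set S}), (0 < n)%N ->
      measurable (Y n @^-1` [set` B]))
    (predY : forall (B : {set S}) (n : nat), (0 < n)%N ->
      exists2 V : T -> R,
        is_cond_exp P (past Y n) (hit R Y B n.+1) V &
        {ae P, forall w, V w = predictive P Y alpha theta B n w})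
    (Z_def : forall n : nat,
      is_cond_exp P (past Y n) (hit R Y A n.+1) (Z n)) :
  (forall W : nat -> T -> R,
     (forall n : nat, is_cond_exp P (past Y n) (Z n.+1) (W n)) ->
     (forall n : nat, 'E_P[fun w => ((W n w - Z n w) ^+ 2)%R]%E \is a fin_num) /\
     (fun n : nat => fine 'E_P[fun w => ((W n w - Z n w) ^+ 2)%R]%E)
       =o_\oo (fun n : nat => (n%:R ^- 3 : R))) /\
  (exists Zlim : {mfun T >-> R},
     {ae P, forall w, Z n w @[n --> \oo] --> Zlim w}) /\
  (forall Zlim : {mfun T >-> R},
     {ae P, forall w, Z n w @[n --> \oo] --> Zlim w} ->
     stable_cvg P
       (fun n w => (Num.sqrt n%:R * (hit_mean R Y A n w - Z n w),
                    Num.sqrt n%:R * (Z n w - Zlim w)))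
       (prod_kernel (kdirac (measurable_cst (0 : R)))
                    (gauss_kernel (Zlim * (1 - Zlim))))).
Proof.
split=> [W|]; first exact: (drift_littleo alpha_bounds theta_bound mY predY Z_def).
split; first exact: (predictions_ae_cvg alpha_bounds theta_bound mY predY Z_def).
exact: (predictions_stable_cvg alpha_bounds theta_bound mY predY Z_def).
Qed.
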